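(* Let $U$ be a left bialgebroid over $A$ and let $N$ be a braided commutative Yetter-Drinfel'd algebra over $U$. Then the cohomology groups $H^\bullet_{\mathrm{co}}(U,N)$ carry the structure of a Gerstenhaber algebra (with the cup product and bracket specified in the context). In particular, if $U_\triangleleft$ is flat as a right $A$-module, then $\mathrm{Cotor}^\bullet_U(A,N)\simeq H^\bullet_{\mathrm{co}}(U,N)$ is a Gerstenhaber algebra.
   Context: **Bialgebroids.** $k$ is a commutative ring, unadorned tensor products are over $k$, algebras are unital associative. Let $A,U$ be $k$-algebras with a $k$-algebra map $\eta:A\otimes A^{\mathrm{op}}\to U$; put $s(a)=\eta(a\otimes1)$, $t(a)=\eta(1\otimes a)$. A left $U$-module $N$ is an $A$-bimodule via $a\triangleright n\triangleleft b:=s(a)t(b)n$; this applies to $U$. $U\otimes_A U:=U_\triangleleft\otimes_A{}_\triangleright U$ (so $t(a)u\otimes v=u\otimes s(a)v$). $U$ is a left bialgebroid over $A$ if it carries $A$-bimodule maps (for $\triangleright,\triangleleft$) $\Delta:U\to U\otimes_AU$, $u\mapsto u_{(1)}\otimes_Au_{(2)}$, and $\varepsilon:U\to A$ making it a coassociative counital coalgebra in $A$-bimodules, such that $\Delta$ takes values in $\{\sum u_i\otimes_Av_i:\ \sum u_it(a)\otimes_A v_i=\sum u_i\otimes_A v_is(a)\ \forall a\in A\}$ and is a unital algebra map into it, $\varepsilon(1)=1$, and $\varepsilon(uv)=\varepsilon(us(\varepsilon(v)))=\varepsilon(ut(\varepsilon(v)))$. **Yetter-Drinfel'd algebras.** A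 left $U$-comodule is a left $A$-module $N$ with a coassociative counital left $A$-linear map $\Delta_N:N\to U_\triangleleft\otimes_AN$, $n\mapsto n_{(-1)}\otimes_An_{(0)}$; induced right $A$-action $na:=\varepsilon(n_{(-1)}t(a))n_{(0)}$; iterated coactions are $n_{(-p)}\otimes_A\cdots\otimes_An_{(-1)}\otimes_An_{(0)}$. A Yetter-Drinfel'd module is a left $U$-module and left $U$-comodule whose two $A$-bimodule structures coincide and with $(u_{(1)}n)_{(-1)}u_{(2)}\otimes_A(u_{(1)}n)_{(0)}=u_{(1)}n_{(-1)}\otimes_Au_{(2)}n_{(0)}$. A Yetter-Drinfel'd algebra is such an $N$ that is also an $A$-ring (product $\cdot_N$, unit $1_N$) with $u(n\cdot_Nn')=(u_{(1)}n)\cdot_N(u_{(2)}n')$, $u1_N=\varepsilon(u)\triangleright1_N=1_N\triangleleft\varepsilon(u)$, $\Delta_N(1_N)=1_U\otimes_A1_N$, $\Delta_N(n\cdot_Nn')=n_{(-1)}n'_{(-1)}\otimes_An_{(0)}\cdot_Nn'_{(0)}$; it is braided commutative if $n\cdot_Nn'=(n_{(-1)}n')\cdot_Nn_{(0)}$. **The complex and its operations.** $C^p_{\mathrm{co}}(U,N)=U^{\otimes_Ap}\otimes_AN$, elementary tensors $(u^1,\dots,u^p,n)$. $H^\bullet_{\mathrm{co}}(U,N)$ is its cohomology for $\beta=\sum_{i=0}^{n+1}(-1)^i\delta_i$, where $\delta_0(u^1,\dots,u^n,m)=(1,u^1,\dots,u^n,m)$, $\delta_i(u^1,\dots,u^n,m)=(u^1,\dots,\Delta(u^i),\dots,u^n,m)$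 for $1\le i\le n$, $\delta_{n+1}(u^1,\dots,u^n,m)=(u^1,\dots,u^n,m_{(-1)},m_{(0)})$. $\mathrm{Cotor}_U^\bullet(A,-)$ denotes the right derived functors of the cotensor product $A\,\square_U-$ on left $U$-comodules, $A$ being the right comodule with coaction $a\mapsto1_A\otimes_At(a)$. For $i=1,\dots,p$, $$(u^1,\dots,u^p,n)\circ_i(v^1,\dots,v^q,n'):=\big(u^1,\dots,u^{i-1},u^i_{(1)}v^1,\dots,u^i_{(q)}v^q,(u^i_{(q+1)}n')_{(-p+i)}u^{i+1},\dots,(u^i_{(q+1)}n')_{(-1)}u^p,(u^i_{(q+1)}n')_{(0)}\cdot_Nn\big)$$ (for $q=0$: $u^i_{(1)}v^1,\dots,u^i_{(q)}v^q$ is omitted and $u^i_{(q+1)}$ is read as $u^i$), and $n\circ_i(\cdot)=0$ for $n\in N$. With $|n|:=n-1$: $\varphi\bar\circ\psi=(-1)^{|p||q|}\sum_{i=1}^p(-1)^{|q||i|}\varphi\circ_i\psi$, $\{\varphi,\psi\}=\varphi\bar\circ\psi-(-1)^{|p||q|}\psi\bar\circ\varphi$ for $\varphi$ of degree $p$, $\psi$ of degree $q$, and $(u^1,\dots,u^p,m)\smile(v^1,\dots,v^q,n)=(u^1,\dots,u^p,m_{(-q)}v^1,\dots,m_{(-1)}v^q,m_{(0)}\cdot_Nn)$. **Gerstenhaber algebra.** A graded commutative $k$-algebra $V=\bigoplus_{p\ge0}V^p$ with a graded Lie bracket $V^{p+1}\otimes V^{q+1}\to V^{p+q+1}$ on $V[1]=\bigoplus_pV^{p+1}$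 satisfying $\{\gamma,\alpha\smile\beta\}=\{\gamma,\alpha\}\smile\beta+(-1)^{pq}\alpha\smile\{\gamma,\beta\}$ for $\gamma\in V^{p+1},\alpha\in V^q$. *)

(* Defs.v *)
From HB Require Import structures.
From mathcomp Require Import all_boot all_algebra.
From mathcomp Require Import boolp.

Set Implicit Arguments.
Unset Strict Implicit.
Unset Printing Implicit Defensive.

Import GRing.Theory.
Local Open Scope ring_scope.
Local Open Scope quotient_scope.

Definition mklinear (R : pzRingType) (V W : lmodType R) (f : V -> W)
  (Hf : linear f) : {linear V -> W} :=
  HB.pack f (GRing.isLinear.Build R V W *:%R f Hf).

(* Unital associative algebras over k, given by a ring map from k to the      *)
(* centre.  (The library's algType excludes the zero algebra.)                *)
HB.mixin Record isKAlgebra (k : comPzRingType) A of GRing.PzRing A := {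
  kalg : {rmorphism k -> A};
  kalgC : forall (c : k) (x : A), kalg c * x = x * kalg c
}.

#[short(type="kalgType")]
HB.structure Definition KAlgebra (k : comPzRingType) :=
  {A of isKAlgebra k A & GRing.PzRing A}.

Section Restriction.
Variables (k : comPzRingType) (A : kalgType k) (X : lmodType A).

Definition restr : Type := X.
HB.instance Definition _ := GRing.Zmodule.on restr.

Definition restr_scale (c : k) (x : restr) : restr := (kalg c : A) *: (x : X).

Fact restr_scaleA a b x : restr_scale a (restr_scale b x) = restr_scale (a * b) x.
Proof. by rewrite /restr_scale scalerA rmorphM. Qed.
Fact restr_scale1 : left_id 1 restr_scale.
Proof. by move=> x; rewrite /restr_scale rmorph1 scale1r. Qed.
Fact restr_scaleDr : right_distributive restr_scale +%R.
Proof. by move=> c x y; rewrite /restr_scale scalerDr. Qed.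
Fact restr_scaleDl x : {morph restr_scale^~ x : a b / a + b}.
Proof. by move=> a b; rewrite /restr_scale rmorphD scalerDl. Qed.
HB.instance Definition _ := GRing.Zmodule_isLmodule.Build k restr
  restr_scaleA restr_scale1 restr_scaleDr restr_scaleDl.
End Restriction.

Section Kernel.
Variables (R : pzRingType) (V W : lmodType R) (f : {linear V -> W}).

Definition ker_pred : {pred V} := fun x => f x == 0.

Lemma ker_submod_closed : GRing.submod_closed ker_pred.
Proof.
split=> [|a x y]; rewrite !unfold_in ?raddf0 // => /eqP fx /eqP fy.
by rewrite linearP fx fy scaler0 addr0.
Qed.
HB.instance Definition _ := GRing.isSubmodClosed.Build R V ker_pred
  (GRing.submod_closed_semi ker_submod_closed).

Record kernel : predArgType :=
  Kernel { kerval :> V; kervalP : kerval \in ker_pred }.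
HB.instance Definition _ := [isSub for kerval].
HB.instance Definition _ := [Choice of kernel by <:].
HB.instance Definition _ := [SubChoice_isSubLmodule of kernel by <:].
End Kernel.

Section QuotientModule.
Variables (R : pzRingType) (V : lmodType R) (S : {pred V}).
Hypothesis S_closed : GRing.submod_closed S.

Definition quotmod_pred : zmodClosed V :=
  HB.pack S (GRing.isZmodClosed.Build V S (GRing.submod_closedB S_closed)).

Definition quotmod := Quotient.quot quotmod_pred.
HB.instance Definition _ := GRing.Zmodule.on quotmod.

Definition quotmod_pi (x : V) : quotmod := \pi_(Quotient.quot quotmod_pred) x.

Definition quotmod_scale (a : R) (x : quotmod) : quotmod :=
  quotmod_pi (a *: repr x).

Lemma quotmod_piP x y : quotmod_pi x = quotmod_pi y <-> x - y \in S.
Proof.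
rewrite /quotmod_pi; split=> [/eqP|xy]; last apply/eqP.
  by rewrite -Quotient.idealrBE.
by rewrite -Quotient.idealrBE.
Qed.

Lemma quotmod_piD x y : quotmod_pi (x + y) = quotmod_pi x + quotmod_pi y.
Proof. by rewrite /quotmod_pi !piE. Qed.

Lemma quotmod_piZ a x : quotmod_pi (a *: x) = quotmod_scale a (quotmod_pi x).
Proof.
apply/quotmod_piP; rewrite -scalerBr -[_ *: _]addr0.
case: S_closed => S0 Slin; apply: Slin => //.
by apply/quotmod_piP; rewrite /quotmod_pi reprK.
Qed.

Lemma quotmod_ind (P : quotmod -> Prop) :
  (forall x, P (quotmod_pi x)) -> forall x, P x.
Proof. by move=> Ppi x; rewrite -[x]reprK; apply: Ppi. Qed.

Fact quotmod_scaleA a b x :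
  quotmod_scale a (quotmod_scale b x) = quotmod_scale (a * b) x.
Proof. by elim/quotmod_ind: x => x; rewrite -!quotmod_piZ scalerA. Qed.
Fact quotmod_scale1 : left_id 1 quotmod_scale.
Proof. by elim/quotmod_ind=> x; rewrite -quotmod_piZ scale1r. Qed.
Fact quotmod_scaleDr : right_distributive quotmod_scale +%R.
Proof.
move=> a; elim/quotmod_ind=> x; elim/quotmod_ind=> y.
by rewrite -quotmod_piD -!quotmod_piZ scalerDr quotmod_piD.
Qed.
Fact quotmod_scaleDl x : {morph quotmod_scale^~ x : a b / a + b}.
Proof.
elim/quotmod_ind: x => x a b.
by rewrite -!quotmod_piZ scalerDl quotmod_piD.
Qed.
HB.instance Definition _ := GRing.Zmodule_isLmodule.Build R quotmod
  quotmod_scaleA quotmod_scale1 quotmod_scaleDr quotmod_scaleDl.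
End QuotientModule.

Record cochain_complex (R : pzRingType) := CochainComplex {
  cc_obj :> nat -> lmodType R;
  cc_d : forall n, {linear cc_obj n -> cc_obj n.+1};
  cc_dd : forall n (x : cc_obj n), cc_d n.+1 (cc_d n x) = 0
}.

Section Cohomology.
Variables (R : pzRingType) (C : cochain_complex R).

Definition coboundary n : C n -> Prop :=
  match n with
  | 0 => fun x => x = 0
  | m.+1 => fun x => exists y : C m, x = cc_d C m y
  end.

Definition cocycles n := kernel (cc_d C n).

Definition cobnd_pred n : {pred cocycles n} := fun z => `[< coboundary (val z) >].

Lemma cobnd_submod_closed n : GRing.submod_closed (@cobnd_pred n).
Proof.
case: n => [|n]; split.
- by apply/asboolP.
- move=> a x y /asboolP /= x0 /asboolP /= y0; apply/asboolP => /=.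
  by rewrite x0 y0 scaler0 addr0.
- by apply/asboolP; exists 0; rewrite /= raddf0.
- move=> a x y /asboolP /= [u xu] /asboolP /= [v yv]; apply/asboolP => /=.
  by exists (a *: u + v); rewrite linearP xu yv.
Qed.

Definition cohomology n : lmodType R := quotmod (@cobnd_submod_closed n).

Definition has_class n (x : C n) (h : cohomology n) : Prop :=
  exists z : cocycles n, val z = x /\ h = quotmod_pi _ z.
End Cohomology.

(* (S, A)-bimodules: left S-modules with a commuting right A-action           *)
Record bimod (S A : pzRingType) := Bimod {
  bm_sort :> lmodType S;
  ract : bm_sort -> A -> bm_sort;
  ractDl : forall m m' a, ract (m + m') a = ract m a + ract m' a;
  ractDr : forall m a b, ract m (a + b) = ract m a + ract m b;
  ractA : forall m a b, ract m (a * b) = ract (ract m a) b;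
  ract1 : forall m, ract m 1 = m;
  ractZ : forall s m a, ract (s *: m) a = s *: ract m a
}.

Section TensorProduct.
Variables (S A : pzRingType) (M : bimod S A) (X : lmodType A).

(* A finite formal sum of pairs (m, x) is a sequence of such pairs; this is   *)
(* the congruence that the defining relations of M (x)_A X generate on them.  *)
Inductive tens_eq : seq (M * X) -> seq (M * X) -> Prop :=
| teq_refl s : tens_eq s s
| teq_sym s t : tens_eq s t -> tens_eq t s
| teq_trans s t u : tens_eq s t -> tens_eq t u -> tens_eq s u
| teq_cat s s' t t' : tens_eq s s' -> tens_eq t t' -> tens_eq (s ++ t) (s' ++ t')
| teq_catC s t : tens_eq (s ++ t) (t ++ s)
| teq_0 x : tens_eq [:: (0, x)] [::]
| teq_Dl m m' x : tens_eq [:: (m + m', x)] [:: (m, x); (m', x)]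
| teq_Dr m x x' : tens_eq [:: (m, x + x')] [:: (m, x); (m, x')]
| teq_bal m a x : tens_eq [:: (ract m a, x)] [:: (m, a *: x)].

Definition tens_eqb (s t : seq (M * X)) := `[< tens_eq s t >].

Lemma tens_eqb_equiv : equiv_class_of tens_eqb.
Proof.
split=> [s|s t|t s u].
- by apply/asboolP; apply: teq_refl.
- by apply/asboolP/asboolP; apply: teq_sym.
- by move=> /asboolP st /asboolP tu; apply/asboolP; apply: teq_trans st tu.
Qed.
Canonical tens_equiv := EquivRelPack tens_eqb_equiv.
Canonical tens_encModRel := defaultEncModRel tens_eqb.

Definition tens := {eq_quot tens_eqb}.
HB.instance Definition _ := Choice.on tens.

Definition tpi (s : seq (M * X)) : tens := \pi_({eq_quot tens_eqb}) s.
Definition trep (z : tens) : seq (M * X) := repr z.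
Definition ot (m : M) (x : X) : tens := tpi [:: (m, x)].

Definition tadd (z w : tens) := tpi (trep z ++ trep w).
Definition topp (z : tens) := tpi [seq (- p.1, p.2) | p <- trep z].
Definition tscale (a : S) (z : tens) := tpi [seq (a *: p.1, p.2) | p <- trep z].

Lemma trepK z : tpi (trep z) = z. Proof. exact: reprK. Qed.

Lemma tpiP s t : tpi s = tpi t <-> tens_eq s t.
Proof.
rewrite /tpi; split=> [/eqP|st]; first by rewrite piE => /asboolP.
by apply/eqP; rewrite piE; apply/asboolP.
Qed.

Lemma trep_pi s : tens_eq (trep (tpi s)) s.
Proof. by apply/tpiP; rewrite trepK. Qed.

Lemma teq_map (f : M -> M) : {morph f : m m' / m + m'} ->
    (forall m a, f (ract m a) = ract (f m) a) -> forall s t, tens_eq s t ->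
  tens_eq [seq (f p.1, p.2) | p <- s] [seq (f p.1, p.2) | p <- t].
Proof.
move=> fD fA s t; have f0 : f 0 = 0 by apply: (@addrI _ (f 0)); rewrite -fD !addr0.
elim=> {s t} [s|s t _ IH|s t u _ IH1 _ IH2|s s' t t' _ IH1 _ IH2|s t|x|m m' x|m x x'|m a x];
  rewrite ?map_cat /= ?f0 ?fD ?fA.
- exact: teq_refl.
- exact: teq_sym.
- exact: teq_trans IH1 IH2.
- exact: teq_cat.
- exact: teq_catC.
- exact: teq_0.
- exact: teq_Dl.
- exact: teq_Dr.
- exact: teq_bal.
Qed.

Lemma tpi_cat s t : tpi (s ++ t) = tadd (tpi s) (tpi t).
Proof. by apply/tpiP; apply: teq_cat; apply/teq_sym/trep_pi. Qed.

Lemma tpi_scale a s : tpi [seq (a *: p.1, p.2) | p <- s] = tscale a (tpi s).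
Proof.
apply/tpiP; apply: teq_map (teq_sym (trep_pi _)).
- by move=> m m'; rewrite scalerDr.
- by move=> m b; rewrite ractZ.
Qed.

Lemma tens_pi_ind (P : tens -> Prop) : (forall s, P (tpi s)) -> forall z, P z.
Proof. by move=> H z; rewrite -[z]trepK. Qed.

Fact taddA : associative tadd.
Proof.
by do 3!elim/tens_pi_ind=> ?; rewrite -!tpi_cat catA.
Qed.
Fact taddC : commutative tadd.
Proof.
by do 2!elim/tens_pi_ind=> ?; rewrite -!tpi_cat; apply/tpiP; apply: teq_catC.
Qed.
Fact tadd0 : left_id (tpi [::]) tadd.
Proof. by elim/tens_pi_ind=> s; rewrite -tpi_cat. Qed.
Fact taddN : left_inverse (tpi [::]) topp tadd.
Proof.
move=> z; rewrite /topp -{2}[z]trepK -tpi_cat; apply/tpiP.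
elim: (trep z) => [|[m x] s IH] /=; first exact: teq_refl.
rewrite -cat1s -[(m, x) :: s]cat1s.
apply: (@teq_trans _ ([:: (- m, x)] ++ ([:: (m, x)] ++ ([seq (- p.1, p.2) | p <- s] ++ s)))).
  apply: teq_cat; first exact: teq_refl.
  rewrite !catA; apply: teq_cat; last exact: teq_refl.
  exact: teq_catC.
rewrite catA -[[::]]cats0; apply: teq_cat => //.
apply: teq_trans (teq_0 x); apply: teq_sym.
by rewrite -(addNr m); apply: teq_Dl.
Qed.
HB.instance Definition _ := GRing.isZmodule.Build tens taddA taddC tadd0 taddN.

Fact tscaleA a b z : tscale a (tscale b z) = tscale (a * b) z.
Proof.
elim/tens_pi_ind: z => s; rewrite -!tpi_scale -map_comp; congr tpi.
by apply: eq_map => p /=; rewrite scalerA.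
Qed.
Fact tscale1 : left_id 1 tscale.
Proof.
elim/tens_pi_ind=> s; rewrite -tpi_scale; congr tpi.
by rewrite -[RHS]map_id; apply: eq_map => -[m x] /=; rewrite scale1r.
Qed.
Fact tscaleDr : right_distributive tscale +%R.
Proof.
move=> a; do 2!elim/tens_pi_ind=> ?; rewrite -[_ + _]tpi_cat -!tpi_scale.
by rewrite -[_ + _]tpi_cat map_cat.
Qed.
Fact tscaleDl z : {morph tscale^~ z : a b / a + b}.
Proof.
elim/tens_pi_ind: z => s a b; rewrite -!tpi_scale -[tpi _ + tpi _]tpi_cat; apply/tpiP.
elim: s => [|[m x] s IH] /=; first exact: teq_refl.
rewrite -[_ :: (_ ++ _)]cat1s -[(b *: m, x) :: _]cat1s.
apply: (@teq_trans _ ([:: (a *: m, x)] ++ ([:: (b *: m, x)] ++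
  ([seq (a *: p.1, p.2) | p <- s] ++ [seq (b *: p.1, p.2) | p <- s])))); last first.
  apply: teq_cat; first exact: teq_refl.
  rewrite !catA; apply: teq_cat; last exact: teq_refl.
  exact: teq_catC.
rewrite -[_ :: _]cat1s catA; apply: teq_cat => //.
by rewrite scalerDl; apply: teq_Dl.
Qed.
HB.instance Definition _ := GRing.Zmodule_isLmodule.Build S tens
  tscaleA tscale1 tscaleDr tscaleDl.

Lemma otDl m m' x : ot (m + m') x = ot m x + ot m' x.
Proof. by rewrite -[RHS]tpi_cat; apply/tpiP/teq_Dl. Qed.
Lemma otDr m x x' : ot m (x + x') = ot m x + ot m x'.
Proof. by rewrite -[RHS]tpi_cat; apply/tpiP/teq_Dr. Qed.
Lemma ot_bal m a x : ot (ract m a) x = ot m (a *: x).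
Proof. exact/tpiP/teq_bal. Qed.
Lemma otZ a m x : ot (a *: m) x = a *: ot m x.
Proof. by rewrite -[RHS]tpi_scale. Qed.

Lemma ot0r m : ot m 0 = 0.
Proof. by apply: (@addrI _ (ot m 0)); rewrite -otDr !addr0. Qed.

Lemma tens_sumE z : z = \sum_(p <- trep z) ot p.1 p.2.
Proof.
rewrite -{1}[z]trepK; elim: (trep z) => [|[m x] s IH]; first by rewrite big_nil.
by rewrite big_cons -IH -cat1s tpi_cat.
Qed.

(* tsum z F is F summed over a chosen expression of z as a sum of elementary  *)
(* tensors (Sweedler notation); it depends only on z when F is balanced, and  *)
(* is then the map on M (x)_A X induced by F (tsum_ot, tsumD).  In nested     *)
(* sums below, the order is such that each sum is over a balanced function    *)
(* once the sums inside it are performed.                                     *)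
Definition tsum (z : tens) (V : zmodType) (F : M -> X -> V) : V :=
  \sum_(p <- trep z) F p.1 p.2.

Record balanced (V : zmodType) (F : M -> X -> V) : Prop := Balanced {
  balDl : forall m m' x, F (m + m') x = F m x + F m' x;
  balDr : forall m x x', F m (x + x') = F m x + F m x';
  balA : forall m a x, F (ract m a) x = F m (a *: x)
}.

Lemma tsum_pi (V : zmodType) (F : M -> X -> V) s : balanced F ->
  tsum (tpi s) F = \sum_(p <- s) F p.1 p.2.
Proof.
case=> FDl FDr FA; rewrite /tsum.
have F0 x : F 0 x = 0 by apply: (@addrI _ (F 0 x)); rewrite -FDl !addr0.
suff sum_eq t u : tens_eq t u ->
    \sum_(p <- t) F p.1 p.2 = \sum_(p <- u) F p.1 p.2 by apply/sum_eq/trep_pi.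
elim=> {s t u} //=.
- by move=> s t u _ -> _ ->.
- by move=> s s' t t' _ IH1 _ IH2; rewrite !big_cat /= IH1 IH2.
- by move=> s t; rewrite !big_cat /= addrC.
- by move=> x; rewrite big_seq1 big_nil F0.
- by move=> m m' x; rewrite !big_cons !big_nil /= !addr0 FDl.
- by move=> m x x'; rewrite !big_cons !big_nil /= !addr0 FDr.
- by move=> m a x; rewrite !big_cons !big_nil /= !addr0 FA.
Qed.

Lemma tsum_ot (V : zmodType) (F : M -> X -> V) m x : balanced F ->
  tsum (ot m x) F = F m x.
Proof. by move=> Fb; rewrite tsum_pi // big_seq1. Qed.

Lemma tsumD (V : zmodType) (F : M -> X -> V) : balanced F ->
  {morph (fun z => tsum z F) : z w / z + w}.
Proof.
move=> Fb; do 2!elim/tens_pi_ind=> ?; rewrite -[_ + _]tpi_cat !tsum_pi //.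
by rewrite big_cat.
Qed.

Lemma tsum_linear (V : lmodType S) (F : M -> X -> V) : balanced F ->
  (forall a m x, F (a *: m) x = a *: F m x) -> linear (fun z => tsum z F).
Proof.
move=> Fb FZ a z w; rewrite tsumD //; congr (_ + _).
elim/tens_pi_ind: z => s; rewrite -[a *: _]tpi_scale !tsum_pi // big_map.
by rewrite scaler_sumr; apply: eq_bigr => p _; rewrite FZ.
Qed.

Lemma tens_ind (P : tens -> Prop) : P 0 -> (forall z w, P z -> P w -> P (z + w)) ->
  (forall m x, P (ot m x)) -> forall z, P z.
Proof. by move=> P0 PD Pot z; rewrite [z]tens_sumE; elim/big_ind: _. Qed.

End TensorProduct.

Arguments ot {S A M X} m x.

Notation "\tsum_ ( m , x <- z ) F" := (tsum z (fun m x => F))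
  (at level 41, m name, x name, z at level 50, F at level 41,
   format "\tsum_ ( m ,  x  <-  z )  F") : ring_scope.

Section TensorMap.
Variables (S A : pzRingType) (M : bimod S A) (X Y : lmodType A) (f : {linear X -> Y}).

Lemma tmap_bal : balanced (fun (m : M) x => ot m (f x)).
Proof.
split=> [m m' x|m x x'|m a x]; first exact: otDl.
  by rewrite raddfD otDr.
by rewrite ot_bal linearZ.
Qed.

Lemma tmap_linear : linear (fun z : tens M X => \tsum_(m, x <- z) ot m (f x) : tens M Y).
Proof. by apply: tsum_linear => [|a m x]; [apply: tmap_bal|rewrite otZ]. Qed.

Definition tmap : {linear tens M X -> tens M Y} := mklinear tmap_linear.

Lemma tmap_ot m x : tmap (ot m x) = ot m (f x).
Proof. exact: (tsum_ot _ _ tmap_bal). Qed.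
End TensorMap.

Arguments tmap {S A} M {X Y} f.

Lemma tsum0 (S A : pzRingType) (M : bimod S A) (X : lmodType A) (V : zmodType)
  (F : M -> X -> V) : balanced F -> tsum 0 F = 0.
Proof. by move=> Fb; apply: (@addrI _ (tsum 0 F)); rewrite -tsumD // !addr0. Qed.

Lemma balanced_comp (S A : pzRingType) (M : bimod S A) (X Y : lmodType A)
    (V : zmodType) (F : M -> Y -> V) (f : {linear X -> Y}) :
  balanced F -> balanced (fun m x => F m (f x)).
Proof.
by case=> FDl FDr FA; split=> *; rewrite ?FDl ?raddfD ?FDr ?FA ?linearZ.
Qed.

Lemma tsum_tmap (S A : pzRingType) (M : bimod S A) (X Y : lmodType A)
    (V : zmodType) (F : M -> Y -> V) (f : {linear X -> Y}) z : balanced F ->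
  tsum (tmap M f z) F = \tsum_(m, x <- z) F m (f x).
Proof.
move=> Fb; have Ffb := balanced_comp f Fb.
elim/tens_ind: z => [|z w IHz IHw|m x]; first by rewrite raddf0 !tsum0.
  by rewrite raddfD !tsumD // IHz IHw.
by rewrite tmap_ot !tsum_ot.
Qed.

Lemma tmap_sq (S A : pzRingType) (M : bimod S A) (X Y Y' Z : lmodType A)
    (f : {linear X -> Y}) (g : {linear Y -> Z})
    (f' : {linear X -> Y'}) (g' : {linear Y' -> Z}) :
  (forall x, g (f x) = g' (f' x)) ->
  forall z, tmap M g (tmap M f z) = tmap M g' (tmap M f' z).
Proof.
move=> e; elim/tens_ind=> [|z w IHz IHw|u x]; first by rewrite !raddf0.
  by have := f_equal2 +%R IHz IHw; rewrite !raddfD.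
by rewrite !tmap_ot e.
Qed.

Lemma tmap_tsum (S A : pzRingType) (M : bimod S A) (X Y : lmodType A)
    (f : {linear X -> Y}) (S' A' : pzRingType) (P : bimod S' A') (Z : lmodType A')
    (z : tens P Z) (F : P -> Z -> tens M X) :
  tmap M f (tsum z F) = \tsum_(u, v <- z) tmap M f (F u v).
Proof. exact: raddf_sum. Qed.

(* Transport along m = n, and 0 when m and n differ                           *)
Definition degcast (R : pzRingType) (V : nat -> lmodType R) (n m : nat) (x : V m) :
    V n :=
  match m =P n with
  | ReflectT e => eq_rect m (fun i => V i) x n e
  | ReflectF _ => 0
  end.
Arguments degcast {R} V n {m} x.

Section Gerstenhaber.
Variables (k : comPzRingType) (V : nat -> lmodType k).

(* The bracket of V^p and V^q lies in V^(p+q-1), which is 0 for p = q = 0     *)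
(* (g_br00); so all terms below that would have negative degree are 0, and    *)
(* the other casts are between equal degrees.  In signs p - 1 is encoded by   *)
(* p + 1.                                                                     *)
Record gerstenhaber := Gerstenhaber {
  g_mul : forall p q, V p -> V q -> V (p + q)%N;
  g_one : V 0%N;
  g_br : forall p q, V p -> V q -> V (p + q).-1;
  g_mul_linl : forall p q (y : V q), linear (fun x : V p => g_mul x y);
  g_mul_linr : forall p q (x : V p), linear (g_mul x : V q -> _);
  g_mulA : forall p q r (x : V p) (y : V q) (z : V r),
    degcast V (p + q + r) (g_mul x (g_mul y z)) = g_mul (g_mul x y) z;
  g_mul1x : forall p (x : V p), g_mul g_one x = x;
  g_mulx1 : forall p (x : V p), degcast V p (g_mul x g_one) = x;
  g_mulC : forall p q (x : V p) (y : V q),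
    g_mul x y = (-1) ^+ (p * q) *: degcast V (p + q) (g_mul y x);
  g_br_linl : forall p q (y : V q), linear (fun x : V p => g_br x y);
  g_br_linr : forall p q (x : V p), linear (g_br x : V q -> _);
  g_br00 : forall x y : V 0%N, g_br x y = 0;
  g_brC : forall p q (x : V p) (y : V q),
    g_br x y = - ((-1) ^+ (p.+1 * q.+1) *: degcast V (p + q).-1 (g_br y x));
  g_jacobi : forall p q r (x : V p) (y : V q) (z : V r),
    let J := @degcast k V (p + q + r).-2 in
    J _ (g_br x (g_br y z)) =
    J _ (g_br (g_br x y) z) + (-1) ^+ (p.+1 * q.+1) *: J _ (g_br y (g_br x z));
  g_leibniz : forall p q r (c : V p) (x : V q) (y : V r),
    let L := @degcast k V (p + q + r).-1 in
    L _ (g_br c (g_mul x y)) =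
    L _ (g_mul (g_br c x) y) + (-1) ^+ (p.+1 * q) *: L _ (g_mul x (g_br c y))
}.
End Gerstenhaber.

Definition gerstenhaber_morphism (k : comPzRingType) (V W : nat -> lmodType k)
    (G : gerstenhaber V) (H : gerstenhaber W)
    (f : forall n, {linear V n -> W n}) : Prop :=
  [/\ f 0%N (g_one G) = g_one H,
      forall p q (x : V p) (y : V q),
        f _ (g_mul G x y) = g_mul H (f p x) (f q y)
    & forall p q (x : V p) (y : V q),
        f _ (g_br G x y) = g_br H (f p x) (f q y)].

Section CentralBimodule.
Variables (k : comPzRingType) (V : lmodType k).

Fact cbimodA (v : V) a b : (a * b) *: v = b *: (a *: v).
Proof. by rewrite scalerA mulrC. Qed.
Fact cbimodZ a (v : V) b : b *: (a *: v) = a *: (b *: v).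
Proof. by rewrite !scalerA mulrC. Qed.

Definition cbimod : bimod k k :=
  @Bimod k k V (fun v c => c *: v) (fun v w c => scalerDr c v w)
    (fun v a b => scalerDl v a b) cbimodA (@scale1r _ V) cbimodZ.
End CentralBimodule.

Definition kmod (k : comPzRingType) (A : kalgType k) : lmodType k := restr A^o.

Lemma kmodZ (k : comPzRingType) (A : kalgType k) (c : k) (a : kmod A) :
  c *: a = kalg c * (a : A) :> A.
Proof. by []. Qed.

(* A (x)_k A as a k-module; it carries the algebra A (x) A^op.                *)
Definition enveloping (k : comPzRingType) (A : kalgType k) : lmodType k :=
  tens (cbimod (kmod A)) (kmod A).

Definition env (k : comPzRingType) (A : kalgType k) (a b : A) : enveloping A :=
  @ot _ _ (cbimod (kmod A)) (kmod A) a b.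

(* A k-algebra map eta : A (x) A^op -> U                                      *)
Record source_target (k : comPzRingType) (A U : kalgType k) := SourceTarget {
  eta :> {linear enveloping A -> kmod U};
  etaM : forall a b a' b' : A,
    eta (env (a * a') (b' * b)) = (eta (env a b) : U) * eta (env a' b') :> U;
  eta1 : eta (env 1 1) = 1 :> U
}.

Section SourceTarget.
Variables (k : comPzRingType) (A U : kalgType k) (E : source_target A U).

Definition src (a : A) : U := E (env a 1).
Definition tgt (a : A) : U := E (env 1 a).

Lemma srcD a b : src (a + b) = src a + src b.
Proof. by rewrite /src /env otDl raddfD. Qed.
Lemma tgtD a b : tgt (a + b) = tgt a + tgt b.
Proof. by rewrite /tgt /env otDr raddfD. Qed.
Lemma srcM a b : src (a * b) = src a * src b.
Proof. by rewrite /src -etaM mulr1. Qed.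
Lemma tgtM a b : tgt (a * b) = tgt b * tgt a.
Proof. by rewrite /tgt -etaM mulr1. Qed.
Lemma src1 : src 1 = 1. Proof. exact: eta1. Qed.
Lemma tgt1 : tgt 1 = 1. Proof. exact: eta1. Qed.
Lemma src_tgtC a b : src a * tgt b = tgt b * src a.
Proof. by rewrite /src /tgt -!etaM !(mul1r, mulr1). Qed.
Lemma src_kalg c : src (kalg c) = tgt (kalg c).
Proof.
rewrite /src /tgt /env; congr (E _).
have kalgE : kalg c = (c *: (1 : kmod A)) :> A by rewrite kmodZ mulr1.
by rewrite kalgE; apply: (@ot_bal _ _ (cbimod (kmod A)) (kmod A)).
Qed.

(* |>U : U as a left A-module via a |> u = s(a) u                             *)
Definition lU of source_target A U : Type := U.
Local Notation lUE := (lU E).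
HB.instance Definition _ := GRing.Zmodule.on lUE.
Definition lU_scale (a : A) (u : lUE) : lUE := src a * (u : U).
Fact lU_scaleA a b u : lU_scale a (lU_scale b u) = lU_scale (a * b) u.
Proof. by rewrite /lU_scale srcM mulrA. Qed.
Fact lU_scale1 : left_id 1 lU_scale.
Proof. by move=> u; rewrite /lU_scale src1 mul1r. Qed.
Fact lU_scaleDr : right_distributive lU_scale +%R.
Proof. by move=> a u v; rewrite /lU_scale mulrDr. Qed.
Fact lU_scaleDl u : {morph lU_scale^~ u : a b / a + b}.
Proof. by move=> a b; rewrite /lU_scale srcD mulrDl. Qed.
HB.instance Definition _ := GRing.Zmodule_isLmodule.Build A lUE
  lU_scaleA lU_scale1 lU_scaleDr lU_scaleDl.

(* u <| a = t(a) u                                                            *)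
Definition tgt_mul (a : A) (u : lUE) : lUE := tgt a * (u : U).
Lemma tgt_mul_linear a : linear (tgt_mul a).
Proof.
move=> b u v; rewrite /tgt_mul mulrDr; congr (_ + _).
by rewrite /GRing.scale /= /lU_scale !mulrA src_tgtC.
Qed.
HB.instance Definition _ a := GRing.isLinear.Build A lUE lUE _ (tgt_mul a)
  (tgt_mul_linear a).

Fact bU_Dl (u v : lUE) a : tgt_mul a (u + v) = tgt_mul a u + tgt_mul a v.
Proof. exact: raddfD. Qed.
Fact bU_Dr (u : lUE) a b : tgt_mul (a + b) u = tgt_mul a u + tgt_mul b u.
Proof. by rewrite /tgt_mul tgtD mulrDl. Qed.
Fact bU_A (u : lUE) a b : tgt_mul (a * b) u = tgt_mul b (tgt_mul a u).
Proof. by rewrite /tgt_mul tgtM mulrA. Qed.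
Fact bU_1 (u : lUE) : tgt_mul 1 u = u.
Proof. by rewrite /tgt_mul tgt1 mul1r. Qed.
Fact bU_Z b (u : lUE) a : tgt_mul a (b *: u) = b *: tgt_mul a u.
Proof. exact: linearZ. Qed.

Definition bU : bimod A A :=
  @Bimod A A lUE (fun u a => tgt_mul a u) bU_Dl bU_Dr bU_A bU_1 bU_Z.

(* U_<| (x)_A X, a left A-module via |>U                                      *)
Definition Utens (X : lmodType A) : lmodType A := tens bU X.
Definition uot (X : lmodType A) (u : U) (x : X) : Utens X := @ot _ _ bU X u x.

Definition uot2 (u v : U) : Utens lUE := uot u (v : lUE).

Lemma uot_tgt (X : lmodType A) u a (x : X) : uot (tgt a * u) x = uot u (a *: x).
Proof. exact: (@ot_bal _ _ bU X). Qed.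
Lemma uot_src (X : lmodType A) u a (x : X) : uot (src a * u) x = a *: uot u x.
Proof. exact: (@otZ _ _ bU X). Qed.

Section Extension.
Variables (S : pzRingType) (M : bimod S A) (rho : {linear M -> tens M lUE}).

(* rho (x) id_X : M (x)_A X -> M (x)_A U (x)_A X                              *)
Definition ext (X : lmodType A) : tens M X -> tens M (Utens X) :=
  fun z => \tsum_(m, x <- z) \tsum_(m', u <- rho m) ot m' (uot u x).

Hypothesis rho_tgt : forall m a, rho (ract m a) = tmap M (tgt_mul a) (rho m).

Lemma ext_bal_in (X : lmodType A) (x : X) :
  balanced (fun (m' : M) (u : lUE) => ot m' (uot u x)).
Proof.
split=> [m m' u|m u u'|m a u]; first exact: otDl.
- by rewrite /uot otDl otDr.
- rewrite ot_bal; congr (ot _ _); exact/esym/uot_src.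
Qed.

Lemma ext_bal (X : lmodType A) :
  balanced (fun m (x : X) => \tsum_(m', u <- rho m) ot m' (uot u x)).
Proof.
split=> [m m' x|m x x'|m a x].
- by rewrite raddfD tsumD //; apply: ext_bal_in.
- rewrite /tsum -big_split; apply: eq_bigr => p _.
  by rewrite /uot !otDr.
- by rewrite rho_tgt tsum_tmap; [apply: eq_bigr => p _; rewrite -uot_tgt
    | apply: ext_bal_in].
Qed.

Lemma ext_linear (X : lmodType A) : linear (@ext X).
Proof.
apply: tsum_linear; first exact: ext_bal.
move=> a m x; rewrite linearZ /=.
have tl := tsum_linear (ext_bal_in x) (fun a m u => otZ a m (uot u x)).
by have := tl a (rho m) 0; rewrite !addr0 (tsum0 (ext_bal_in x)) addr0.
Qed.

Definition extL X : {linear tens M X -> tens M (Utens X)} := mklinear (@ext_linear X).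
Lemma extL_nat (X Y : lmodType A) (f : {linear X -> Y}) z :
  extL Y (tmap M f z) = tmap M (tmap bU f) (extL X z).
Proof.
have extL_ot (V : lmodType A) m (v : V) : extL V (ot m v) = \tsum_(m', u <- rho m) ot m' (uot u v).
  by rewrite /extL /= /ext tsum_ot //; apply: ext_bal.
elim/tens_ind: z => [|z w IHz IHw|m x]; first by rewrite !raddf0.
  by have := f_equal2 +%R IHz IHw; rewrite !raddfD.
rewrite tmap_ot !extL_ot tmap_tsum.
by apply: eq_bigr => p _; rewrite !tmap_ot.
Qed.
End Extension.
End SourceTarget.

Arguments tgt_mul {k A U} E a u.
Arguments uot {k A U} E {X} u x.
Arguments ext {k A U E S M} rho {X} z.

Lemma alternating_square (k : comPzRingType) (V : lmodType k) m
    (F : nat -> nat -> V) :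
  (forall i j, (i <= j < m)%N -> F j.+1 i = F i j) ->
  \sum_(i < m) \sum_(j < m.+1) (-1) ^+ (i + j) *: F j i = 0.
Proof.
move=> FE; pose G (i j : nat) := (-1 : k) ^+ (i + j) *: F j i.
transitivity (\sum_(i < m) \sum_(j < m | (j <= i)%N) G i j
            + \sum_(i < m) \sum_(j < m | (i <= j)%N) G i j.+1).
  rewrite -big_split; apply: eq_bigr => i _.
  rewrite (bigID (fun j : 'I_m.+1 => (j <= i)%N)) /=; congr (_ + _).
    by rewrite big_mkcond big_ord_recr /= leqNgt ltn_ord addr0 [RHS]big_mkcond.
  rewrite big_mkcond big_ord_recl /= add0r [RHS]big_mkcond.
  by apply: eq_bigr => j _; rewrite -ltnNge ltnS.
rewrite [X in _ + X](exchange_big_dep xpredT) //= -big_split big1 // => i _.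
rewrite -big_split big1 //= => j ji.
by rewrite /G FE ?ji ?ltn_ord // addnS exprS mulN1r scaleNr addnC subrr.
Qed.

Section Bialgebroids.
Variables (k : comPzRingType) (A U : kalgType k).

Record left_bialgebroid := LeftBialgebroid {
  lb_eta :> source_target A U;
  comul : {linear lU lb_eta -> Utens lb_eta (lU lb_eta)};
  counit : U -> A;
  comul_tgt : forall (u : U) a,
    comul (tgt lb_eta a * u) = tmap (bU lb_eta) (tgt_mul lb_eta a) (comul u);
  counitD : forall u v : U, counit (u + v) = counit u + counit v;
  counit_bimod : forall (u : U) a b,
    counit (src lb_eta a * tgt lb_eta b * u) = a * counit u * b;
  comulA : forall u : U,
    ext (M := bU lb_eta) comul (comul u) = tmap (bU lb_eta) comul (comul u);
  counitl : forall u : U,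
    \tsum_(u1, u2 <- comul u) src lb_eta (counit u1) * u2 = u;
  counitr : forall u : U,
    \tsum_(u1, u2 <- comul u) tgt lb_eta (counit u2) * u1 = u;
  comul_takeuchi : forall (u : U) a,
    \tsum_(u1, u2 <- comul u) uot2 lb_eta (u1 * tgt lb_eta a) u2 =
    \tsum_(u1, u2 <- comul u) uot2 lb_eta u1 (u2 * src lb_eta a);
  comul1 : comul (1 : U) = uot2 lb_eta 1 1;
  comulM : forall u v : U,
    comul (u * v) = \tsum_(v1, v2 <- comul v) \tsum_(u1, u2 <- comul u)
      uot2 lb_eta (u1 * v1) (u2 * v2);
  counit1 : counit 1 = 1;
  counitM_src : forall u v : U,
    counit (u * v) = counit (u * src lb_eta (counit v));
  counitM_tgt : forall u v : U,
    counit (u * v) = counit (u * tgt lb_eta (counit v))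
}.

Definition right_flat (B : left_bialgebroid) : Prop :=
  forall (X Y : lmodType A) (f : {linear X -> Y}),
    injective f -> injective (tmap (bU B) f).

Section Fixed.
Variable B : left_bialgebroid.

(* Delta (x) id_X                                                             *)
Definition comul_id (X : lmodType A) : {linear Utens B X -> Utens B (Utens B X)} :=
  @extL k A U B A (bU B) (comul B) (@comul_tgt B) X.

Record left_comodule := LeftComodule {
  lc_mod :> lmodType A;
  coact : {linear lc_mod -> Utens B lc_mod};
  coactA : forall n,
    ext (M := bU B) (comul B) (coact n) = tmap (bU B) coact (coact n);
  coact1 : forall n, \tsum_(u, m <- coact n) counit B u *: m = n
}.

Arguments coact {l}.

(* n a = epsilon(n_(-1) t(a)) n_(0)                                           *)
Definition co_ract (N : left_comodule) (n : N) (a : A) : N :=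
  \tsum_(u, m <- coact n) counit B ((u : U) * tgt B a) *: m.

Record right_comodule := RightComodule {
  rc_mod :> bimod k A;
  rcoact : {linear rc_mod -> tens rc_mod (lU B)};
  rcoact_tgt : forall m a,
    rcoact (ract m a) = tmap rc_mod (tgt_mul B a) (rcoact m);
  rcoactA : forall m, ext rcoact (rcoact m) = tmap rc_mod (comul B) (rcoact m);
  rcoact1 : forall m, \tsum_(m', u <- rcoact m) ract m' (counit B u) = m
}.

(* A as a right comodule, with coaction a |-> 1 (x) t(a)                      *)
Fact bA_Dl (x y : kmod A) (a : A) : (x + y : A) * a = (x : A) * a + (y : A) * a.
Proof. exact: mulrDl. Qed.
Fact bA_Z (c : k) (x : kmod A) (a : A) :
  (c *: x : A) * a = (c *: ((x : A) * a : kmod A) : A).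
Proof. by rewrite !kmodZ mulrA. Qed.
Definition bA : bimod k A :=
  @Bimod k A (kmod A) (fun x a => (x : A) * a) bA_Dl (fun x => mulrDr (x : A))
    (fun x => mulrA (x : A)) (fun x => mulr1 (x : A)) bA_Z.

Definition coA (a : bA) : tens bA (lU B) := @ot _ _ bA (lU B) (1 : A) (tgt B a).

Lemma coA_linear : linear coA.
Proof.
move=> c x y; rewrite /coA tgtD otDr; congr (_ + _).
rewrite -otZ (_ : c *: ((1 : A) : bA) = @ract _ _ bA (1 : A) (kalg c)); last first.
  by rewrite /= mul1r kmodZ mulr1.
rewrite ot_bal; congr (ot _ _).
by rewrite kmodZ kalgC tgtM -src_kalg.
Qed.

Lemma coA_tgt m a : mklinear coA_linear (ract m a) =
  tmap bA (tgt_mul B a) (mklinear coA_linear m).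
Proof. by rewrite [RHS]tmap_ot /= /coA /= tgtM. Qed.

Lemma coA_coassoc m : ext (mklinear coA_linear) (mklinear coA_linear m) =
  tmap bA (comul B) (mklinear coA_linear m).
Proof.
rewrite [RHS]tmap_ot /ext tsum_ot; last exact/ext_bal/coA_tgt.
rewrite tsum_ot; last exact: ext_bal_in.
have -> : comul B (tgt B m) = uot2 B 1 (tgt B m).
  rewrite -[LHS](congr1 (comul B) (mulr1 (tgt B m))) comul_tgt comul1.
  by rewrite [LHS]tmap_ot; congr (ot _ _); apply: (@mulr1 U).
by rewrite tgt1.
Qed.

Lemma counit_tgt a : counit B (tgt B a) = a.
Proof.
have := @counit_bimod B 1 1 a.
by rewrite src1 mul1r mulr1 counit1 !mul1r.
Qed.

Lemma coA_counit m :
  \tsum_(m', u <- mklinear coA_linear m) @ract _ _ bA m' (counit B u) = m.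
Proof.
rewrite tsum_ot; first by rewrite counit_tgt; apply: (@mul1r A).
split=> [x y u|x u v|x a u]; first exact: (@mulrDl A).
  by rewrite counitD; apply: (@mulrDr A).
rewrite -ractA; congr (ract _ _).
have := @counit_bimod B u a 1.
by rewrite tgt1 !mulr1.
Qed.

Definition base_comodule : right_comodule :=
  RightComodule coA_tgt coA_coassoc coA_counit.

(* M [] N, the equaliser of rho_M (x) id and id (x) Delta_N                   *)
Definition cotensor (M : right_comodule) (N : left_comodule) : lmodType k :=
  kernel (extL (@rcoact_tgt M) N \- tmap M (@coact N)).

Section Iterate.
Variable X : lmodType A.

(* U^(x)p (x)_A X                                                             *)
Fixpoint iterU (p : nat) : lmodType A :=
  if p is q.+1 then Utens B (iterU q) else X.
End Iterate.

Section CobarComplex.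
Variable N : left_comodule.

Definition Cco (p : nat) : lmodType A := iterU N p.

(* cofaceS n i is delta_(i+1) on C^n, for i <= n; it is left A-linear, unlike *)
(* delta_0, which is only k-linear.                                           *)
Fixpoint cofaceS (n i : nat) : {linear Cco n -> Cco n.+1} :=
  match n return {linear Cco n -> Cco n.+1} with
  | 0 => @coact N
  | m.+1 =>
      if i is j.+1 then tmap (bU B) (cofaceS m j)
      else comul_id (Cco m)
  end.

Definition coface (n i : nat) (x : Cco n) : Cco n.+1 :=
  if i is j.+1 then cofaceS n j x else uot B 1 x.


Definition cobar_d (n : nat) (x : restr (Cco n)) : restr (Cco n.+1) :=
  \sum_(i < n.+2) (-1) ^+ i *: (coface i x : restr (Cco n.+1)).

Lemma comul_id_ot (X : lmodType A) u (x : X) :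
  comul_id X (uot B u x) = \tsum_(u1, u2 <- comul B u) uot B u1 (uot B u2 x).
Proof. by rewrite /comul_id /= /ext tsum_ot //; apply/ext_bal/comul_tgt. Qed.

Lemma Utens_ind (X : lmodType A) (P : Utens B X -> Prop) : P 0 ->
  (forall z w, P z -> P w -> P (z + w)) -> (forall u x, P (uot B u x)) ->
  forall z, P z.
Proof. exact: tens_ind. Qed.

Lemma comul_id1 (X : lmodType A) (x : X) :
  comul_id X (uot B 1 x) = uot B 1 (uot B 1 x).
Proof. by rewrite comul_id_ot comul1 tsum_ot //; apply: ext_bal_in. Qed.

Definition Umap (X Y : lmodType A) (f : {linear X -> Y}) :
  {linear Utens B X -> Utens B Y} := tmap (bU B) f.

Lemma Umap_ot (X Y : lmodType A) (f : {linear X -> Y}) u x :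
  Umap f (uot B u x) = uot B u (f x).
Proof. exact: tmap_ot. Qed.

Lemma comul_id_nat (X Y : lmodType A) (f : {linear X -> Y}) z :
  comul_id Y (Umap f z) = Umap (Umap f) (comul_id X z).
Proof. exact: (@extL_nat k A U B A (bU B) (comul B) (@comul_tgt B) X Y f z). Qed.

Definition uotr (X : lmodType A) (x : X) (u : lU B) : Utens B X := uot B u x.
Lemma uotr_linear (X : lmodType A) (x : X) : linear (uotr x).
Proof. by move=> a u v; rewrite /uotr /uot otDl otZ. Qed.
Definition uotrL (X : lmodType A) (x : X) : {linear lU B -> Utens B X} :=
  mklinear (uotr_linear x).

Lemma comul_id_uotr (X : lmodType A) u (x : X) :
  comul_id X (uot B u x) = Umap (uotrL x) (comul B u).
Proof. by rewrite comul_id_ot. Qed.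

Lemma comul_idA (X : lmodType A) z :
  comul_id (Utens B X) (comul_id X z) = Umap (comul_id X) (comul_id X z).
Proof.
elim/Utens_ind: z => [|z w IHz IHw|u x]; first by rewrite !raddf0.
  by have := f_equal2 +%R IHz IHw; rewrite !raddfD.
have cA : comul_id (lU B) (comul B u) = Umap (comul B) (comul B u) := comulA B u.
rewrite comul_id_uotr comul_id_nat cA.
set z := comul B u; elim/Utens_ind: z => [|z w IHz IHw|v w]; first by rewrite !raddf0.
  by have := f_equal2 +%R IHz IHw; rewrite !raddfD.
by rewrite !Umap_ot; congr (uot _ _ _); apply/esym/comul_id_uotr.
Qed.

Lemma cofaceS_comm n i j : (i <= j <= n)%N -> forall x,
  cofaceS n.+1 j.+1 (cofaceS n i x) = cofaceS n.+1 i (cofaceS n j x).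
Proof.
elim: n i j => [|n IH] [|i] [|j] //= ij x.
- exact/esym/coactA.
- exact/esym/comul_idA.
- exact/esym/comul_id_nat.
- by apply: (@tmap_sq _ _ _ _ _ _ _ (cofaceS n i) (cofaceS n.+1 j.+1) (cofaceS n j) (cofaceS n.+1 i)) => y; apply: IH.
Qed.

Lemma coface_comm n i j (x : Cco n) : (i <= j <= n.+1)%N ->
  coface j.+1 (coface i x) = coface i (coface j x).
Proof.
case: i j => [|i] [|j] // ij; last exact: cofaceS_comm.
- exact: comul_id1.
- exact: Umap_ot.
Qed.

Lemma coface_linear n i : linear (@coface n i : restr (Cco n) -> restr (Cco n.+1)).
Proof.
case: i => [|i] c x y; last exact: (linearP (cofaceS n i)).
rewrite /= /uot otDr; congr (_ + _).
rewrite -[c *: x]/(kalg c *: (x : Cco n)) -ot_bal.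
rewrite -[RHS]/(kalg c *: (uot B 1 (x : Cco n))) -uot_src src_kalg.
by congr (ot _ _).
Qed.

Lemma cobar_d_linear n : linear (@cobar_d n).
Proof.
move=> c x y; rewrite /cobar_d scaler_sumr -big_split; apply: eq_bigr => i _ /=.
by rewrite coface_linear scalerDr !scalerA mulrC.
Qed.

Definition cobar_dL n : {linear restr (Cco n) -> restr (Cco n.+1)} :=
  mklinear (@cobar_d_linear n).

Lemma cobar_dd n (x : restr (Cco n)) : cobar_dL n.+1 (cobar_dL n x) = 0.
Proof.
have FE i j : (i <= j < n.+2)%N ->
    coface j.+1 (coface i (x : Cco n)) = coface i (coface j (x : Cco n)).
  by move=> ij; apply: coface_comm.
have e := @alternating_square k (restr (Cco n.+2)) n.+2
  (fun j i => coface j (coface i (x : Cco n))) FE.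
rewrite -[RHS]e exchange_big; apply: eq_bigr => j _.
pose cj := mklinear (@coface_linear n.+1 j).
rewrite -[X in _ *: X]/(cj (cobar_d x)) /cobar_d raddf_sum scaler_sumr.
apply: eq_bigr => i _; rewrite addnC exprD -scalerA; congr (_ *: _).
exact: (linearZZ cj).
Qed.

Definition cobar : cochain_complex k := CochainComplex cobar_dd.

Definition Hco (n : nat) : lmodType k := cohomology cobar n.
End CobarComplex.

Record yd_module := YDModule {
  yd_co :> left_comodule;
  yact : U -> yd_co -> yd_co;
  yactDl : forall u v n, yact (u + v) n = yact u n + yact v n;
  yactDr : forall u n m, yact u (n + m) = yact u n + yact u m;
  yactA : forall u v n, yact (u * v) n = yact u (yact v n);
  yact1 : forall n, yact 1 n = n;
  yact_src : forall a n, yact (src B a) n = a *: n;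
  yact_tgt : forall a n, yact (tgt B a) n = co_ract n a;
  yd_compat : forall u n,
    \tsum_(u1, u2 <- comul B u) \tsum_(w, m <- coact (yact u1 n)) uot B (w * u2) m =
    \tsum_(w, m <- coact n) \tsum_(u1, u2 <- comul B u) uot B (u1 * w) (yact u2 m)
}.

Record yd_algebra := YDAlgebra {
  yd_mod :> yd_module;
  ymul : yd_mod -> yd_mod -> yd_mod;
  yone : yd_mod;
  ymulDl : forall m m' n, ymul (m + m') n = ymul m n + ymul m' n;
  ymulDr : forall m n n', ymul m (n + n') = ymul m n + ymul m n';
  ymulA : forall m n n', ymul m (ymul n n') = ymul (ymul m n) n';
  ymul1n : forall n, ymul yone n = n;
  ymuln1 : forall n, ymul n yone = n;
  ymulZl : forall a m n, ymul (a *: m) n = a *: ymul m n;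
  ymul_bal : forall m a n, ymul (co_ract m a) n = ymul m (a *: n);
  ymul_ract : forall m n a, ymul m (co_ract n a) = co_ract (ymul m n) a;
  yact_mul : forall u m n,
    yact u (ymul m n) = \tsum_(u1, u2 <- comul B u) ymul (yact u1 m) (yact u2 n);
  yact_onel : forall u, yact u yone = counit B u *: yone;
  yact_oner : forall u, yact u yone = co_ract yone (counit B u);
  coact_one : coact yone = uot B 1 yone;
  coact_mul : forall m n,
    coact (ymul m n) = \tsum_(v, n0 <- coact n) \tsum_(u, m0 <- coact m)
      uot B (u * v) (ymul m0 n0)
}.

Record bc_yd_algebra := BraidedCommYDAlgebra {
  bc_alg :> yd_algebra;
  braided_comm : forall m n : bc_alg,
    ymul m n = \tsum_(u, m0 <- coact m) ymul (yact u n) m0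
}.

Section Operations.
Variable N : yd_algebra.
Local Notation C := (Cco N).

(* (m_(-q) v^1, ..., m_(-1) v^q, m_(0) n) for y = (v^1, ..., v^q, n)          *)
Fixpoint cup0 (q : nat) : N -> C q -> C q :=
  match q return N -> C q -> C q with
  | 0 => fun m n => ymul m n
  | _.+1 => fun m y =>
      \tsum_(v, y' <- y) \tsum_(w, m0 <- coact m) uot B (w * v) (cup0 m0 y')
  end.

Fixpoint cup (p q : nat) : C p -> C q -> C (p + q) :=
  match p return C p -> C q -> C (p + q) with
  | 0 => fun m y => cup0 m y
  | _.+1 => fun x y => \tsum_(u, x' <- x) uot B u (cup x' y)
  end.

(* (u, x) o_1 psi in the form                                                 *)
(* (u_(1) v^1, ..., u_(q) v^q, (u_(q+1) n')_(-r) x^1, ..., (u_(q+1) n')_(0) n)*)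
(* for psi = (v^1, ..., v^q, n') and x = (x^1, ..., x^r, n)                   *)
Fixpoint ins (q r : nat) : U -> C q -> C r -> C (q + r) :=
  match q return U -> C q -> C r -> C (q + r) with
  | 0 => fun u n x => cup0 (yact u n) x
  | _.+1 => fun u psi x =>
      \tsum_(v, psi' <- psi) \tsum_(u1, u2 <- comul B u)
        uot B (u1 * v) (ins u2 psi' x)
  end.

(* phi o_(i+1) psi for phi of degree r + 1 and i <= r                         *)
Fixpoint circ (i r q : nat) : C r.+1 -> C q -> C (r + q) :=
  match i, r return C r.+1 -> C q -> C (r + q) with
  | 0, r => fun phi psi =>
      degcast C (r + q) (\tsum_(u, x <- phi) ins u psi x)
  | i'.+1, r'.+1 => fun phi psi =>
      \tsum_(u, x <- phi) uot B u (circ i' x psi)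
  | _.+1, 0 => fun _ _ => 0
  end.

(* |n| = n - 1 is encoded in signs by n + 1, which has the same parity        *)
Definition circ_bar (p q : nat) : C p -> C q -> C (p + q).-1 :=
  match p return C p -> C q -> C (p + q).-1 with
  | 0 => fun _ _ => 0
  | r.+1 => fun phi psi =>
      (-1) ^+ (r.+2 * q.+1) *:
        \sum_(i < r.+1) (-1) ^+ (q.+1 * i) *: circ i phi psi
  end.

Definition bracket (p q : nat) (phi : C p) (psi : C q) : C (p + q).-1 :=
  circ_bar phi psi
  - (-1) ^+ (p.+1 * q.+1) *: degcast C (p + q).-1 (circ_bar psi phi).
End Operations.

Definition comodule_hom (N P : left_comodule) (f : {linear N -> P}) : Prop :=
  forall n, coact (f n) = tmap (bU B) f (coact n).

(* When U_<| is flat, the monomorphisms of comodules are the injective ones.  *)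
Definition injective_comodule (I : left_comodule) : Prop :=
  forall (X Y : left_comodule) (i : {linear X -> Y}) (f : {linear X -> I}),
    comodule_hom i -> injective i -> comodule_hom f ->
  exists g : {linear Y -> I}, comodule_hom g /\ forall x, g (i x) = f x.

Record injective_resolution (N : left_comodule) := InjectiveResolution {
  ir_obj :> nat -> left_comodule;
  ir_aug : {linear N -> ir_obj 0};
  ir_d : forall n, {linear ir_obj n -> ir_obj n.+1};
  ir_aug_hom : comodule_hom ir_aug;
  ir_d_hom : forall n, comodule_hom (ir_d n);
  ir_aug_inj : injective ir_aug;
  ir_exact0 : forall x, ir_d 0 x = 0 <-> exists n, x = ir_aug n;
  ir_exactS : forall n x, ir_d n.+1 x = 0 <-> exists y, x = ir_d n y;
  ir_inj : forall n, injective_comodule (ir_obj n)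
}.

Section Cotor.
Variables (M : right_comodule).

Lemma cotensor_map_subproof (N P : left_comodule) (f : {linear N -> P}) :
  comodule_hom f -> forall z : cotensor M N,
  tmap M f (val z) \in ker_pred (extL (@rcoact_tgt M) P \- tmap M (@coact P)).
Proof.
move=> fH [z /= zK]; move: zK; rewrite !unfold_in /= !subr_eq0 => /eqP zE.
apply/eqP.
apply: etrans (@extL_nat k A U B k M (@rcoact M) (@rcoact_tgt M) N P f z) _.
by rewrite [extL _ _ z]zE; apply: tmap_sq => n; rewrite fH.
Qed.

Definition cotensor_map_fun (N P : left_comodule) (f : {linear N -> P})
    (fH : comodule_hom f) (z : cotensor M N) : cotensor M P :=
  Kernel (cotensor_map_subproof fH z).

Lemma cotensor_map_linear (N P : left_comodule) (f : {linear N -> P})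
  (fH : comodule_hom f) : linear (cotensor_map_fun fH).
Proof.
by move=> c z w; apply: val_inj; apply: (linearP (tmap M f) c (val z) (val w)).
Qed.

(* M [] f                                                                     *)
Definition cotensor_map (N P : left_comodule) (f : {linear N -> P})
    (fH : comodule_hom f) : {linear cotensor M N -> cotensor M P} :=
  mklinear (cotensor_map_linear fH).

Variables (N : left_comodule) (I : injective_resolution N).

Lemma cotensor_dd n (z : cotensor M (I n)) :
  cotensor_map (@ir_d_hom N I n.+1) (cotensor_map (@ir_d_hom N I n) z) = 0.
Proof.
suff dd w : tmap M (ir_d I n.+1) (tmap M (ir_d I n) w) = 0.
  by apply: val_inj; apply: (dd (val z)).
elim/tens_ind: w => [|u v IHu IHv|m x]; first by rewrite !raddf0.
  by have := f_equal2 +%R IHu IHv; rewrite !raddfD addr0.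
rewrite !tmap_ot (_ : ir_d I n.+1 _ = 0) ?ot0r //.
by apply/ir_exactS; exists x.
Qed.

Definition cotensor_complex : cochain_complex k :=
  CochainComplex cotensor_dd.

(* The right derived functors of M [] - at N, computed from the resolution I  *)
Definition Cotor (n : nat) : lmodType k := cohomology cotensor_complex n.
End Cotor.

End Fixed.
End Bialgebroids.

(* Main.v *)
(* Work in the graded algebra C of cochains under the cup product.  It is     *)
(* generated by N in degree 0 and by the elements [u] = (u, 1_N), u in U, in  *)
(* degree 1, and U acts on it diagonally; the Yetter-Drinfel'd condition makes*)
(* C a U-module algebra, and braided commutativity says n x = (n_(-1) x) n_(0)*)
(* for n in N, x in C.  Since (u, f) o_1 x = (u . x) f, the map f |-> f o-bar *)
(* x is, up to sign, the graded derivation D_x of C that kills N and sends [u]*)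
(* to u . x.  Derivations of C that kill N are determined by their values on  *)
(* the [u], and D_x commutes with the action of U, so [D_x, D_y] is D_z for   *)
(* z = D_x y -+ D_y x: this gives the Jacobi identity.  With E = [1] and      *)
(* mu = E E the differential is f |-> E f -+ f E - D_mu f = {mu, f}, hence a  *)
(* derivation of the bracket.  From [D_x, D_mu] and D_x E = x one reads off   *)
(* that D_x is a homotopy between left and right multiplication by x, which   *)
(* gives graded commutativity.  In the Leibniz rule the terms D_c (x y) fit   *)
(* on the nose; for D_(x y) c the homotopy is the operator b with             *)
(*   b (f g) = b f g +- D_x f D_y g +- f b g                                  *)
(* that vanishes on N and on the [u].                                         *)
(*                                                                            *)
(* For Cotor, the double complex U^p (x) I^q of the cobar complexes of an     *)
(* injective resolution I of N has exact rows because U is flat, and exact    *)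
(* columns because an injective comodule J is a retract of the cofree one     *)
(* U (x) J; so the complexes A [] I and C have isomorphic cohomology, and the *)
(* structure is transported along this isomorphism.                           *)

Require Import Defs.
From HB Require Import structures.
From mathcomp Require Import all_boot all_algebra.
From mathcomp Require Import boolp.

Set Implicit Arguments.
Unset Strict Implicit.
Unset Printing Implicit Defensive.

Import GRing.Theory.
Local Open Scope ring_scope.

(** * Linear identities in abelian groups *)

(** All cochains live in one graded algebra [tot] under the cup product, and every operation is
    expressed through products and the derivations D_x = [tder e x]: by [tin_cobar_d] the cobar
    differential is E f -+ f E - D_mu f, and by [tin_bracket] the bracket of x and y is, up to sign,
    D_y x -+ D_x y. Two facts feed the calculus. The Yetter-Drinfel'd condition makes U act on
    products through its coproduct ([tact_mul]), so D_x commutes with U ([tder_act]). Braided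
    commutativity extends from N to all cochains ([ofN_mul]), so D_x obeys the graded product rule
    ([tder_mul]).

    Since derivations killing N are determined by their values on the [u], a commutator of two D's
    is again a D ([tder_comm], [tder_tbr]). This gives the Jacobi identity on cochains
    ([tbr_jacobi]), and, as d = {mu, -} ([tdiffE]), also that d is a derivation of the bracket
    ([tdiff_tbr]). Graded commutativity and the Leibniz rule hold only up to coboundaries, with
    explicit primitives: D_x f ([tdiff_tder]) and the brace of f with x, y ([tdiff_tbrace]).

    For Cotor, flatness ([tmap_exact]) and the acyclicity of injective comodules ([cobar_acyclic])
    make the double complex of a resolution exact off its edges. Zigzags along its antidiagonals
    ([diagonal_correspondence]) identify the cohomologies of the two edges ([cotor_cobar]), and
    [gerstenhaber_transport] carries the structure over. *)

Inductive zexpr := ZVar of nat | ZZero | ZAdd of zexpr & zexpr | ZOpp of zexpr.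

Section ZExpr.
Variable V : zmodType.

Fixpoint zeval (env : seq V) (t : zexpr) : V :=
  match t with
  | ZVar i => env`_i
  | ZZero => 0
  | ZAdd t1 t2 => zeval env t1 + zeval env t2
  | ZOpp t1 => - zeval env t1
  end.

Fixpoint zcoef (t : zexpr) (i : nat) : int :=
  match t with
  | ZVar j => if i == j then 1%Z else 0%Z
  | ZZero => 0%Z
  | ZAdd t1 t2 => (zcoef t1 i + zcoef t2 i)%R
  | ZOpp t1 => (- zcoef t1 i)%R
  end.

Lemma zevalE env t : zeval env t = \sum_(i < size env) env`_i *~ zcoef t i.
Proof.
elim: t => [j||t1 IH1 t2 IH2|t IH] /=.
- have [js|sj] := ltnP j (size env).
    rewrite (bigD1 (Ordinal js)) //= eqxx mulr1z big1 ?addr0 // => i.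
    by rewrite -val_eqE /= => /negPf ->; rewrite mulr0z.
  rewrite nth_default // big1 // => i _; case: eqP => [e|]; last by rewrite mulr0z.
  by move: (ltn_ord i); rewrite e ltnNge sj.
- by rewrite big1 // => i _; rewrite mulr0z.
- by rewrite IH1 IH2 -big_split; apply: eq_bigr => i _; rewrite mulrzDr.
- by rewrite IH -sumrN; apply: eq_bigr => i _; rewrite mulrNz.
Qed.

Lemma zeval_eq env t1 t2 :
  all (fun i => zcoef t1 i == zcoef t2 i) (iota 0 (size env)) ->
  zeval env t1 = zeval env t2.
Proof.
move=> /allP e; rewrite !zevalE; apply: eq_bigr => i _.
by have /eqP-> : zcoef t1 i == zcoef t2 i by apply: e; rewrite mem_iota ltn_ord.
Qed.
End ZExpr.

(** The dummy [match constr:(Set)] lets a tactic that returns a term branch on whether [constr_eq]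
    succeeds. *)
Ltac zindex a env k :=
  lazymatch env with
  | nil => fail
  | ?b :: ?s =>
      match constr:(Set) with
      | _ => let _ := match goal with _ => constr_eq a b end in k
      | _ => let k' := constr:(S k) in zindex a s k'
      end
  end.

Ltac zatoms t env :=
  lazymatch t with
  | Algebra.add ?a ?b => let env1 := zatoms a env in zatoms b env1
  | Algebra.opp ?a => zatoms a env
  | Algebra.zero => env
  | _ => match constr:(Set) with
         | _ => let _ := zindex t env O in env
         | _ => constr:(t :: env)
         end
  end.

Ltac zquote t env :=
  lazymatch t with
  | Algebra.add ?a ?b =>
      let a' := zquote a env in let b' := zquote b env in constr:(ZAdd a' b')
  | Algebra.opp ?a => let a' := zquote a env in constr:(ZOpp a')
  | Algebra.zero => constr:(ZZero)
  | _ => let i := zindex t env O in constr:(ZVar i)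
  end.

(* Compares the integer coefficients of the two sides as combinations of      *)
(* atoms; atoms are identified syntactically.                                 *)
Ltac zmodule :=
  match goal with
  | |- @eq ?T ?a ?b =>
      let nilT := constr:(@nil T) in
      let env1 := zatoms a nilT in let env := zatoms b env1 in
      let a' := zquote a env in let b' := zquote b env in
      refine (@zeval_eq _ env a' b' _); vm_compute; reflexivity
  end.

(** * Sweedler calculus *)

Section TsumTheory.
Variables (S A : pzRingType) (M : bimod S A) (X : lmodType A).
Implicit Types (z : tens M X).

(** With z fixed, both sides run over the same chosen expression of z, so this and the next rules
    hold for arbitrary F. Rules that change z, such as [tsum_bind], rely on balancedness. *)
Lemma eq_tsum z (V : zmodType) (F G : M -> X -> V) :
  (forall m x, F m x = G m x) -> tsum z F = tsum z G.
Proof. by move=> FG; apply: eq_bigr => p _. Qed.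

Lemma tsumDF z (V : zmodType) (F G : M -> X -> V) :
  tsum z (fun m x => F m x + G m x) = tsum z F + tsum z G.
Proof. exact: big_split. Qed.

Lemma morph_tsum (V W : zmodType) (f : V -> W) z (F : M -> X -> V) :
  {morph f : x y / x + y} -> f (tsum z F) = tsum z (fun m x => f (F m x)).
Proof.
move=> fD; have f0 : f 0 = 0 by apply: (@addrI _ (f 0)); rewrite -fD !addr0.
exact: (big_morph f fD f0).
Qed.

Lemma scale_tsum (R : pzRingType) (V : lmodType R) a z (F : M -> X -> V) :
  a *: tsum z F = tsum z (fun m x => a *: F m x).
Proof. exact: scaler_sumr. Qed.

Lemma tsum_tsum (S' A' : pzRingType) (P : bimod S' A') (Y : lmodType A')
    (V : zmodType) z (w : tens P Y) (F : M -> X -> P -> Y -> V) :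
  \tsum_(m, x <- z) \tsum_(p, y <- w) F m x p y =
  \tsum_(p, y <- w) \tsum_(m, x <- z) F m x p y.
Proof. exact: exchange_big. Qed.

Lemma tensE z : z = \tsum_(m, x <- z) ot m x.
Proof. exact: tens_sumE. Qed.
End TsumTheory.

Lemma tsum_bind (S A S' A' : pzRingType) (M : bimod S A) (X : lmodType A)
    (P : bimod S' A') (Y : lmodType A') (V : zmodType) (w : tens P Y)
    (G : P -> Y -> tens M X) (F : M -> X -> V) :
  balanced F -> tsum (tsum w G) F = \tsum_(p, y <- w) tsum (G p y) F.
Proof. by move=> Fb; apply: (morph_tsum w G (tsumD Fb)). Qed.

Section Sweedler.
Variables (k : comPzRingType) (A U : kalgType k) (B : left_bialgebroid A U).
Implicit Types (u : U) (a : A).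

Section BalancedU.
Variables (X : lmodType A) (V : zmodType).

(** The predicate [balanced] for U_<| (x)_A X, phrased with the ring multiplication of U so that it
    can be used for rewriting there. *)
Record balU (F : U -> X -> V) : Prop := BalU {
  balUl : forall u v x, F (u + v) x = F u x + F v x;
  balUr : forall u x y, F u (x + y) = F u x + F u y;
  balUA : forall u a x, F (tgt B a * u) x = F u (a *: x)
}.

Lemma balUP F : balU F -> @balanced A A (bU B) X V F.
Proof. by case=> Fl Fr FA; split=> [u v x|u x y|u a x]; [apply: Fl|apply: Fr|apply: FA]. Qed.
End BalancedU.

Lemma balU_uot (X : lmodType A) : balU (@uot _ _ _ B X).
Proof. by split=> *; [apply: otDl|apply: otDr|apply: uot_tgt]. Qed.

Definition tsumU (X : lmodType A) (V : zmodType) (z : Utens B X) (F : U -> X -> V) : V :=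
  @tsum A A (bU B) X z V F.

Section TsumU.
Variables (X : lmodType A) (V : zmodType).
Implicit Types (z : Utens B X) (F G : U -> X -> V).

Lemma eq_tsumU z F G : (forall u x, F u x = G u x) -> tsumU z F = tsumU z G.
Proof. by move=> FG; apply: eq_tsum. Qed.

Lemma tsumUDF z F G : tsumU z (fun u x => F u x + G u x) = tsumU z F + tsumU z G.
Proof. exact: tsumDF. Qed.

Lemma tsumU_uot F u x : balU F -> tsumU (uot B u x) F = F u x.
Proof. by move/balUP; apply: tsum_ot. Qed.

Lemma tsumUD F : balU F -> {morph (fun z => tsumU z F) : z w / z + w}.
Proof. by move/balUP; apply: tsumD. Qed.

Lemma tsumUZ F a z : balU F ->
  tsumU (a *: z) F = tsumU z (fun u x => F (src B a * u) x).
Proof.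
move/balUP=> Fb; rewrite [z in LHS]tensE scale_tsum [LHS]tsum_bind //.
by apply: eq_tsum => u x; rewrite -otZ tsum_ot.
Qed.
End TsumU.

Lemma morph_tsumU (X : lmodType A) (V W : zmodType) (f : V -> W) (z : Utens B X)
    (F : U -> X -> V) :
  {morph f : x y / x + y} -> f (tsumU z F) = tsumU z (fun u x => f (F u x)).
Proof. exact: morph_tsum. Qed.

Lemma tsumU_bind (X Y : lmodType A) (V : zmodType) (w : Utens B Y)
    (G : U -> Y -> Utens B X) (F : U -> X -> V) :
  balU F -> tsumU (tsumU w G) F = tsumU w (fun u y => tsumU (G u y) F).
Proof. by move/balUP; apply: tsum_bind. Qed.

Lemma tsumUC (X Y : lmodType A) (V : zmodType) (z : Utens B X) (w : Utens B Y)
    (F : U -> X -> U -> Y -> V) :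
  tsumU z (fun u x => tsumU w (fun v y => F u x v y)) =
  tsumU w (fun v y => tsumU z (fun u x => F u x v y)).
Proof. exact: tsum_tsum. Qed.

Lemma tsumU_tmap (X Y : lmodType A) (V : zmodType) (f : {linear X -> Y})
    (F : U -> Y -> V) z : balU F ->
  tsumU (tmap (bU B) f z) F = tsumU z (fun u x => F u (f x)).
Proof. by move/balUP; apply: tsum_tmap. Qed.

(* G is a function on U (x)_A U (x)_A X *)
Record balUU (X : lmodType A) (V : zmodType) (G : U -> U -> X -> V) : Prop := BalUU {
  balUU1 : forall x, balU (fun u (v : lU B) => G u v x);
  balUU2 : forall u, balU (fun v x => G u v x)
}.

Lemma balUU_tsumU (X : lmodType A) (V : zmodType) (G : U -> U -> X -> V) :
  balUU G -> balU (fun u (y : Utens B X) => tsumU y (fun v x => G u v x)).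
Proof.
case=> G1 G2; split=> [u v y|u y y'|u a y].
- by rewrite -tsumUDF; apply: eq_tsumU => w x; apply: (balUl (G1 x)).
- exact: tsumUD (G2 u) _ _.
- by rewrite tsumUZ //; apply: eq_tsumU => w x; apply: (balUA (G1 x)).
Qed.

(** Sweedler's F(u_(1), u_(2)); the analogue F(n_(-1), n_(0)) for a coaction is [sc]. *)
Definition sw (V : zmodType) (u : U) (F : U -> U -> V) : V := tsumU (comul B u : Utens B (lU B)) F.

Section Sw.
Variable V : zmodType.
Implicit Types F G : U -> U -> V.
Local Notation bal F := (@balU (lU B) V F).

Lemma eq_sw u F G : (forall v w, F v w = G v w) -> sw u F = sw u G.
Proof. by move=> FG; apply: eq_tsumU. Qed.

Lemma swDF u F G : sw u (fun v w => F v w + G v w) = sw u F + sw u G.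
Proof. exact: tsumUDF. Qed.

Lemma swD u (v : U) F : bal F -> sw (u + v) F = sw u F + sw v F.
Proof.
move=> Fb; have e : comul B (u + v) = comul B u + comul B v by apply: raddfD.
by rewrite /sw e (tsumUD Fb).
Qed.

Lemma sw_takeuchi a u F : bal F ->
  sw u (fun v w => F (v * tgt B a) w) = sw u (fun v w => F v (w * src B a)).
Proof.
move=> Fb; have := congr1 (fun z : Utens B (lU B) => tsumU z F) (comul_takeuchi B u a).
rewrite !tsumU_bind // => e; apply: etrans (etrans _ e) _.
  by apply: eq_tsumU => v w; rewrite tsumU_uot.
by apply: eq_tsumU => v w; rewrite tsumU_uot.
Qed.

Lemma sw1 F : bal F -> sw 1 F = F 1 1.
Proof. by move=> Fb; rewrite /sw comul1; apply: tsumU_uot. Qed.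

Lemma swM u (v : U) F : bal F ->
  sw (u * v) F = sw v (fun v1 v2 => sw u (fun u1 u2 => F (u1 * v1) (u2 * v2))).
Proof.
move=> Fb; rewrite /sw comulM [LHS]tsumU_bind //; apply: eq_tsumU => v1 v2.
by rewrite [LHS]tsumU_bind //; apply: eq_tsumU => u1 u2; apply: tsumU_uot.
Qed.
End Sw.

Lemma sw_counitl u : sw u (fun v w => src B (counit B v) * w) = u.
Proof. exact: counitl. Qed.

Lemma sw_counitr u : sw u (fun v w => tgt B (counit B w) * v) = u.
Proof. exact: counitr. Qed.

Lemma morph_sw (V W : zmodType) (f : V -> W) u (F : U -> U -> V) :
  {morph f : x y / x + y} -> f (sw u F) = sw u (fun v w => f (F v w)).
Proof. exact: morph_tsumU. Qed.

(** Evaluates G on (Delta (x) id)(z). Applied to the two coassociativity axioms, it turns them into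
    identities between iterated sums. *)
Lemma tsumU_ext (X : lmodType A) (V : zmodType) (G : U -> U -> X -> V)
    (z : Utens B X) : balUU G ->
  tsumU (ext (M := bU B) (comul B) z) (fun u y => tsumU y (G u)) =
  tsumU z (fun u x => sw u (fun u1 u2 => G u1 u2 x)).
Proof.
move=> Gb; rewrite [LHS]tsumU_bind; last exact: balUU_tsumU.
apply: eq_tsumU => u x; rewrite [LHS]tsumU_bind; last exact: balUU_tsumU.
by apply: eq_tsumU => v w; rewrite !tsumU_uot //; [apply: balUU2|apply: balUU_tsumU].
Qed.

Lemma sw_coassoc (V : zmodType) u (G : U -> U -> U -> V) : balUU (X := lU B) G ->
  sw u (fun v w => sw v (fun v1 v2 => G v1 v2 w)) =
  sw u (fun v w => sw w (fun w1 w2 => G v w1 w2)).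
Proof.
move=> Gb; have := congr1 (fun z : Utens B (Utens B (lU B)) =>
  tsumU z (fun u y => tsumU y (G u))) (comulA B u).
rewrite tsumU_ext // => e; rewrite [LHS]e tsumU_tmap //; exact: balUU_tsumU.
Qed.

Section Comodule.
Variables (N : left_comodule B) (V : zmodType).
Implicit Types (n m : N) (F G : U -> N -> V).

Definition sc n F : V := tsumU (coact N n) F.

Lemma eq_sc n F G : (forall u m, F u m = G u m) -> sc n F = sc n G.
Proof. exact: eq_tsumU. Qed.

Lemma scDF n F G : sc n (fun u m => F u m + G u m) = sc n F + sc n G.
Proof. exact: tsumUDF. Qed.

Lemma scD n m F : balU F -> sc (n + m) F = sc n F + sc m F.
Proof. by move=> Fb; rewrite /sc raddfD (tsumUD Fb). Qed.

Lemma scZ a n F : balU F -> sc (a *: n) F = sc n (fun u m => F (src B a * u) m).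
Proof. by move=> Fb; rewrite /sc linearZZ tsumUZ. Qed.

Lemma sc_coassoc n (G : U -> U -> N -> V) : balUU G ->
  sc n (fun u m => tsumU (coact N m) (fun v m' => G u v m')) =
  sc n (fun u m => sw u (fun v w => G v w m)).
Proof.
move=> Gb; have := congr1 (fun z : Utens B (Utens B N) =>
  tsumU z (fun u y => tsumU y (G u))) (coactA n).
rewrite tsumU_ext // => e; rewrite [RHS]e tsumU_tmap //; exact: balUU_tsumU.
Qed.
End Comodule.

Lemma morph_sc (N : left_comodule B) (V W : zmodType) (f : V -> W) (n : N)
    (F : U -> N -> V) :
  {morph f : x y / x + y} -> f (sc n F) = sc n (fun u m => f (F u m)).
Proof. exact: morph_tsumU. Qed.

Lemma sw_sc (N : left_comodule B) (V : zmodType) u (n : N) (F : U -> U -> U -> N -> V) :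
  sw u (fun v w => sc n (F v w)) = sc n (fun y m => sw u (fun v w => F v w y m)).
Proof. exact: tsumUC. Qed.

Lemma counit_balU (X : lmodType A) : balU (fun u (x : X) => counit B u *: x).
Proof.
split=> [u v x|u x y|u a x]; first by rewrite counitD scalerDl.
  exact: scalerDr.
have := @counit_bimod _ _ _ B u 1 a; rewrite src1 !mul1r => ->.
by rewrite scalerA.
Qed.

Lemma counit_src a u : counit B (src B a * u) = a * counit B u.
Proof.
by have := @counit_bimod _ _ _ B u a 1; rewrite tgt1 mulr1 mulr1.
Qed.

Lemma comul_tgtE a : comul B (tgt B a) = uot2 B 1 (tgt B a).
Proof.
have := comul_tgt B 1 a; rewrite mulr1 comul1 => ->.
by rewrite [LHS]tmap_ot /= /tgt_mul; congr (ot _ _); apply: mulr1.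
Qed.

Lemma comul_srcE a : comul B (src B a) = uot2 B (src B a) 1.
Proof.
have e : comul B (src B a * 1) = a *: comul B (1 : U) by apply: (linearZZ (comul B)).
by rewrite mulr1 in e; rewrite e comul1 /uot2 -uot_src mulr1.
Qed.

Lemma sw_tgtE (V : zmodType) a (F : U -> U -> V) : balU (X := lU B) F ->
  sw (tgt B a) F = F 1 (tgt B a).
Proof. by move=> Fb; rewrite /sw comul_tgtE; apply: tsumU_uot. Qed.

Lemma sw_srcE (V : zmodType) a (F : U -> U -> V) : balU (X := lU B) F ->
  sw (src B a) F = F (src B a) 1.
Proof. by move=> Fb; rewrite /sw comul_srcE; apply: tsumU_uot. Qed.

Lemma balU_mulr (X : lmodType A) (V : zmodType) (F : U -> X -> V) (v : U) :
  balU F -> balU (fun u x => F (u * v) x).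
Proof. by case=> Fl Fr FA; split=> *; rewrite ?mulrDl ?Fl ?Fr // -mulrA FA. Qed.

Lemma balU_mulrr (V : zmodType) (F : U -> U -> V) (v : U) :
  balU (X := lU B) F -> balU (X := lU B) (fun u x => F u (x * v)).
Proof.
case=> Fl Fr FA; split=> [u u' x|u x y|u a x]; first exact: Fl.
  by rewrite [_ * _]mulrDl; apply: Fr.
by rewrite FA /GRing.scale /= /lU_scale mulrA.
Qed.

Lemma counit_ll : balU (X := lU B) (fun v w => src B (counit B v) * w).
Proof. exact: counit_balU. Qed.

Lemma counit_rr : balU (X := lU B) (fun v w => tgt B (counit B w) * v).
Proof.
split=> [u v x|u x y|u a x]; first exact: mulrDr.
  by rewrite counitD tgtD mulrDl.
by rewrite counit_src tgtM mulrA.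
Qed.

(** Multiplication by Delta(u) from the left respects the tensor relation because Delta(u) lies in
    the Takeuchi product, where t(a) on the first factor trades for s(a) on the second. *)
Lemma balU_swM (V : zmodType) u (F : U -> U -> V) : balU (X := lU B) F ->
  balU (X := lU B) (fun v1 v2 => sw u (fun u1 u2 => F (u1 * v1) (u2 * v2))).
Proof.
move=> Fb; split=> [v v' w|v w w'|v a w].
- by rewrite -swDF; apply: eq_sw => u1 u2; rewrite mulrDr (balUl Fb).
- by rewrite -swDF; apply: eq_sw => u1 u2; rewrite -(balUr Fb); congr F; apply: mulrDr.
- have Fb' : balU (X := lU B) (fun u1 u2 => F (u1 * v) (u2 * w)).
    exact/(@balU_mulrr _ (fun u1 u2 => F (u1 * v) u2))/(@balU_mulr (lU B)).
  transitivity (sw u (fun u1 u2 => F (u1 * tgt B a * v) (u2 * w))).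
    by apply: eq_sw => u1 u2; rewrite mulrA.
  rewrite (sw_takeuchi a u Fb'); apply: eq_sw => u1 u2; congr F; exact/esym/mulrA.
Qed.

(** Counitality of u t(a), whose coproduct is u_(1) (x) u_(2) t(a). *)
Lemma counit_tgtR a u : sw u (fun v w => tgt B (counit B (w * tgt B a)) * v) = u * tgt B a.
Proof.
rewrite -[RHS]sw_counitr swM; last exact: counit_rr.
rewrite sw_tgtE; first by apply: eq_sw => v w; rewrite mulr1.
exact: (@balU_swM _ u (fun v w => tgt B (counit B w) * v) counit_rr).
Qed.

(** Counitality of u s(a), whose coproduct is u_(1) s(a) (x) u_(2); to the right of u_(1) the counit
    does not distinguish s(a) from t(a). *)
Lemma counit_srcR a u : sw u (fun v w => src B (counit B (v * tgt B a)) * w) = u * src B a.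
Proof.
rewrite -[RHS]sw_counitl swM; last exact: counit_ll.
rewrite sw_srcE; last first.
  exact: (@balU_swM _ u (fun v w => src B (counit B v) * w) counit_ll).
have sE : counit B (src B a) = a by rewrite -[src B a]mulr1 counit_src counit1 mulr1.
by apply: eq_sw => v w; rewrite mulr1 [counit B (v * src B a)]counitM_tgt sE.
Qed.

Lemma counit_tgtL a u : counit B (tgt B a * u) = counit B u * a.
Proof. by have := @counit_bimod _ _ _ B u 1 a; rewrite src1 !mul1r. Qed.

Section ComoduleTakeuchi.
Variables (N : left_comodule B) (V : zmodType) (F : U -> N -> V).
Hypothesis Fb : balU F.
Implicit Type n : N.

Lemma co_ractE n a : co_ract n a = sc n (fun u m => counit B (u * tgt B a) *: m).
Proof. by []. Qed.

Lemma sc_takeuchi a n :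
  sc n (fun u m => F (u * tgt B a) m) = sc n (fun u m => F u (co_ract m a)).
Proof.
pose G u v m := F (tgt B (counit B (v * tgt B a)) * u) m.
have Gb : balUU G.
  split=> [m|u]; split=> [x y z|x y z|x b y]; rewrite /G.
  - by rewrite mulrDr (balUl Fb).
  - by rewrite mulrDl counitD tgtD mulrDl (balUl Fb).
  - by rewrite mulrA -tgtM -counit_src mulrA.
  - by rewrite mulrDl counitD tgtD mulrDl (balUl Fb).
  - exact: (balUr Fb).
  - by rewrite -(balUA Fb) -[_ * x * _]mulrA counit_tgtL tgtM mulrA.
transitivity (sc n (fun u m => tsumU (coact N m) (fun v m' => G u v m'))).
  rewrite sc_coassoc //; apply: eq_sc => u m; rewrite -counit_tgtR.
  by rewrite (morph_sw (f := F^~ m)) // => x y; apply: (balUl Fb).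
apply: eq_sc => u m; rewrite co_ractE (morph_sc (f := F u)).
  by apply: eq_sc => v m'; rewrite -(balUA Fb).
by move=> x y; apply: (balUr Fb).
Qed.

(** As for [sc_takeuchi], now contracting the first leg and collapsing with [counit_srcR]. *)
Lemma sc_co_ract a n : sc (co_ract n a) F = sc n (fun u m => F (u * src B a) m).
Proof.
pose G u v m := F (src B (counit B (u * tgt B a)) * v) m.
have Gb : balUU G.
  split=> [m|u]; split=> [x y z|x y z|x b y]; rewrite /G.
  - by rewrite mulrDl counitD srcD mulrDl (balUl Fb).
  - rewrite -(balUl Fb); congr (F _ _); exact: mulrDr.
  - rewrite -mulrA counit_tgtL srcM -mulrA; congr (F _ _).
  - by rewrite mulrDr (balUl Fb).
  - exact: (balUr Fb).
  - by rewrite -(balUA Fb) !mulrA src_tgtC.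
transitivity (sc n (fun u m => tsumU (coact N m) (fun v m' => G u v m'))).
  rewrite co_ractE (morph_sc (f := fun z => sc z F)); last by move=> x y; apply: scD.
  by apply: eq_sc => u m; rewrite scZ.
rewrite sc_coassoc //; apply: eq_sc => u m; rewrite -counit_srcR.
by rewrite (morph_sw (f := F^~ m)) // => x y; apply: (balUl Fb).
Qed.
End ComoduleTakeuchi.

Section YetterDrinfeld.
Variable N : yd_module B.
Variable V : zmodType.

Lemma sc_yd u (n : N) (F : U -> N -> V) : balU F ->
  sw u (fun u1 u2 => sc (yact u1 n) (fun w m => F (w * u2) m)) =
  sc n (fun w m => sw u (fun u1 u2 => F (u1 * w) (yact u2 m))).
Proof.
move=> Fb; have := congr1 (fun z : Utens B N => tsumU z F) (yd_compat u n).
rewrite [LHS]tsumU_bind // [RHS]tsumU_bind // => e.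
apply: etrans (etrans _ e) _; apply: eq_tsumU => v w.
  by rewrite [RHS]tsumU_bind //; apply: eq_tsumU => ? ?; rewrite tsumU_uot.
by rewrite [LHS]tsumU_bind //; apply: eq_tsumU => ? ?; rewrite tsumU_uot.
Qed.
End YetterDrinfeld.

(** * Cup product and diagonal action *)

Section CupAct.
Variable N : yd_algebra B.
Implicit Types (m n : N).

Lemma sc_mul (V : zmodType) m n (F : U -> N -> V) : balU F ->
  sc (ymul m n) F = sc n (fun v n0 => sc m (fun u m0 => F (u * v) (ymul m0 n0))).
Proof.
move=> Fb; rewrite /sc coact_mul [LHS]tsumU_bind //; apply: eq_tsumU => v n0.
by rewrite [LHS]tsumU_bind //; apply: eq_tsumU => u m0; rewrite tsumU_uot.
Qed.

Lemma sc_one (V : zmodType) (F : U -> N -> V) : balU F -> sc (yone N) F = F 1 (yone N).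
Proof. by move=> Fb; rewrite /sc coact_one tsumU_uot. Qed.

(** The properties are proved together by induction on q: the sum that defines [cup0] in degree q +
    1 is over a balanced function only thanks to them in degree q. *)
Record cup0_spec q : Prop := Cup0Spec {
  cup0Dl : forall m m' (y : Cco N q), cup0 (m + m') y = cup0 m y + cup0 m' y;
  cup0Dr : forall m (y y' : Cco N q), cup0 m (y + y') = cup0 m y + cup0 m y';
  cup0Z : forall a m (y : Cco N q), cup0 (a *: m) y = a *: cup0 m y;
  cup0_bal : forall a m (y : Cco N q), cup0 (co_ract m a) y = cup0 m (a *: y)
}.

Lemma cup0_bal1 q (v : U) (y : Cco N q) : cup0_spec q ->
  balU (fun w m => uot B (w * v) (cup0 m y)).
Proof.
case=> cDl cDr cZ cb; apply: (@balU_mulr _ _ (fun w m => uot B w (cup0 m y))).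
have [Ul Ur UA] := balU_uot (Cco N q).
by split=> *; rewrite ?Ul ?Ur ?cDl ?cZ ?UA.
Qed.

(** To move a from v to y, first [sc_takeuchi] turns it into a right action on m_(0), then
    [cup0_bal] passes it on to y. *)
Lemma cup0_bal2 q m : cup0_spec q ->
  balU (fun v (y : Cco N q) => sc m (fun w m0 => uot B (w * v) (cup0 m0 y))).
Proof.
move=> qs; case: (qs) => cDl cDr cZ cb; have [Ul Ur UA] := balU_uot (Cco N q).
split=> [v v' y|v y y'|v a y].
- by rewrite -scDF; apply: eq_sc => w m0; rewrite mulrDr Ul.
- by rewrite -scDF; apply: eq_sc => w m0; rewrite cDr Ur.
- transitivity (sc m (fun w m0 => uot B (w * tgt B a * v) (cup0 m0 y))).
    by apply: eq_sc => w m0; rewrite mulrA.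
  rewrite (sc_takeuchi (cup0_bal1 v y qs)).
  by apply: eq_sc => w m0; rewrite cb.
Qed.

Lemma cup0_uot_of q m v (y : Cco N q) : cup0_spec q ->
  cup0 (q := q.+1) m (uot B v y) = sc m (fun w m0 => uot B (w * v) (cup0 m0 y)).
Proof. by move=> qs; apply: tsumU_uot (cup0_bal2 m qs). Qed.

Lemma cup0P q : cup0_spec q.
Proof.
elim: q => [|q qs].
  split=> [m m' y|m y y'|a m y|a m y] /=.
  - exact: ymulDl.
  - exact: ymulDr.
  - exact: ymulZl.
  - exact: ymul_bal.
have step m := cup0_bal2 m qs; have in_bal v y := cup0_bal1 v y qs.
have cE m (z : Cco N q.+1) : cup0 m z =
  tsumU z (fun v y => sc m (fun w m0 => uot B (w * v) (cup0 m0 y))) by [].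
split=> [m m' z|m y y'|a m z|a m z].
- rewrite !cE -tsumUDF; apply: eq_tsumU => v y; exact: scD.
- exact: tsumUD (step m) _ _.
- rewrite !cE /tsumU scale_tsum; apply: eq_tsum => v y.
  rewrite scZ // /sc /tsumU scale_tsum; apply: eq_tsum => w m0.
  by rewrite -mulrA; apply: uot_src.
- rewrite !cE tsumUZ //; apply: eq_tsumU => v y; rewrite sc_co_ract //.
  by apply: eq_sc => w m0; rewrite mulrA.
Qed.

Lemma cup0_uot q m v (y : Cco N q) :
  cup0 (q := q.+1) m (uot B v y) = sc m (fun w m0 => uot B (w * v) (cup0 m0 y)).
Proof. exact/cup0_uot_of/cup0P. Qed.

Record cup_spec p q : Prop := CupSpec {
  cupDl : forall (x x' : Cco N p) (y : Cco N q), cup (x + x') y = cup x y + cup x' y;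
  cupDr : forall (x : Cco N p) (y y' : Cco N q), cup x (y + y') = cup x y + cup x y';
  cupZ : forall a (x : Cco N p) (y : Cco N q), cup (a *: x) y = a *: cup x y
}.

Lemma cup_bal p q (y : Cco N q) : cup_spec p q ->
  balU (fun u (x : Cco N p) => uot B u (cup x y)).
Proof.
case=> cDl cDr cZ; have [Ul Ur UA] := balU_uot (Cco N (p + q)).
by split=> *; rewrite ?Ul ?cDl ?Ur ?cZ ?UA.
Qed.

Lemma cupP p q : cup_spec p q.
Proof.
elim: p => [|p ps].
  by case: (cup0P q) => *; split.
have step y := cup_bal y ps; case: (ps) => cDl cDr cZ.
have cE (z : Cco N p.+1) (y : Cco N q) : cup z y = tsumU z (fun u x => uot B u (cup x y)) by [].
split=> [x x' y|x y y'|a x y].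
- exact: tsumUD (step y) _ _.
- rewrite !cE -tsumUDF; apply: eq_tsumU => u z; rewrite cDr; exact: otDr.
- rewrite !cE tsumUZ // /tsumU scale_tsum; apply: eq_tsum => u z; exact: uot_src.
Qed.

Lemma cup_uot p q u (x : Cco N p) (y : Cco N q) :
  cup (p := p.+1) (uot B u x) y = uot B u (cup x y).
Proof. exact: tsumU_uot (cup_bal y (cupP p q)). Qed.

(* (u_(1) v^1, ..., u_(q) v^q, u_(q+1) n) for y = (v^1, ..., v^q, n); with    *)
(* it (u, x) o_1 y becomes the cup product (u . y) x (see ins_cup).           *)
Fixpoint cact (q : nat) : U -> Cco N q -> Cco N q :=
  match q return U -> Cco N q -> Cco N q with
  | 0 => fun u n => yact u n
  | q'.+1 => fun u z =>
      tsumU z (fun v (y : Cco N q') => sw u (fun u1 u2 => uot B (u1 * v) (cact u2 y)))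
  end.

Record cact_spec q : Prop := CactSpec {
  cactDl : forall u v (y : Cco N q), cact (u + v) y = cact u y + cact v y;
  cactDr : forall u (y y' : Cco N q), cact u (y + y') = cact u y + cact u y';
  cactM : forall u v (y : Cco N q), cact (u * v) y = cact u (cact v y);
  cact1 : forall y : Cco N q, cact 1 y = y;
  cact_src : forall a (y : Cco N q), cact (src B a) y = a *: y
}.

Lemma cact_bal1 q v (y : Cco N q) : cact_spec q ->
  balU (X := lU B) (fun u1 u2 => uot B (u1 * v) (cact u2 y)).
Proof.
case=> cDl cDr cM c1 cs.
suff b : balU (X := lU B) (fun w t : U => uot B w (cact t y)) by apply: (balU_mulr v b).
have [Ul Ur UA] := balU_uot (Cco N q).
split=> [w w' u|w u u'|w a u]; rewrite ?Ul // ?UA.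
  by rewrite -Ur; congr (uot _ _ _); apply: cDl.
by rewrite -cs; congr (uot _ _ _); apply/esym/cM.
Qed.

Lemma cact_bal2 q u : cact_spec q ->
  balU (fun v (y : Cco N q) => sw u (fun u1 u2 => uot B (u1 * v) (cact u2 y))).
Proof.
move=> qs; case: (qs) => cDl cDr cM c1 cs; have [Ul Ur UA] := balU_uot (Cco N q).
split=> [v v' y|v y y'|v a y].
- by rewrite -swDF; apply: eq_sw => w t; rewrite mulrDr Ul.
- by rewrite -swDF; apply: eq_sw => w t; rewrite cDr Ur.
- transitivity (sw u (fun w t => uot B (w * tgt B a * v) (cact t y))).
    by apply: eq_sw => w t; rewrite mulrA.
  rewrite (sw_takeuchi a u (cact_bal1 v y qs)).
  by apply: eq_sw => w t; rewrite -cs cM.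
Qed.

Lemma cactP q : cact_spec q.
Proof.
elim: q => [|q qs].
  split=> [u v y|u y y'|u v y|y|a y] /=.
  - exact: yactDl.
  - exact: yactDr.
  - exact: yactA.
  - exact: yact1.
  - exact: yact_src.
have step u := cact_bal2 u qs; have in_bal v y := cact_bal1 v y qs.
case: (qs) => cDl cDr cM c1 cs.
have cE u (z : Cco N q.+1) : cact u z =
  tsumU z (fun v (y : Cco N q) => sw u (fun u1 u2 => uot B (u1 * v) (cact u2 y))) by [].
have retE (z : Cco N q.+1) : tsumU z (fun v (y : Cco N q) => uot B v y) = z.
  exact/esym/tensE.
split=> [u v z|u y y'|u v z|z|a z].
- rewrite !cE -tsumUDF; apply: eq_tsumU => x y; exact: swD.
- exact: tsumUD (step u) _ _.
- rewrite [RHS]cE [cact v z]cE [RHS]tsumU_bind // cE; apply: eq_tsumU => x y.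
  rewrite swM // [RHS]tsumU_bind //; apply: eq_sw => v1 v2; rewrite tsumU_uot //.
  by apply: eq_sw => u1 u2; rewrite cM mulrA.
- by rewrite cE -[RHS]retE; apply: eq_tsumU => x y; rewrite sw1 // mul1r c1.
- rewrite cE -[in RHS](retE z) /tsumU scale_tsum; apply: eq_tsum => x y.
  by rewrite sw_srcE // c1 uot_src.
Qed.

Lemma cact_uot q u v (y : Cco N q) :
  cact (q := q.+1) u (uot B v y) = sw u (fun u1 u2 => uot B (u1 * v) (cact u2 y)).
Proof. exact: tsumU_uot (cact_bal2 u (cactP q)). Qed.

Lemma ins_cup q r u (y : Cco N q) (x : Cco N r) : ins u y x = cup (cact u y) x.
Proof.
have Ml p (z : Cco N r) : {morph (fun w : Cco N p => cup w z) : a b / a + b}.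
  by move=> a b; apply: (cupDl (cupP p r)).
elim: q u y => [|q IH] u y //.
apply: etrans (esym (morph_tsumU y _ (Ml q.+1 x))); apply: eq_tsumU => v y'.
apply: etrans (esym (morph_sw u _ (Ml q.+1 x))); apply: eq_sw => u1 u2.
by rewrite [RHS]cup_uot -IH.
Qed.
End CupAct.
End Sweedler.

(** * The total algebra of cochains *)

Section DirectSum.
Variables (R : pzRingType) (V : nat -> lmodType R).

Lemma degcast_id n (x : V n) : degcast V n x = x.
Proof. by rewrite /degcast; case: eqP => // e; rewrite eq_axiomK. Qed.

Lemma degcast_neq m n (x : V m) : m <> n -> degcast V n x = 0.
Proof. by rewrite /degcast; case: eqP. Qed.

Lemma degcast_linear m n : linear (fun x : V m => degcast V n x).
Proof.
move=> a x y; have [e|/eqP e] := eqVneq m n; last by rewrite !degcast_neq // scaler0 addr0.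
by case: n / e; rewrite !degcast_id.
Qed.

(** Families of finite support. The bound is only asserted to exist, so that elements with equal
    components are equal. *)
Record dsum := DSum {
  dsval :> forall n, V n;
  dsvalP : exists b, forall n, (b <= n)%N -> dsval n = 0
}.

Lemma dsumP (x y : dsum) : (forall n, x n = y n) -> x = y.
Proof.
case: x y => [f fP] [g gP] /= fg; have e : f = g by apply: functional_extensionality_dep.
by case: g / e gP {fg} => gP; congr DSum; apply: Prop_irrelevance.
Qed.

HB.instance Definition _ := gen_eqMixin dsum.
HB.instance Definition _ := gen_choiceMixin dsum.

Program Definition dsum0 : dsum := @DSum (fun=> 0) _.
Next Obligation. by exists 0%N. Qed.
Program Definition dsum_add (x y : dsum) : dsum := @DSum (fun n => x n + y n) _.
Next Obligation.
case: (dsvalP x) (dsvalP y) => [b xb] [c yc]; exists (maxn b c) => n.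
by rewrite geq_max => /andP[bn cn]; rewrite xb // yc // addr0.
Qed.
Program Definition dsum_opp (x : dsum) : dsum := @DSum (fun n => - x n) _.
Next Obligation. by case: (dsvalP x) => [b xb]; exists b => n bn; rewrite xb ?oppr0. Qed.
Program Definition dsum_scale (a : R) (x : dsum) : dsum := @DSum (fun n => a *: x n) _.
Next Obligation. by case: (dsvalP x) => [b xb]; exists b => n bn; rewrite xb ?scaler0. Qed.

Fact dsum_addA : associative dsum_add.
Proof. by move=> x y z; apply: dsumP => n; apply: addrA. Qed.
Fact dsum_addC : commutative dsum_add.
Proof. by move=> x y; apply: dsumP => n; apply: addrC. Qed.
Fact dsum_add0 : left_id dsum0 dsum_add.
Proof. by move=> x; apply: dsumP => n; apply: add0r. Qed.
Fact dsum_addN : left_inverse dsum0 dsum_opp dsum_add.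
Proof. by move=> x; apply: dsumP => n; apply: addNr. Qed.
HB.instance Definition _ :=
  GRing.isZmodule.Build dsum dsum_addA dsum_addC dsum_add0 dsum_addN.

Fact dsum_scaleA a b x : dsum_scale a (dsum_scale b x) = dsum_scale (a * b) x.
Proof. by apply: dsumP => n; apply: scalerA. Qed.
Fact dsum_scale1 : left_id 1 dsum_scale.
Proof. by move=> x; apply: dsumP => n; apply: scale1r. Qed.
Fact dsum_scaleDr : right_distributive dsum_scale +%R.
Proof. by move=> a x y; apply: dsumP => n; apply: scalerDr. Qed.
Fact dsum_scaleDl x : {morph dsum_scale^~ x : a b / a + b}.
Proof. by move=> a b; apply: dsumP => n; apply: scalerDl. Qed.
HB.instance Definition _ := GRing.Zmodule_isLmodule.Build R dsum
  dsum_scaleA dsum_scale1 dsum_scaleDr dsum_scaleDl.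

Lemma dsumDE (x y : dsum) n : (x + y) n = x n + y n. Proof. by []. Qed.
Lemma dsumZE a (x : dsum) n : (a *: x) n = a *: x n. Proof. by []. Qed.

Fact dinj_subproof m (x : V m) : exists b, forall n, (b <= n)%N -> degcast V n x = 0.
Proof.
by exists m.+1 => n mn; apply: degcast_neq => e; rewrite e ltnn in mn.
Qed.
Definition dinj m (x : V m) : dsum := DSum (dinj_subproof x).

Lemma dinjE m (x : V m) : dinj x m = x. Proof. exact: degcast_id. Qed.

Lemma dinj_neq m n (x : V m) : m <> n -> dinj x n = 0.
Proof. exact: degcast_neq. Qed.

Lemma dinj_linear m : linear (@dinj m).
Proof. by move=> a x y; apply: dsumP => n; apply: degcast_linear. Qed.
HB.instance Definition _ m := GRing.isLinear.Build R (V m) dsum _ (@dinj m) (@dinj_linear m).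

Lemma dinj_inj m : injective (@dinj m).
Proof. by move=> x y e; rewrite -[x]dinjE e dinjE. Qed.

Lemma dinj_degcast m n (x : V m) : m = n -> dinj (degcast V n x) = dinj x.
Proof. by move=> e; case: n / e; rewrite degcast_id. Qed.

Lemma dinj_val (x : dsum) m n : dinj (x m) n = if m == n then x n else 0.
Proof. by case: eqP => [<-|/dinj_neq ->] //; rewrite dinjE. Qed.

Lemma dsum_sumE (x : dsum) b : (forall n, (b <= n)%N -> x n = 0) ->
  x = \sum_(n < b) dinj (x n).
Proof.
move=> xb; apply: dsumP => n.
have -> : (\sum_(i < b) dinj (x i)) n = \sum_(i < b) dinj (x i) n.
  by elim/big_rec2: _ => // i y z _ <-.
under eq_bigr do rewrite dinj_val.
rewrite -big_mkcond; have [nb|nb] := ltnP n b.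
  by rewrite (big_pred1 (Ordinal nb)) // => i; rewrite -val_eqE.
rewrite big_pred0 ?xb // => i; apply/eqP => e; move: (ltn_ord i).
by rewrite e ltnNge nb.
Qed.

Lemma dsum_ind (P : dsum -> Prop) : P 0 -> (forall x y, P x -> P y -> P (x + y)) ->
  (forall n (x : V n), P (dinj x)) -> forall x, P x.
Proof.
move=> P0 PD Pi x; case: (dsvalP x) => b /dsum_sumE ->.
by elim/big_ind: _ => // i _; apply: Pi.
Qed.

Section Lift.
Variables (Z : zmodType) (g : forall n, V n -> Z).

(** The map out of the direct sum induced by the [g n]; it sums up to a chosen bound of the support,
    and [dliftE] shows that any bound will do. *)
Definition dlift (x : dsum) : Z := \sum_(n < sval (cid (dsvalP x))) g (x n).

Hypothesis gD : forall n, {morph @g n : x y / x + y}.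

Lemma dliftE (x : dsum) b : (forall n, (b <= n)%N -> x n = 0) -> dlift x = \sum_(n < b) g (x n).
Proof.
rewrite /dlift; case: cid => c /= xc xb.
have g0 n : g (0 : V n) = 0 by apply: (@addrI _ (g (0 : V n))); rewrite -gD !addr0.
wlog bc : b c xb xc / (b <= c)%N.
  by move=> H; case/orP: (leq_total b c) => bc; [|apply/esym]; apply: H.
rewrite (big_ord_widen c (fun n => g (x n)) bc) [RHS]big_mkcond; apply: eq_bigr => i _.
by case: ltnP => // /xb ->.
Qed.

Lemma dliftD : {morph dlift : x y / x + y}.
Proof.
move=> x y; case: (dsvalP x) (dsvalP y) => [b xb] [c yc].
have zb (z : dsum) d e : (forall n, (d <= n)%N -> z n = 0) ->
    forall n, (maxn d e <= n)%N -> z n = 0.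
  by move=> zd n; rewrite geq_max => /andP[/zd].
have xm := zb x b c xb; have ym : forall n, (maxn b c <= n)%N -> y n = 0.
  by rewrite maxnC; apply: zb.
rewrite (dliftE xm) (dliftE ym) (@dliftE _ (maxn b c)).
  by rewrite -big_split; apply: eq_bigr => i _; rewrite /= gD.
by move=> n bn; rewrite dsumDE xm // ym // addr0.
Qed.

Lemma dlift_dinj n (x : V n) : dlift (dinj x) = g x.
Proof.
rewrite (@dliftE _ n.+1); last by move=> m nm; apply: dinj_neq => e; rewrite e ltnn in nm.
have g0 m : g (0 : V m) = 0 by apply: (@addrI _ (g (0 : V m))); rewrite -gD !addr0.
transitivity (g (dinj x n)); last by rewrite dinjE.
rewrite big_ord_recr big1; first exact: add0r.
move=> i _.
by rewrite dinj_neq // => /= e; move: (ltn_ord i); rewrite -e ltnn.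
Qed.
End Lift.

Lemma dliftZ (Z : lmodType R) (g : forall n, V n -> Z) :
  (forall n, linear (g n)) -> linear (dlift g).
Proof.
move=> gl; have gD n : {morph g n : x y / x + y}.
  by move=> x y; have := gl n 1 x y; rewrite !scale1r.
have gZ n a (x : V n) : g n (a *: x) = a *: g n x.
  have g0 : g n 0 = 0 by apply: (@addrI _ (g n 0)); rewrite -gD !addr0.
  by have := gl n a x 0; rewrite !addr0 g0 addr0.
move=> a x y; rewrite dliftD //; congr (_ + _); case: (dsvalP x) => b xb.
rewrite (dliftE gD xb) (dliftE gD (b := b)) => [|n /xb xn0]; last by rewrite dsumZE xn0 scaler0.
by rewrite scaler_sumr; apply: eq_bigr => i _; rewrite dsumZE gZ.
Qed.
End DirectSum.

Section TotalAlgebra.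
Variables (k : comPzRingType) (A U : kalgType k) (B : left_bialgebroid A U).
Variable N : yd_algebra B.
Implicit Types (u : U) (a : A) (m n : N).

(* All degrees are put into one ring, so that identities between cochains     *)
(* need no transport along equalities of degrees.                             *)
Definition tot : Type := dsum (Cco N).
HB.instance Definition _ := GRing.Lmodule.on tot.
Implicit Types x y z : tot.

Definition tin p (c : Cco N p) : tot := dinj c.
Definition ofN n : tot := @tin 0 n.

Lemma tin_linear p : linear (@tin p).
Proof. exact: dinj_linear. Qed.
HB.instance Definition _ p := GRing.isLinear.Build A (Cco N p) tot _ (@tin p) (@tin_linear p).

Lemma tinD p (c d : Cco N p) : tin (c + d) = tin c + tin d.
Proof. exact: (raddfD (@tin p)). Qed.
Lemma tinN p (c : Cco N p) : tin (- c) = - tin c.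
Proof. exact: (raddfN (@tin p)). Qed.

Definition homog p x := exists c : Cco N p, x = tin c.

Lemma homogD p x y : homog p x -> homog p y -> homog p (x + y).
Proof. by move=> [c ->] [d ->]; exists (c + d); rewrite raddfD. Qed.
Lemma homog0 p : homog p 0.
Proof. by exists 0; rewrite raddf0. Qed.
Lemma homogN p x : homog p x -> homog p (- x).
Proof. by move=> [c ->]; exists (- c); rewrite raddfN. Qed.
Lemma homog_ofN n : homog 0 (ofN n).
Proof. by exists n. Qed.

(** Prefixing: (u^1, ..., u^p, n) |-> (u, u^1, ..., u^p, n). *)
Definition ucons u x : tot := dlift (fun p (c : Cco N p) => @tin p.+1 (uot B u c)) x.

Lemma ucons_subproof u p : {morph (fun c : Cco N p => @tin p.+1 (uot B u c)) : x y / x + y}.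
Proof. by move=> c d; rewrite (balUr (balU_uot B _)) raddfD. Qed.

Lemma ucons_tin u p (c : Cco N p) : ucons u (tin c) = @tin p.+1 (uot B u c).
Proof. exact: dlift_dinj (ucons_subproof u) _ _. Qed.

Definition additive_fun (V W : zmodType) (f : V -> W) := {morph f : x y / x + y}.

Lemma additive_fun0 (V W : zmodType) (f : V -> W) : additive_fun f -> f 0 = 0.
Proof. by move=> fD; apply: (@addrI _ (f 0)); rewrite -fD !addr0. Qed.

Lemma tot_eq (V : zmodType) (f g : tot -> V) : additive_fun f -> additive_fun g ->
  (forall p (c : Cco N p), f (tin c) = g (tin c)) -> forall x, f x = g x.
Proof.
move=> fD gD fg; elim/dsum_ind=> // [|x y fx fy]; first by rewrite !additive_fun0.
by rewrite (fD x y) (gD x y) fx fy.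
Qed.

Lemma uconsDr u : additive_fun (ucons u).
Proof. exact: dliftD (ucons_subproof u). Qed.

Lemma ucons_bal : balU B ucons.
Proof.
split=> [u v x|u x y|u a x]; last 1 first.
- apply: (tot_eq (f := ucons (tgt B a * u)) (g := fun x => ucons u (a *: x))).
  + exact: uconsDr.
  + by move=> y z; rewrite scalerDr uconsDr.
  + move=> p c; rewrite -(linearZZ (@tin p)) !ucons_tin; congr tin; exact: uot_tgt.
- apply: (tot_eq (f := ucons (u + v)) (g := fun x => ucons u x + ucons v x)).
  + exact: uconsDr.
  + by move=> y z; rewrite !uconsDr addrACA.
  + by move=> p c; rewrite !ucons_tin -raddfD; congr tin; apply: otDl.
- exact: uconsDr.
Qed.

Lemma uconsDl u v x : ucons (u + v) x = ucons u x + ucons v x.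
Proof. exact: (balUl ucons_bal). Qed.

Lemma ucons_src a u x : ucons (src B a * u) x = a *: ucons u x.
Proof.
apply: (tot_eq (f := ucons (src B a * u)) (g := fun x => a *: ucons u x)).
- exact: uconsDr.
- by move=> y z; rewrite uconsDr scalerDr.
- by move=> p c; rewrite !ucons_tin -linearZZ; congr tin; apply: uot_src.
Qed.

Lemma homog_ucons p u x : homog p x -> homog p.+1 (ucons u x).
Proof. by move=> [c ->]; rewrite ucons_tin; eexists. Qed.

(** Every cochain is a sum of elements obtained from N by repeated prefixing. This induction
    replaces computations with elementary tensors of arbitrary length. *)
Lemma homog_ind (P : nat -> tot -> Prop) :
  (forall p, P p 0) -> (forall p x y, homog p x -> homog p y -> P p x -> P p y -> P p (x + y)) ->
  (forall n, P 0%N (ofN n)) -> (forall p u x, homog p x -> P p x -> P p.+1 (ucons u x)) ->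
  forall p x, homog p x -> P p x.
Proof.
move=> P0 PD Pn Pu p _ [c ->]; elim: p c => [|p IH] c; first exact: Pn.
elim/Utens_ind: c => [|c d Pc Pd|u c]; first by rewrite raddf0.
  by rewrite raddfD; apply: PD => //; eexists.
by rewrite -ucons_tin; apply: Pu; first eexists.
Qed.

Lemma cons_ind (P : tot -> Prop) : P 0 -> (forall x y, P x -> P y -> P (x + y)) ->
  (forall n, P (ofN n)) -> (forall u x, P x -> P (ucons u x)) -> forall x, P x.
Proof.
move=> P0 PD Pn Pu; apply: dsum_ind => // p c.
by apply: (@homog_ind (fun=> P) _ _ _ _ p); auto; eexists.
Qed.

Lemma cons_eq (V : zmodType) (f g : tot -> V) : additive_fun f -> additive_fun g ->
  (forall n, f (ofN n) = g (ofN n)) ->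
  (forall u x, f x = g x -> f (ucons u x) = g (ucons u x)) -> forall x, f x = g x.
Proof.
move=> fD gD fn fu; apply: cons_ind => //; first by rewrite !additive_fun0.
by move=> x y fx fy; rewrite fD gD fx fy.
Qed.

Definition tmul x y : tot := dlift (fun p (c : Cco N p) =>
  dlift (fun q (d : Cco N q) => tin (cup c d)) y) x.

Lemma tmul_subproof p (c : Cco N p) q : additive_fun (fun d : Cco N q => tin (cup c d)).
Proof. by move=> d e; rewrite (cupDr (cupP N p q)) raddfD. Qed.

Lemma tmul_subproof2 y p :
  additive_fun (fun (c : Cco N p) => dlift (fun q (d : Cco N q) => tin (cup c d)) y).
Proof.
move=> c c'; apply: (tot_eq (f := dlift (fun q (d : Cco N q) => tin (cup (c + c') d)))
  (g := fun y => dlift (fun q (d : Cco N q) => tin (cup c d)) y +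
                 dlift (fun q (d : Cco N q) => tin (cup c' d)) y)).
- exact: (dliftD (tmul_subproof _)).
- by move=> z w; rewrite !(dliftD (tmul_subproof _)) addrACA.
- move=> q d; rewrite !(dlift_dinj (tmul_subproof _)).
  by rewrite (cupDl (cupP N p q)) raddfD.
Qed.

Lemma tmulDl y : additive_fun (tmul^~ y).
Proof. exact: (dliftD (tmul_subproof2 y)). Qed.

Lemma tmul_tin p q (c : Cco N p) (d : Cco N q) : tmul (tin c) (tin d) = tin (cup c d).
Proof.
by rewrite /tmul (dlift_dinj (tmul_subproof2 _)) (dlift_dinj (tmul_subproof _)).
Qed.

Lemma tmulDr x : additive_fun (tmul x).
Proof.
move=> y z; apply: (tot_eq (f := tmul^~ (y + z)) (g := fun x => tmul x y + tmul x z)).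
- exact: tmulDl.
- by move=> v w; rewrite !tmulDl addrACA.
- move=> p c; rewrite /tmul !(dlift_dinj (tmul_subproof2 _)).
  exact: (dliftD (tmul_subproof c)).
Qed.

Lemma tot_eq2 (V : zmodType) (f g : tot -> tot -> V) :
  (forall y, additive_fun (f^~ y)) -> (forall x, additive_fun (f x)) ->
  (forall y, additive_fun (g^~ y)) -> (forall x, additive_fun (g x)) ->
  (forall p (c : Cco N p) q (d : Cco N q), f (tin c) (tin d) = g (tin c) (tin d)) ->
  forall x y, f x y = g x y.
Proof.
move=> fl fr gl gr fg x y; apply: (tot_eq (f := f^~ y) (g := g^~ y)) => // p c.
exact: (tot_eq (f := f (tin c)) (g := g (tin c))).
Qed.

Lemma tmul_ucons u x y : tmul (ucons u x) y = ucons u (tmul x y).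
Proof.
apply: (tot_eq2 (f := fun x y => tmul (ucons u x) y) (g := fun x y => ucons u (tmul x y))).
- by move=> {}y v w; rewrite uconsDr tmulDl.
- by move=> {}x v w; rewrite tmulDr.
- by move=> {}y v w; rewrite tmulDl uconsDr.
- by move=> {}x v w; rewrite tmulDr uconsDr.
- by move=> p c q d; rewrite tmul_tin !ucons_tin tmul_tin cup_uot.
Qed.

Lemma tmul_ofN m n : tmul (ofN m) (ofN n) = ofN (ymul m n).
Proof. exact: tmul_tin. Qed.

Lemma tmulZl a x y : tmul (a *: x) y = a *: tmul x y.
Proof.
apply: (tot_eq2 (f := fun x y => tmul (a *: x) y) (g := fun x y => a *: tmul x y)).
- by move=> {}y v w; rewrite scalerDr tmulDl.
- by move=> {}x v w; rewrite tmulDr.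
- by move=> {}y v w; rewrite tmulDl scalerDr.
- by move=> {}x v w; rewrite tmulDr scalerDr.
- move=> p c q d; rewrite -linearZZ !tmul_tin -linearZZ; congr tin.
  exact: (cupZ (cupP N p q)).
Qed.

Lemma ofND : additive_fun ofN.
Proof. by move=> m n; apply: (raddfD (@tin 0)). Qed.

Lemma ofNZ a n : ofN (a *: n) = a *: ofN n.
Proof. exact: (linearZZ (@tin 0)). Qed.

Lemma tmul_bal v y : balU B (fun w m => ucons (w * v) (tmul (ofN m) y)).
Proof.
suff b : balU B (fun w m => ucons w (tmul (ofN m) y)) by apply: (balU_mulr v b).
split=> [u u' n|u n n'|u a n]; first exact: uconsDl.
  by rewrite ofND tmulDl uconsDr.
by rewrite (balUA ucons_bal) ofNZ tmulZl.
Qed.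

Lemma tmul_ofN_ucons m v y :
  tmul (ofN m) (ucons v y) = sc m (fun w m0 => ucons (w * v) (tmul (ofN m0) y)).
Proof.
apply: (tot_eq (f := fun y => tmul (ofN m) (ucons v y))
  (g := fun y => sc m (fun w m0 => ucons (w * v) (tmul (ofN m0) y)))).
- by move=> x z; rewrite uconsDr tmulDr.
- by move=> x z; rewrite -scDF; apply: eq_sc => w m0; rewrite tmulDr uconsDr.
- move=> p c; rewrite ucons_tin tmul_tin [cup _ _]cup0_uot (morph_sc (f := @tin p.+1)).
    by apply: eq_sc => w m0; rewrite tmul_tin ucons_tin.
  exact: raddfD.
Qed.

(** Prefixes of the left factor come out of a product, so that factor reduces to N, and then
    likewise the middle one. For m and n in N before a prefix v, the claim is the multiplicativity
    of the coaction, [sc_mul]. *)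
Lemma tmulA : associative tmul.
Proof.
have A1 m n : forall z, tmul (ofN m) (tmul (ofN n) z) = tmul (tmul (ofN m) (ofN n)) z.
  move=> z; elim/cons_ind: z m n => [|x y IHx IHy|l|u z IH] m n.
  - by rewrite !(additive_fun0 (tmulDr _)).
  - by rewrite !tmulDr IHx IHy.
  - by rewrite !tmul_ofN ymulA.
  - rewrite tmul_ofN !tmul_ofN_ucons sc_mul; last exact: tmul_bal.
    rewrite (morph_sc _ _ (tmulDr (ofN m))).
    apply: eq_sc => v n0; rewrite tmul_ofN_ucons; apply: eq_sc => w m0.
    by rewrite mulrA -tmul_ofN IH.
have A2 z m : forall y, tmul (ofN m) (tmul y z) = tmul (tmul (ofN m) y) z.
  move=> y; elim/cons_ind: y m => [|x y IHx IHy|l|u y IH] m.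
  - by rewrite !(additive_fun0 (tmulDr _), additive_fun0 (tmulDl _)).
  - by rewrite !(tmulDl, tmulDr) IHx IHy.
  - exact: A1.
  - rewrite tmul_ucons !tmul_ofN_ucons (morph_sc _ _ (tmulDl z)); apply: eq_sc => w m0.
    by rewrite tmul_ucons IH.
move=> x y z; apply: (cons_eq (f := tmul^~ (tmul y z))
  (g := fun x => tmul (tmul x y) z)) => [|v w|m|u {}x IH].
- exact: tmulDl.
- by rewrite !tmulDl.
- exact: A2.
- by rewrite !tmul_ucons IH.
Qed.

Definition tone : tot := ofN (yone N).

Lemma tmul1l : left_id tone tmul.
Proof.
apply: cons_eq => [x y|//|n|u x IH]; first exact: tmulDr.
  by rewrite tmul_ofN ymul1n.
rewrite tmul_ofN_ucons sc_one; last exact: tmul_bal.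
by rewrite mul1r IH.
Qed.

Lemma tmul1r : right_id tone tmul.
Proof.
apply: cons_eq => [x y|//|n|u x IH]; first exact: tmulDl.
  by rewrite tmul_ofN ymuln1.
by rewrite tmul_ucons IH.
Qed.

HB.instance Definition _ := GRing.Zmodule_isPzRing.Build tot tmulA tmul1l tmul1r
  (fun x y z => tmulDl z x y) tmulDr.

Lemma mul_ucons u x y : ucons u x * y = ucons u (x * y).
Proof. exact: tmul_ucons. Qed.
Lemma mul_ofN m n : ofN m * ofN n = ofN (ymul m n).
Proof. exact: tmul_ofN. Qed.
Lemma mul_ofN_ucons m v y :
  ofN m * ucons v y = sc m (fun w m0 => ucons (w * v) (ofN m0 * y)).
Proof. exact: tmul_ofN_ucons. Qed.
Lemma mul_tin p q (c : Cco N p) (d : Cco N q) : tin c * tin d = tin (cup c d).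
Proof. exact: tmul_tin. Qed.
Lemma scalemul a x y : a *: x * y = a *: (x * y).
Proof. exact: tmulZl. Qed.
Lemma homog_mul p q x y : homog p x -> homog q y -> homog (p + q) (x * y).
Proof. by move=> [c ->] [d ->]; rewrite mul_tin; eexists. Qed.

Definition tact u x : tot := dlift (fun p (c : Cco N p) => tin (cact u c)) x.

Lemma tact_subproof u p : additive_fun (fun c : Cco N p => tin (cact u c)).
Proof. by move=> c d; rewrite (cactDr (cactP N p)) raddfD. Qed.

Lemma tact_tin u p (c : Cco N p) : tact u (tin c) = tin (cact u c).
Proof. exact: dlift_dinj (tact_subproof u) _ _. Qed.

Lemma tactDr u : additive_fun (tact u).
Proof. exact: dliftD (tact_subproof u). Qed.

Lemma tactDl u v x : tact (u + v) x = tact u x + tact v x.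
Proof.
apply: (tot_eq (f := tact (u + v)) (g := fun x => tact u x + tact v x)).
- exact: tactDr.
- by move=> y z; rewrite !tactDr addrACA.
- by move=> p c; rewrite !tact_tin (cactDl (cactP N p)) raddfD.
Qed.

Lemma tactM u v x : tact (u * v) x = tact u (tact v x).
Proof.
apply: (tot_eq (f := tact (u * v)) (g := fun x => tact u (tact v x))).
- exact: tactDr.
- by move=> y z; rewrite !tactDr.
- by move=> p c; rewrite !tact_tin (cactM (cactP N p)).
Qed.

Lemma tact1 x : tact 1 x = x.
Proof.
apply: (tot_eq (f := tact 1) (g := id)) => // [|p c]; first exact: tactDr.
by rewrite tact_tin (cact1 (cactP N p)).
Qed.

Lemma tact_src a x : tact (src B a) x = a *: x.
Proof.
apply: (tot_eq (f := tact (src B a)) (g := fun x => a *: x)).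
- exact: tactDr.
- by move=> y z; rewrite scalerDr.
- by move=> p c; rewrite tact_tin (cact_src (cactP N p)) linearZZ.
Qed.

Lemma tact_srcl a u x : tact (src B a * u) x = a *: tact u x.
Proof. by rewrite tactM tact_src. Qed.

Lemma tact_ofN u n : tact u (ofN n) = ofN (yact u n).
Proof. exact: tact_tin. Qed.

Lemma homog_tact p u x : homog p x -> homog p (tact u x).
Proof. by move=> [c ->]; rewrite tact_tin; eexists. Qed.

Lemma tact_bal v x : balU B (X := lU B) (fun u1 u2 => ucons (u1 * v) (tact u2 x)).
Proof.
suff b : balU B (X := lU B) (fun w t : U => ucons w (tact t x)) by apply: (balU_mulr v b).
split=> [u u' t|u t t'|u a t]; first exact: uconsDl.
  by rewrite -uconsDr; congr ucons; apply: tactDl.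
by rewrite (balUA ucons_bal) -tact_srcl.
Qed.

Lemma tact_ucons u v x :
  tact u (ucons v x) = sw B u (fun u1 u2 => ucons (u1 * v) (tact u2 x)).
Proof.
apply: (tot_eq (f := fun x => tact u (ucons v x))
  (g := fun x => sw B u (fun u1 u2 => ucons (u1 * v) (tact u2 x)))).
- by move=> y z; rewrite uconsDr tactDr.
- by move=> y z; rewrite -swDF; apply: eq_sw => u1 u2; rewrite tactDr uconsDr.
- move=> p c; rewrite ucons_tin tact_tin cact_uot (morph_sw B (f := @tin p.+1)).
    by apply: eq_sw => u1 u2; rewrite tact_tin ucons_tin.
  exact: raddfD.
Qed.

(** As Delta(t(a)) = 1 (x) t(a), the action of t(a) passes through all prefixes to the component in
    N, where it is the right action of a and [cup0_bal] applies. *)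
Lemma tact_tgt_mul a x y : tact (tgt B a) x * y = x * (a *: y).
Proof.
apply: (cons_eq (f := fun x => tact (tgt B a) x * y) (g := fun x => x * (a *: y))).
- by move=> v w; rewrite tactDr mulrDl.
- by move=> v w; rewrite mulrDl.
- move=> n; rewrite tact_ofN yact_tgt.
  apply: (tot_eq (f := fun y => ofN (co_ract n a) * y) (g := fun y => ofN n * (a *: y))).
  + by move=> v w; rewrite mulrDr.
  + by move=> v w; rewrite scalerDr mulrDr.
  + move=> q d; rewrite mul_tin -(linearZZ (@tin q)) mul_tin; congr tin.
    exact: (cup0_bal (cup0P N q)).
- move=> u {}x IH; rewrite tact_ucons sw_tgtE; last exact: tact_bal.
  by rewrite mul1r !mul_ucons IH.
Qed.

Lemma tact_mul_bal x y : balU B (X := lU B) (fun u1 u2 => tact u1 x * tact u2 y).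
Proof.
split=> [u v w|u v w|u a w].
- by rewrite tactDl mulrDl.
- by rewrite -mulrDr; congr (_ * _); apply: tactDl.
- by rewrite tactM tact_tgt_mul -tact_srcl.
Qed.

Lemma ucons_tact_mul_bal v x y :
  balUU B (X := lU B) (fun u1 u2 u3 => ucons (u1 * v) (tact u2 x * tact u3 y)).
Proof.
have [ml mr mA] := tact_mul_bal x y.
split=> [u3|u1]; last first.
  split=> [u w t|u w t|u a w]; first by rewrite ml uconsDr.
    by rewrite mr uconsDr.
  by rewrite mA.
suff b : balU B (X := lU B) (fun u1 u2 : U => ucons u1 (tact u2 x * tact u3 y)).
  exact: (balU_mulr v b).
split=> [u u' t|u t t'|u a t]; first exact: uconsDl.
  by rewrite ml uconsDr.
by rewrite (balUA ucons_bal) -scalemul -tact_srcl.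
Qed.

(* For x in N this is the Yetter-Drinfel'd condition, iterated. *)
Lemma tact_mul u x y : tact u (x * y) = sw B u (fun u1 u2 => tact u1 x * tact u2 y).
Proof.
have A1 n : forall y u, tact u (ofN n * y) = sw B u (fun u1 u2 => tact u1 (ofN n) * tact u2 y).
  move=> {}y; elim/cons_ind: y n => [|v w IHv IHw|m|v y' IH] n {}u.
  - rewrite mulr0 (additive_fun0 (tactDr _)) /sw /tsumU /tsum big1 // => i _.
    by rewrite (additive_fun0 (tactDr _)) mulr0.
  - by rewrite mulrDr tactDr IHv IHw -swDF; apply: eq_sw => u1 u2; rewrite tactDr mulrDr.
  - rewrite mul_ofN tact_ofN yact_mul (morph_sw _ _ _ ofND).
    by apply: eq_sw => u1 u2; rewrite !tact_ofN mul_ofN.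
  (* Here n meets a prefix v. The left side is (u_(1) n_(-1) v, (u_(2) n_(0)) (u_(3) y')), the right
     side ((u_(1) n)_(-1) u_(2) v, (u_(1) n)_(0) (u_(3) y')); [sc_yd] on the first two legs of u
     identifies them. *)
  - transitivity (sc n (fun w m => sw B u (fun u1 u2 => sw B u2 (fun t1 t2 =>
        ucons (u1 * (w * v)) (tact t1 (ofN m) * tact t2 y'))))).
      rewrite mul_ofN_ucons (morph_sc _ _ (tactDr u)); apply: eq_sc => w m.
      rewrite tact_ucons; apply: eq_sw => u1 u2; rewrite IH (morph_sw _ _ _ (uconsDr _)).
      by apply: eq_sw => t1 t2.
    transitivity (sw B u (fun u1 u2 => sw B u2 (fun t1 t2 =>
        tact u1 (ofN n) * ucons (t1 * v) (tact t2 y')))); last first.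
      apply: eq_sw => u1 u2; rewrite tact_ucons (morph_sw B (f := *%R (tact u1 (ofN n)))) //.
      by move=> ? ?; rewrite mulrDr.
    rewrite -sw_coassoc; last first.
      have [tl tr tA] := tact_bal v y'.
      split=> [u3|u1]; split=> [s t r|s t r|s a t].
      + by rewrite tactDl mulrDl.
      + by rewrite -mulrDr -uconsDl -mulrDl.
      + rewrite tactM tact_tgt_mul -ucons_src; congr (_ * ucons _ _); exact: mulrA.
      + by rewrite tl mulrDr.
      + by rewrite tr mulrDr.
      + by rewrite tA.
    transitivity (sw B u (fun u1 u2 => sc n (fun w m => sw B u1 (fun s1 s2 =>
        ucons (s1 * (w * v)) (tact s2 (ofN m) * tact u2 y'))))); last first.
      apply: eq_sw => u1 u2.
      transitivity (sw B u1 (fun s1 s2 => sc (yact s1 n) (fun w m =>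
          ucons (w * s2 * v) (ofN m * tact u2 y')))).
        apply: etrans (esym (sc_yd u1 n (tmul_bal v (tact u2 y')))).
        by apply: eq_sc => w m; apply: eq_sw => s1 s2; rewrite tact_ofN mulrA.
      apply: eq_sw => s1 s2; rewrite tact_ofN mul_ofN_ucons; apply: eq_sc => w m.
      by rewrite mulrA.
    rewrite sw_sc; apply: eq_sc => w m; rewrite sw_coassoc //.
    exact: ucons_tact_mul_bal.
elim/cons_ind: x u => [|v w IHv IHw|n|v x IH] u.
- rewrite mul0r (additive_fun0 (tactDr _)) /sw /tsumU /tsum big1 // => i _.
  by rewrite (additive_fun0 (tactDr _)) mul0r.
- by rewrite mulrDl tactDr IHv IHw -swDF; apply: eq_sw => u1 u2; rewrite tactDr mulrDl.
- exact: A1.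
- transitivity (sw B u (fun u1 u2 => sw B u2 (fun t1 t2 =>
      ucons (u1 * v) (tact t1 x * tact t2 y)))).
    rewrite mul_ucons tact_ucons; apply: eq_sw => u1 u2.
    by rewrite IH (morph_sw _ _ _ (uconsDr _)).
  rewrite -sw_coassoc; last exact: ucons_tact_mul_bal.
  apply: eq_sw => u1 u2; rewrite tact_ucons (morph_sw B (f := *%R^~ (tact u2 y))).
    by apply: eq_sw => s1 s2; rewrite mul_ucons.
  by move=> ? ?; rewrite mulrDl.
Qed.

(* Recursion along tot = N (+) U (x)_A tot, for functions that vanish on N *)
Section Recursor.
Variables (V : lmodType A) (s : U -> tot -> V -> V).

(** In [s u x v], v stands for the value already computed at x, so additivity and the A-balance are
    required for the pair (x, v). *)
Record rec_spec : Prop := RecSpec {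
  rec_u : forall u u' x v, s (u + u') x v = s u x v + s u' x v;
  rec_D : forall u x x' v v', s u (x + x') (v + v') = s u x v + s u x' v';
  rec_tgt : forall u a x v, s (tgt B a * u) x v = s u (a *: x) (a *: v);
  rec_src : forall u a x v, s (src B a * u) x v = a *: s u x v
}.
Hypothesis sP : rec_spec.

Fixpoint crec (p : nat) : Cco N p -> V :=
  match p return Cco N p -> V with
  | 0 => fun=> 0
  | p'.+1 => fun c => tsumU c (fun u (d : Cco N p') => s u (tin d) (crec d))
  end.

Lemma crec_bal p : linear (@crec p) -> balU B (fun u (d : Cco N p) => s u (tin d) (crec d)).
Proof.
move=> lin; have cD (c d : Cco N p) : crec (c + d) = crec c + crec d :> V.
  by have := lin 1 c d; rewrite !scale1r.
have cZ a (c : Cco N p) : crec (a *: c) = a *: crec c :> V.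
  by have := lin a c 0; rewrite (additive_fun0 cD) !addr0.
split=> [u v c|u c d|u a c]; first exact: (rec_u sP).
  by rewrite raddfD cD (rec_D sP).
by rewrite (rec_tgt sP) cZ -(linearZZ (@tin p)).
Qed.

Lemma crec_linear p : linear (@crec p).
Proof.
elim: p => [|p IH] a c d; first by rewrite /= scaler0 addr0.
have b := crec_bal IH; rewrite /= (tsumUD b (a *: c) d) (tsumUZ a c b); congr (_ + _).
by rewrite /tsumU scale_tsum; apply: eq_tsum => u e; apply: (rec_src sP).
Qed.

Definition trec (x : tot) : V := dlift (@crec) x.

Lemma trec_linear : linear trec.
Proof. exact: dliftZ crec_linear. Qed.

Lemma trec_tin p (c : Cco N p) : trec (tin c) = crec c.
Proof.
by apply: dlift_dinj => q d e; have := crec_linear 1 d e; rewrite !scale1r.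
Qed.

Lemma trecD : additive_fun trec.
Proof. by move=> x y; have := trec_linear 1 x y; rewrite !scale1r. Qed.

Lemma trecZ a x : trec (a *: x) = a *: trec x.
Proof. by have := trec_linear a x 0; rewrite (additive_fun0 trecD) !addr0. Qed.

Lemma trec_ofN n : trec (ofN n) = 0.
Proof. exact: trec_tin. Qed.

Lemma trec_ucons u x : trec (ucons u x) = s u x (trec x).
Proof.
apply: (tot_eq (f := fun x => trec (ucons u x)) (g := fun x => s u x (trec x))).
- by move=> y z; rewrite uconsDr trecD.
- by move=> y z; rewrite trecD (rec_D sP).
- move=> p c; rewrite ucons_tin !trec_tin; apply: tsumU_uot; apply: crec_bal.
  exact: crec_linear.
Qed.
End Recursor.

(** The sign (-1)^e, defined by the parity of e, so that graded identities reduce to cases on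
    parities followed by [zmodule]. *)
Definition tsign (e : nat) x : tot := if odd e then - x else x.

Lemma tsignD (e : nat) : additive_fun (tsign e).
Proof. by move=> x y; rewrite /tsign; case: odd; rewrite ?opprD. Qed.

Lemma tsignN e x : tsign e (- x) = - tsign e x.
Proof. by rewrite /tsign; case: odd. Qed.

Lemma tsign0 e : tsign e 0 = 0.
Proof. exact: additive_fun0 (tsignD e). Qed.

Lemma tsignZ a e x : tsign e (a *: x) = a *: tsign e x.
Proof. by rewrite /tsign; case: odd; rewrite ?scalerN. Qed.

Lemma mul_tsignr e x y : x * tsign e y = tsign e (x * y).
Proof. by rewrite /tsign; case: odd; rewrite ?mulrN. Qed.

Lemma mul_tsignl e x y : tsign e x * y = tsign e (x * y).
Proof. by rewrite /tsign; case: odd; rewrite ?mulNr. Qed.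

Lemma homog_tsign p e x : homog p x -> homog p (tsign e x).
Proof. by rewrite /tsign; case: odd => // /homogN. Qed.

(** * Twisted derivations of the cup algebra *)

Section TwistedDerivation.
Variables (e : nat) (x : tot) (phi : tot -> tot).

(** The common form of two operators: [phi] the identity gives the derivation [tder], and [phi]
    another derivation gives the brace [tbrace]. *)
Definition tpar : tot -> tot := trec (fun u f v => tact u x * phi f + tsign e (ucons u v)).

Hypotheses (phiD : additive_fun phi) (phiZ : forall a f, phi (a *: f) = a *: phi f).

Lemma tpar_rec : rec_spec (V := tot) (fun u f v => tact u x * phi f + tsign e (ucons u v)).
Proof.
split=> [u u' f v|u f f' v v'|u a f v|u a f v].
- by rewrite tactDl mulrDl uconsDl tsignD addrACA.
- by rewrite phiD mulrDr uconsDr tsignD addrACA.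
- by rewrite tactM tact_tgt_mul phiZ (balUA ucons_bal).
- by rewrite tact_srcl ucons_src scalemul tsignZ scalerDr.
Qed.

Lemma tparD : additive_fun tpar. Proof. exact: trecD tpar_rec. Qed.
Lemma tparZ a f : tpar (a *: f) = a *: tpar f. Proof. exact: trecZ tpar_rec _ _. Qed.
Lemma tpar_ofN n : tpar (ofN n) = 0. Proof. exact: trec_ofN tpar_rec _. Qed.
Lemma tpar_ucons u f : tpar (ucons u f) = tact u x * phi f + tsign e (ucons u (tpar f)).
Proof. exact: trec_ucons tpar_rec _ _. Qed.
End TwistedDerivation.

(* The derivation of parity e of the cup algebra that kills N and maps        *)
(* (u, 1_N) to u . x; for x of degree q and e = q + 1, f o-bar x is           *)
(* tder e x f up to sign.                                                     *)
Definition tder (e : nat) (x : tot) : tot -> tot := tpar e x id.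

Lemma tderD e x : additive_fun (tder e x). Proof. exact: tparD. Qed.
Lemma tderN e x f : tder e x (- f) = - tder e x f.
Proof.
apply: (@addrI _ (tder e x f)); rewrite -tderD !subrr.
exact: additive_fun0 (tderD _ _).
Qed.
Lemma tderZ e x a f : tder e x (a *: f) = a *: tder e x f. Proof. exact: tparZ. Qed.
Lemma tder_ofN e x n : tder e x (ofN n) = 0. Proof. exact: tpar_ofN. Qed.
Lemma tder_ucons e x u f :
  tder e x (ucons u f) = tact u x * f + tsign e (ucons u (tder e x f)).
Proof. exact: tpar_ucons. Qed.

Lemma tderDl e f : additive_fun (fun x => tder e x f).
Proof.
move=> x y; apply: (cons_eq (f := tder e (x + y)) (g := fun f => tder e x f + tder e y f)).
- exact: tderD.
- by move=> v w; rewrite !tderD addrACA.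
- by move=> n; rewrite !tder_ofN addr0.
- by move=> u {}f IH; rewrite !tder_ucons IH tactDr mulrDl uconsDr tsignD addrACA.
Qed.

Lemma tderNl e x f : tder e (- x) f = - tder e x f.
Proof.
apply: (@addrI _ (tder e x f)); rewrite -(tderDl e f) !subrr.
exact: additive_fun0 (tderDl e f).
Qed.

Lemma tder0 e x f : homog 0 f -> tder e x f = 0.
Proof. by move=> [n ->]; apply: tder_ofN. Qed.

Lemma homog_tder e q p x f : homog q x -> homog p.+1 f -> homog (p + q) (tder e x f).
Proof.
move=> xq; suff H r : forall f, homog r f -> if r is s.+1 then homog (s + q) (tder e x f) else True.
  exact: (H p.+1).
apply: (homog_ind (P := fun r f => if r is s.+1 then homog (s + q) (tder e x f) else True)).
- by case=> // s; rewrite (additive_fun0 (tderD _ _)); apply: homog0.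
- by case=> // s y z _ _ yq zq; rewrite tderD; apply: homogD.
- by [].
- move=> s u y yh IH; rewrite tder_ucons; apply: homogD.
    by rewrite addnC; apply: homog_mul => //; apply: homog_tact.
  apply: homog_tsign; case: s yh IH => [/tder0 -> _|s _ IH]; last exact: homog_ucons.
  by rewrite (additive_fun0 (uconsDr _)); apply: homog0.
Qed.

Lemma uconsN u x : ucons u (- x) = - ucons u x.
Proof.
by apply: (@addrI _ (ucons u x)); rewrite -uconsDr !subrr (additive_fun0 (uconsDr _)).
Qed.
Lemma tactN u x : tact u (- x) = - tact u x.
Proof.
by apply: (@addrI _ (tact u x)); rewrite -tactDr !subrr (additive_fun0 (tactDr _)).
Qed.
Lemma ucons_tsign u e x : ucons u (tsign e x) = tsign e (ucons u x).
Proof. by rewrite /tsign; case: odd; rewrite ?uconsN. Qed.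
Lemma tact_tsign u e x : tact u (tsign e x) = tsign e (tact u x).
Proof. by rewrite /tsign; case: odd; rewrite ?tactN. Qed.
Lemma tder_tsign e x e' f : tder e x (tsign e' f) = tsign e' (tder e x f).
Proof. by rewrite /tsign; case: odd; rewrite ?tderN. Qed.
Lemma tder_tsignl e x e' f : tder e (tsign e' x) f = tsign e' (tder e x f).
Proof. by rewrite /tsign; case: odd; rewrite ?tderNl. Qed.

(** On (v, f) both sides expand over Delta(u): prefixes by [tact_ucons], the product (v . x) f by
    [tact_mul]. *)
Lemma tder_act e x u f : tder e x (tact u f) = tact u (tder e x f).
Proof.
elim/cons_ind: f u => [|f g IHf IHg|n|v f IH] u.
- by rewrite !(additive_fun0 (tactDr _), additive_fun0 (tderD _ _)).
- by rewrite !(tactDr, tderD) IHf IHg.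
- by rewrite tact_ofN !tder_ofN (additive_fun0 (tactDr _)).
- rewrite tact_ucons tder_ucons tactDr tact_mul tact_tsign tact_ucons.
  rewrite (morph_sw _ _ _ (tderD e x)) (morph_sw _ _ _ (tsignD e)) -swDF.
  by apply: eq_sw => u1 u2; rewrite tder_ucons tactM IH.
Qed.

(** The elements E = (1, 1_N) and mu = (1, 1, 1_N) = E E. *)
Definition tunit : tot := ucons 1 1.
Definition tmu : tot := ucons 1 tunit.

Lemma homog1 : homog 0 (1 : tot). Proof. exact: homog_ofN. Qed.
Lemma homog_tunit : homog 1 tunit. Proof. exact/homog_ucons/homog1. Qed.
Lemma homog_tmu : homog 2 tmu. Proof. exact/homog_ucons/homog_tunit. Qed.

Lemma ucons1E x : ucons 1 x = tunit * x.
Proof. by rewrite /tunit mul_ucons mul1r. Qed.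

Lemma tmuE : tmu = tunit * tunit. Proof. exact: ucons1E. Qed.

Lemma tder_tunit e x : tder e x tunit = x.
Proof.
by rewrite tder_ucons tact1 mulr1 tder_ofN (additive_fun0 (uconsDr _)) tsign0 addr0.
Qed.

(** The second leg of Delta(u) acts on 1_N by the counit, which then cancels against the first
    leg. *)
Lemma tact_tunit u : tact u tunit = ucons u 1.
Proof.
rewrite tact_ucons -[RHS](_ : sw B u (fun u1 u2 => ucons (tgt B (counit B u2) * u1) 1) = _).
  apply: eq_sw => u1 u2; rewrite mulr1 (balUA ucons_bal); congr ucons.
  by rewrite [tact _ _]tact_ofN yact_onel ofNZ.
rewrite -{2}(sw_counitr B u) (morph_sw B (f := ucons^~ 1)) // => v w; exact: uconsDl.
Qed.

Lemma tact_tmu u : tact u tmu = sw B u (fun u1 u2 => ucons u1 (ucons u2 1)).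
Proof.
by rewrite tact_ucons; apply: eq_sw => u1 u2; rewrite mulr1 tact_tunit.
Qed.
End TotalAlgebra.

(** * Derivations and the bracket *)

Section BraidedCommutative.
Variables (k : comPzRingType) (A U : kalgType k) (B : left_bialgebroid A U).
Variable N : bc_yd_algebra B.
Local Notation tot := (tot N).
Local Notation tder := (@tder k A U B N).
Local Notation E := (tunit N).
Local Notation mu := (tmu N).
Implicit Types (u : U) (n : N) (x y f g : tot).

Fact tot_mulDl x y f : (x + y) * f = x * f + y * f. Proof. exact: mulrDl. Qed.
Fact tot_mulDr x y f : f * (x + y) = f * x + f * y. Proof. exact: mulrDr. Qed.
Fact tot_mulrN x y : x * - y = - (x * y). Proof. exact: mulrN. Qed.
Fact tot_mulNr x y : - x * y = - (x * y). Proof. exact: mulNr. Qed.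

Definition texpand :=
  (@tderD _ _ _ B N, @tderN _ _ _ B N, @tder_tsign _ _ _ B N, @tderDl _ _ _ B N, @tderNl _ _ _ B N,
   @tder_tsignl _ _ _ B N, @uconsDr _ _ _ B N, @uconsN _ _ _ B N, @ucons_tsign _ _ _ B N,
   @tactDr _ _ _ B N, @tactN _ _ _ B N, @tact_tsign _ _ _ B N, @mul_tsignl _ _ _ B N,
   @mul_tsignr _ _ _ B N, @tsignD _ _ _ B N, @tsignN _ _ _ B N,
   tot_mulDl, tot_mulDr, tot_mulrN, tot_mulNr).

(* Braided commutativity, iterated *)
Lemma ofN_mul n y : ofN n * y = sc n (fun u n0 => tact u y * ofN n0).
Proof.
elim/cons_ind: y n => [|x y IHx IHy|m|v y IH] n.
- rewrite mulr0 /sc /tsumU /tsum big1 // => i _.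
  by rewrite (additive_fun0 (tactDr _)) mul0r.
- by rewrite mulrDr IHx IHy -scDF; apply: eq_sc => u n0; rewrite tactDr mulrDl.
- rewrite mul_ofN braided_comm (morph_sc _ _ (@ofND _ _ _ _ N)).
  by apply: eq_sc => u n0; rewrite tact_ofN mul_ofN.
- transitivity (sc n (fun w m0 => sc m0 (fun w' m1 =>
      ucons (w * v) (tact w' y * ofN m1)))).
    rewrite mul_ofN_ucons; apply: eq_sc => w m0.
    by rewrite IH (morph_sc _ _ (uconsDr _)).
  rewrite /sc -[LHS]/(sc n (fun w m0 => tsumU (coact N m0) (fun w' m1 =>
      ucons (w * v) (tact w' y * ofN m1)))) sc_coassoc.
    apply: eq_sc => u n0; rewrite tact_ucons.
    rewrite (morph_sw B (f := *%R^~ (ofN n0))); last by move=> ? ?; rewrite mulrDl.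
    by apply: eq_sw => u1 u2; rewrite mul_ucons.
  split=> [m|w]; last first.
    split=> [u u' m|u m m'|u a m]; first by rewrite tactDl mulrDl uconsDr.
      by rewrite ofND mulrDr uconsDr.
    by rewrite tactM tact_tgt_mul -ofNZ.
  suff b : balU B (X := lU B) (fun u1 u2 : U => ucons u1 (tact u2 y * ofN m)).
    exact: (balU_mulr v b).
  split=> [u u' t|u t t'|u a t]; first exact: uconsDl.
    by rewrite -uconsDr -mulrDl -tactDl.
  by rewrite (balUA (ucons_bal N)) -scalemul -tact_srcl.
Qed.

(** Left N-linearity, which is the product rule for a factor that is killed. It rests on braided
    commutativity: moving n past v . x in (v . x) phi(g) produces n_(-1) v . x, the coefficient that
    arises from the prefix n_(-1) v. *)
Lemma tpar_ofN_mul e x (phi : tot -> tot) n g : additive_fun phi ->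
    (forall a f, phi (a *: f) = a *: phi f) ->
    (forall m f, phi (ofN m * f) = ofN m * phi f) ->
  tpar e x phi (ofN n * g) = ofN n * tpar e x phi g.
Proof.
move=> pD pZ pm; have TD := tparD e x pD pZ; have Tu := tpar_ucons e x pD pZ.
elim/cons_ind: g n => [|y z IHy IHz|m|v g IH] n.
- by rewrite !(mulr0, additive_fun0 TD).
- by rewrite !(mulrDr, TD) IHy IHz.
- by rewrite mul_ofN !tpar_ofN ?mulr0.
- rewrite mul_ofN_ucons (morph_sc _ _ TD) Tu mulrDr.
  have -> : ofN n * (tact v x * phi g) =
      sc n (fun w n0 => tact (w * v) x * phi (ofN n0 * g)).
    rewrite mulrA ofN_mul (morph_sc (f := *%R^~ (phi g))).
      by apply: eq_sc => w n0; rewrite tactM pm mulrA.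
    by move=> ? ?; rewrite mulrDl.
  have -> : ofN n * tsign e (ucons v (tpar e x phi g)) =
      sc n (fun w n0 => tsign e (ucons (w * v) (tpar e x phi (ofN n0 * g)))).
    rewrite mul_tsignr mul_ofN_ucons (morph_sc _ _ (tsignD e)).
    by apply: eq_sc => w n0; rewrite IH.
  by rewrite -scDF; apply: eq_sc => w n0; rewrite Tu.
Qed.

Lemma tder_ofN_mul e x n g : tder e x (ofN n * g) = ofN n * tder e x g.
Proof. exact: tpar_ofN_mul. Qed.

(** Induction on f: prefixes are handled by the recursion for D_x, and elements of N by
    [tder_ofN_mul]. *)
Lemma tder_mul e x p f g : homog p f ->
  tder e x (f * g) = tder e x f * g + tsign (e * p) (f * tder e x g).
Proof.
move=> fp; move: p f fp g.
pose P p f := forall g, tder e x (f * g) = tder e x f * g + tsign (e * p) (f * tder e x g).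
apply: (homog_ind (P := P)) => [p g|p y z _ _ IHy IHz g|n g|p u f _ IH g].
- by rewrite !(mul0r, additive_fun0 (tderD _ _)) tsign0 addr0.
- by rewrite mulrDl !tderD IHy IHz !mulrDl tsignD addrACA.
- by rewrite tder_ofN_mul tder_ofN mul0r add0r muln0.
- rewrite !(mul_ucons, tder_ucons, IH, texpand) /tsign mulnS oddD -mulrA.
  by case: (odd e); case: (odd (e * p)) => /=; zmodule.
Qed.

(** Both sides kill N. On (u, f), the product rule and [tder_act] make the mixed terms cancel,
    leaving u . (D_x y -+ D_y x) times f and the same identity behind the prefix u. *)
Lemma tder_comm q r x y f : homog q x -> homog r y ->
  tder q.+1 x (tder r.+1 y f) - tsign (q.+1 * r.+1) (tder r.+1 y (tder q.+1 x f)) =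
  tder (q + r) (tder q.+1 x y - tsign (q.+1 * r.+1) (tder r.+1 y x)) f.
Proof.
move=> xq yr.
apply: (cons_eq (f := fun f => tder q.+1 x (tder r.+1 y f) -
    tsign (q.+1 * r.+1) (tder r.+1 y (tder q.+1 x f))) (g := tder (q + r) _)).
- by move=> v w; rewrite !texpand opprD addrACA.
- exact: tderD.
- by move=> n; rewrite !(tder_ofN, additive_fun0 (tderD _ _)) tsign0 subrr.
- move=> u {}f IH; rewrite [in RHS]tder_ucons -IH !tder_ucons !tderD.
  rewrite (tder_mul _ _ _ (homog_tact u yr)) (tder_mul _ _ _ (homog_tact u xq)) !tder_act.
  rewrite !(tder_ucons, texpand) /tsign /= !(oddM, oddD) /=.
  case: (odd q); case: (odd r) => /=; zmodule.
Qed.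

Lemma tsign_odd (e e' : nat) x : odd e = odd e' -> tsign e x = tsign e' x.
Proof. by rewrite /tsign => ->. Qed.

Lemma tder_odd e e' x f : odd e = odd e' -> tder e x f = tder e' x f.
Proof.
move=> ee'; apply: (cons_eq (tderD e x) (tderD e' x)) => [n|u {}f IH].
  by rewrite !tder_ofN.
by rewrite !tder_ucons IH (tsign_odd _ ee').
Qed.

Lemma tder_SS e x f : tder e.+2 x f = tder e x f.
Proof. by apply: tder_odd; rewrite /= negbK. Qed.

(** The cobar differential on degree p ([tin_cobar_d]). The index 3 is 2 + 1 for mu of degree 2;
    only the parity of p enters. *)
Definition tdiff p f : tot := E * f - tsign p (f * E) - tder 3 mu f.

Lemma tdiffD p : additive_fun (tdiff p).
Proof. by move=> f g; rewrite /tdiff !texpand; zmodule. Qed.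
Lemma tdiff0 p : tdiff p 0 = 0. Proof. exact: additive_fun0 (tdiffD p). Qed.
Lemma tder_mu e x : tder e x mu = x * E + tsign e (E * x).
Proof.
by rewrite tmuE (tder_mul _ _ _ (homog_tunit N)) !tder_tunit muln1.
Qed.

Lemma tdiff_mul p q f g : homog p f ->
  tdiff (p + q) (f * g) = tdiff p f * g + tsign p (f * tdiff q g).
Proof.
move=> fp; rewrite /tdiff (tder_mul _ _ _ fp) !(texpand, mulrA) /tsign !oddM oddD /=.
by case: (odd p); case: (odd q) => /=; rewrite ?mulrA; zmodule.
Qed.

(** The bracket for x of degree p and y of degree q ([tin_bracket]). *)
Definition tbr p q x y : tot := tsign (p.+1 * q.+1) (tder q.+1 y x) - tder p.+1 x y.

Lemma tbrE p q x y : tbr p q x y = tsign (p.+1 * q.+1) (tder q.+1 y x) - tder p.+1 x y.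
Proof. by []. Qed.

Lemma tbr_odd p p' q q' x y : odd p = odd p' -> odd q = odd q' ->
  tbr p q x y = tbr p' q' x y.
Proof.
move=> pp qq; rewrite /tbr (@tder_odd q.+1 q'.+1) /= ?qq // (@tder_odd p.+1 p'.+1) /= ?pp //.
by congr (_ - _); apply: tsign_odd; rewrite !oddM /= pp qq.
Qed.

Lemma tbrDl p q y : additive_fun (fun x => tbr p q x y).
Proof. by move=> x x'; rewrite /tbr !texpand; zmodule. Qed.
Lemma tbrDr p q x : additive_fun (tbr p q x).
Proof. by move=> y y'; rewrite /tbr !texpand; zmodule. Qed.

Lemma tbrBl p q x x' y : tbr p q (x - x') y = tbr p q x y - tbr p q x' y.
Proof. by rewrite /tbr !texpand; zmodule. Qed.
Lemma tbrBr p q x y y' : tbr p q x (y - y') = tbr p q x y - tbr p q x y'.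
Proof. by rewrite /tbr !texpand; zmodule. Qed.

Lemma homog_tbr p q x y : homog p x -> homog q y -> homog (p + q).-1 (tbr p q x y).
Proof.
move=> xp yq; apply: homogD.
  apply: homog_tsign; case: p xp => [xp|p xp]; first by rewrite tder0 //; apply: homog0.
  exact: homog_tder.
apply: homogN; case: q yq => [yq|q yq]; first by rewrite tder0 //; apply: homog0.
by rewrite addnS addnC; apply: homog_tder.
Qed.

Lemma tbr00 x y : homog 0 x -> homog 0 y -> tbr 0 0 x y = 0.
Proof. by move=> x0 y0; rewrite /tbr !tder0 // tsign0 subr0. Qed.

Lemma tbrC p q x y : tbr p q x y = - tsign (p.+1 * q.+1) (tbr q p y x).
Proof.
rewrite /tbr !texpand /tsign !oddM /=.
by case: (odd p); case: (odd q) => /=; zmodule.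
Qed.

Lemma tder_tbr p q x y f : homog p x -> homog q y ->
  tder (p + q) (tbr p q x y) f =
  tsign (p.+1 * q.+1) (tder q.+1 y (tder p.+1 x f)) - tder p.+1 x (tder q.+1 y f).
Proof.
move=> xp yq; have := tder_comm f xp yq; rewrite /tbr.
rewrite !texpand => /(congr1 -%R); rewrite opprB => ->; zmodule.
Qed.

(** By [tder_tbr] every term becomes a composite of two derivations D, and these cancel. An inner
    bracket of degree q + r - 1 is given the index (q + r).+1, which has the same parity and avoids
    truncated subtraction. *)
Lemma tbr_jacobi p q r x y z : homog p x -> homog q y -> homog r z ->
  tbr p (q + r).+1 x (tbr q r y z) =
  tbr (p + q).+1 r (tbr p q x y) z + tsign (p.+1 * q.+1) (tbr q (p + r).+1 y (tbr p r x z)).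
Proof.
move=> xp yq zr; rewrite [LHS]tbrE [X in _ = X + _]tbrE [X in _ + tsign _ X]tbrE.
rewrite !tder_SS !tder_tbr // /tbr.
rewrite !texpand /tsign !oddM /= !oddD /=.
by case: (odd p); case: (odd q); case: (odd r) => /=; zmodule.
Qed.

Lemma tdiffE p x : tdiff p x = tbr 2 p mu x.
Proof.
rewrite /tbr tder_mu /tdiff !texpand /tsign oddM /=.
by case: (odd p) => /=; zmodule.
Qed.

(** The Jacobi identity with mu as first entry. *)
Lemma tdiff_tbr p q x y : homog p x -> homog q y ->
  tdiff (p + q).+1 (tbr p q x y) =
  tbr p.+1 q (tdiff p x) y + tsign p.+1 (tbr p q.+1 x (tdiff q y)).
Proof.
move=> xp yq; rewrite !tdiffE tbr_jacobi //; last exact: homog_tmu.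
congr (_ + _); first by apply: tbr_odd; rewrite //= !negbK.
rewrite (@tsign_odd (3 * p.+1) p.+1) ?oddM //; congr tsign.
by apply: tbr_odd; rewrite //= !negbK.
Qed.

(** The commutator of D_x and D_mu is a derivation D_z, and D_x E = x turns E f -+ f E into x f and
    f x. When x and f are cocycles only these two products survive, so D_x f bounds their graded
    commutator. *)
Lemma tdiff_tder p q x f : homog q x -> homog p f ->
  tdiff (p + q).+1 (tder q.+1 x f) =
  tsign q.+1 (tder q.+1 x (tdiff p f)) - tsign q.+1 (x * f) +
  tsign (q.+1 + p + q.+1 * p) (f * x) + tder q (tdiff q x) f.
Proof.
move=> xq fp; have C := tder_comm f xq (homog_tmu N).
have {C}C : tder 3 mu (tder q.+1 x f) = tsign q.+1 (tder q.+1 x (tder 3 mu f)) -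
    tsign q.+1 (tder q (tder q.+1 x mu - tsign q.+1 (tder 3 mu x)) f).
  have oq : odd (q.+1 * 3) = odd q.+1 by rewrite oddM andbT.
  move: C; rewrite !(tsign_odd _ oq) (@tder_odd (q + 2) q) ?oddD ?addbF // => <-.
  by rewrite /tsign; case: odd; zmodule.
rewrite /tdiff C tder_mu !texpand (tder_mul _ _ _ (homog_tunit N)) (tder_mul _ _ _ fp).
rewrite !tder_tunit !texpand muln1 /tsign !(oddM, oddD) /= ?(oddM, oddD) /=.
by case: (odd p); case: (odd q) => /=; zmodule.
Qed.

(* A homotopy for the Leibniz rule: up to sign the brace f{x, y}, x and y     *)
(* of degrees q and r.                                                        *)
Definition tbrace q r x y : tot -> tot := tpar (q + r) x (tder r.+1 y).

Section Brace.
Variables (q r : nat) (x y : tot).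
Hypotheses (xq : homog q x) (yr : homog r y).
Local Notation b := (tbrace q r x y).

Lemma tbraceD : additive_fun b.
Proof. by apply: tparD; [apply: tderD|apply: tderZ]. Qed.
Lemma tbraceN f : b (- f) = - b f.
Proof.
by apply: (@addrI _ (b f)); rewrite -tbraceD !subrr; apply: additive_fun0 tbraceD.
Qed.
Lemma tbrace_tsign e f : b (tsign e f) = tsign e (b f).
Proof. by rewrite /tsign; case: odd; rewrite ?tbraceN. Qed.
Lemma tbrace_ofN n : b (ofN n) = 0.
Proof. by apply: tpar_ofN; [apply: tderD|apply: tderZ]. Qed.
Lemma tbrace_ucons u f :
  b (ucons u f) = tact u x * tder r.+1 y f + tsign (q + r) (ucons u (b f)).
Proof. by apply: tpar_ucons; [apply: tderD|apply: tderZ]. Qed.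

(** The middle term accounts for x being inserted in f and y in g; in the outer terms both go into
    the same factor. *)
Lemma tbrace_mul p f g : homog p f ->
  b (f * g) = b f * g + tsign (r.+1 * p.+1) (tder q.+1 x f * tder r.+1 y g) +
              tsign ((q + r) * p) (f * b g).
Proof.
move=> fp; move: p f fp g.
pose P p f := forall g, b (f * g) = b f * g +
  tsign (r.+1 * p.+1) (tder q.+1 x f * tder r.+1 y g) + tsign ((q + r) * p) (f * b g).
apply: (homog_ind (P := P)) => [p g|p f f' _ _ IHf IHf' g|n g|p u f fp IH g].
- by rewrite !(mul0r, additive_fun0 tbraceD, additive_fun0 (tderD _ _)) !tsign0 !addr0.
- by rewrite !(texpand, tbraceD, IHf, IHf'); zmodule.
- rewrite tbrace_ofN tder_ofN !mul0r tsign0 !add0r muln0.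
  by apply: tpar_ofN_mul; [apply: tderD|apply: tderZ|apply: tder_ofN_mul].
- rewrite !(mul_ucons, tbrace_ucons, IH, tder_ucons, tder_mul _ _ _ fp, texpand).
  rewrite -!mulrA /tsign !(oddM, oddD) /=.
  by case: (odd p); case: (odd q); case: (odd r) => /=; zmodule.
Qed.

(** A brace fills two slots, so it lowers the degree by two before adding q + r, and kills degrees 0
    and 1. *)
Lemma homog_tbrace p f : homog p f ->
  if p is p'.+2 then homog (p' + q + r) (b f) else b f = 0.
Proof.
move: p f; apply: (homog_ind (P := fun p f =>
  if p is p'.+2 then homog (p' + q + r) (b f) else b f = 0)).
- by case=> [|[|p]]; rewrite (additive_fun0 tbraceD) //; apply: homog0.
- case=> [|[|p]] f g _ _ fb gb; rewrite tbraceD; try by rewrite fb gb addr0.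
  exact: homogD.
- exact: tbrace_ofN.
- case=> [|p] u f fp fb; rewrite tbrace_ucons.
    by rewrite fb tder0 // mulr0 (additive_fun0 (uconsDr _)) tsign0 addr0.
  apply: homogD.
    rewrite [(p + q)%N]addnC -addnA; apply: homog_mul; first exact: homog_tact.
    exact: homog_tder.
  apply: homog_tsign; case: p fp fb => [_ ->|p _ fb]; last exact: homog_ucons.
  by rewrite (additive_fun0 (uconsDr _)); apply: homog0.
Qed.

Lemma tbrace_act_mu u : b (tact u mu) = tact u (x * y).
Proof.
rewrite tact_tmu tact_mul (morph_sw _ _ _ tbraceD); apply: eq_sw => u1 u2.
rewrite !tbrace_ucons tder_ucons tbrace_ofN tder_ofN.
by rewrite !(additive_fun0 (uconsDr _), tsign0, mulr0, addr0, mulr1).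
Qed.

Hypotheses (dx : tdiff q x = 0) (dy : tdiff r y = 0).

(** The defect in commuting b with D_mu is D_(x y): the two slots of u . mu take x and y, giving u .
    (x y) by [tbrace_act_mu]. The other cross terms cancel because x and y are cocycles. *)
Lemma tbrace_mu f :
  tder 3 mu (b f) = tsign (q + r) (b (tder 3 mu f) - tder (q + r).+1 (x * y) f).
Proof.
have dxE : tder 3 mu x = E * x - tsign q (x * E).
  by apply/esym/eqP; rewrite -subr_eq0; apply/eqP.
have dyE : tder 3 mu y = E * y - tsign r (y * E).
  by apply/esym/eqP; rewrite -subr_eq0; apply/eqP.
(* [tder_comm] gives D_z with z = D_mu y -+ D_y mu, which vanishes for the cocycle y. *)
have C g : tder 3 mu (tder r.+1 y g) = tsign r.+1 (tder r.+1 y (tder 3 mu g)).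
  apply/eqP; rewrite -subr_eq0; apply/eqP.
  have := tder_comm g (homog_tmu N) yr; rewrite tder_mu dyE.
  have or : odd (3 * r.+1) = odd r.+1 by rewrite oddM.
  rewrite !(tsign_odd _ or) => ->; rewrite !texpand /tsign /=.
  by case: (odd r) => /=; zmodule.
apply: (cons_eq (f := fun f => tder 3 mu (b f)) (g := fun f =>
  tsign (q + r) (b (tder 3 mu f) - tder (q + r).+1 (x * y) f))) => [g h|g h|n|u {}f IH].
- by rewrite tbraceD tderD.
- by rewrite !(texpand, tbraceD); zmodule.
- by rewrite !(tbrace_ofN, tder_ofN, additive_fun0 (tderD _ _), additive_fun0 tbraceD) subrr tsign0.
- rewrite !(tbrace_ucons, tder_ucons, tbraceD, tbrace_tsign, IH, texpand).
  rewrite (tbrace_mul _ (homog_tact u (homog_tmu N))) tbrace_act_mu !tder_act.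
  rewrite (tder_mul _ _ _ (homog_tact u xq)) !tder_act C dxE tder_mu.
  rewrite !(tbrace_ucons, tder_ucons, texpand) -?mulrA /tsign ?(oddM, oddD) /= ?(oddM, oddD) /=.
  by case: (odd q); case: (odd r) => /=; zmodule.
Qed.

(** For cocycles, D_(x y) f is thus x (D_y f) -+ (D_x f) y up to a coboundary, the half of the
    Leibniz rule that fails on cochains. *)
Lemma tdiff_tbrace p f : homog p f -> tdiff p f = 0 ->
  tdiff (p + q + r) (b f) = tsign (q + r) (tder (q + r).+1 (x * y) f -
    x * tder r.+1 y f + tsign (p + r.+1 * p.+1) (tder q.+1 x f * y)).
Proof.
move=> fp df; rewrite {1}/tdiff tbrace_mu.
have -> : tder 3 mu f = E * f - tsign p (f * E).
  by apply/esym/eqP; rewrite -subr_eq0; apply/eqP.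
rewrite !(texpand, tbraceD, tbraceN, tbrace_tsign) (tbrace_mul _ (homog_tunit N)).
rewrite (tbrace_mul _ fp) !tder_tunit.
have -> : b E = 0.
  by rewrite tbrace_ucons tder_ofN tbrace_ofN !(additive_fun0 (uconsDr _), tsign0, mulr0, addr0).
rewrite !(mul0r, mulr0, tsign0) !texpand /tsign !(oddM, oddD) /= ?(oddM, oddD) /=.
by case: (odd p); case: (odd q); case: (odd r) => /=; zmodule.
Qed.
End Brace.
End BraidedCommutative.

(** * The operations of the cobar complex *)

Section CochainOperations.
Variables (k : comPzRingType) (A U : kalgType k) (B : left_bialgebroid A U).
Variable N : bc_yd_algebra B.
Local Notation tot := (tot N).

Lemma scaler_tsign (R : pzRingType) (V : lmodType R) (e : nat) (v : V) :
  (-1) ^+ e *: v = if odd e then - v else v.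
Proof. by rewrite -signr_odd scaler_sign. Qed.

Lemma tin_tsumU p (c : Cco N p.+1) : tin c = tsumU c (fun u d => ucons u (tin d)).
Proof.
rewrite {1}[c]tensE (morph_tsumU (f := @tin _ _ _ B N p.+1)); last exact: tinD.
by apply: eq_tsumU => u d; rewrite ucons_tin.
Qed.

(** Delta(u), viewed as the cochain (u_(1), u_(2), 1_N), is u . mu. *)
Lemma tin_comul_id p u (c : Cco N p) :
  @tin _ _ _ B N p.+2 (comul_id B _ (uot B u c)) = tact u (tmu N) * tin c.
Proof.
rewrite comul_id_ot (morph_tsumU (f := @tin _ _ _ B N p.+2)); last exact: tinD.
rewrite tact_tmu (morph_sw B (f := *%R^~ (tin c))); last by move=> ? ?; rewrite mulrDl.
by apply: eq_tsumU => u1 u2; rewrite !mul_ucons mul1r -!ucons_tin.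
Qed.

Lemma cofaceS_uot p j u (d : Cco N p) :
  cofaceS N p.+1 j.+1 (uot B u d) = uot B u (cofaceS N p j d).
Proof. exact: (@tmap_ot _ _ (bU B) _ _ (cofaceS N p j) u d). Qed.

(** The last coface gives c E. On (u, d) the first coproduct coface is (u . mu) d and the others act
    behind u with opposite sign, which is the recursion that defines D_mu. *)
Lemma sum_cofaceS p (c : Cco N p) :
  \sum_(j < p.+1) tsign j.+1 (tin (cofaceS N p j c)) =
  - tsign p (tin c * tunit N) - tder 3 (tmu N) (tin c).
Proof.
have sD m j : additive_fun (fun c : Cco N m => tsign j.+1 (tin (cofaceS N m j c))).
  by move=> d d'; rewrite raddfD tinD tsignD.
elim: p c => [|p IH] c.
  rewrite big_ord_recl big_ord0 addr0 tder_ofN subr0 /tsign /=; congr (- _).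
  rewrite [LHS]tin_tsumU -/(ofN c) mul_ofN_ucons; apply: eq_sc => u m.
  by rewrite !mulr1.
pose f (c : Cco N p.+1) : tot := \sum_(j < p.+2) tsign j.+1 (tin (cofaceS N p.+1 j c)).
pose g (c : Cco N p.+1) : tot := - tsign p.+1 (tin c * tunit N) - tder 3 (tmu N) (tin c).
have fD : additive_fun f.
  by move=> d d'; rewrite /f -big_split; apply: eq_bigr => j _; apply: sD.
have gD : additive_fun g by move=> d d'; rewrite /g tinD !texpand; zmodule.
suff fg : forall c, f c = g c by apply: fg.
elim/Utens_ind=> [|d d' IHd IHd'|u d]; first by rewrite !additive_fun0.
  by rewrite fD gD IHd IHd'.
rewrite /f big_ord_recl [cofaceS _ _ _ _]/(comul_id B _ _) tin_comul_id.
have -> : \sum_(i < p.+1) tsign (lift ord0 i).+1 (tin (cofaceS N p.+1 (lift ord0 i) (uot B u d))) =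
    - ucons u (\sum_(j < p.+1) tsign j.+1 (tin (cofaceS N p j d))).
  rewrite (big_morph _ (uconsDr u) (additive_fun0 (uconsDr u))) -sumrN.
  apply: eq_bigr => j _.
  rewrite (cofaceS_uot j u d : cofaceS N p.+1 (lift ord0 j) (uot B u d) = _) -ucons_tin.
  by rewrite ucons_tsign /tsign /=; case: odd; rewrite /= ?opprK.
rewrite IH /g -ucons_tin tder_ucons mul_ucons !texpand /tsign /=.
by case: (odd p) => /=; zmodule.
Qed.

Lemma tin_cobar_d p (c : Cco N p) : tin (cobar_d c : Cco N p.+1) = tdiff p (tin c).
Proof.
rewrite /cobar_d big_ord_recl expr0 scale1r /tdiff.
transitivity (tin (uot B 1 c : Cco N p.+1) + \sum_(j < p.+1) tsign j.+1 (tin (cofaceS N p j c))).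
  rewrite [LHS](@tinD _ _ _ B N p.+1); congr (_ + _).
  rewrite [LHS](raddf_sum (@tin _ _ _ B N p.+1)); apply: eq_bigr => j _.
  by rewrite scaler_tsign /tsign; case: odd; rewrite //= tinN.
by rewrite sum_cofaceS -ucons_tin ucons1E; zmodule.
Qed.

(** On (u, x), insertion at the first place is (u . d) x by [ins_cup]; later insertions act behind u
    with the sign of passing it. This is the recursion of [tder_ucons]. *)
Lemma sum_circ r q (c : Cco N r.+1) (d : Cco N q) :
  \sum_(i < r.+1) tsign (q.+1 * i) (tin (circ i c d)) = tder q.+1 (tin d) (tin c).
Proof.
elim: r c => [|r IH] c.
  rewrite big_ord_recl big_ord0 addr0 muln0 [RHS](congr1 _ (tin_tsumU c)).
  rewrite (morph_tsumU _ _ (tderD _ _)) /=.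
  rewrite [tin _]dinj_degcast; last by rewrite addnC.
  rewrite -[dinj _]/(tin _) (morph_tsumU (f := @tin _ _ _ B N (q + 0))); last exact: tinD.
  apply: eq_tsumU => u e; rewrite ins_cup -mul_tin -tact_tin tder_ucons.
  rewrite (tder_ofN q.+1 (tin d) e : tder q.+1 (tin d) (@tin _ _ _ B N 0 e) = 0).
  by rewrite (additive_fun0 (uconsDr _)) tsign0 addr0.
rewrite big_ord_recl muln0 [RHS](congr1 _ (tin_tsumU c)) (morph_tsumU _ _ (tderD _ _)) /=.
rewrite [tin _]dinj_degcast; last by rewrite addnC.
rewrite -[dinj _]/(tin _) (morph_tsumU (f := @tin _ _ _ B N (q + r.+1))); last exact: tinD.
have -> : \sum_(i < r.+1) tsign (q.+1 * (lift ord0 i)) (@tin _ _ _ B N (r.+1 + q)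
      (tsumU c (fun u (x : Cco N r.+1) => uot B u (circ i x d) : Cco N (r.+1 + q)))) =
    tsumU c (fun u (x : Cco N r.+1) => tsign q.+1 (ucons u (tder q.+1 (tin d) (tin x)))).
  transitivity (\sum_(i < r.+1) tsumU c (fun u (x : Cco N r.+1) =>
      tsign q.+1 (ucons u (tsign (q.+1 * i) (tin (circ i x d)))))).
    apply: eq_bigr => i _; rewrite (morph_tsumU (f := @tin _ _ _ B N (r.+1 + q))); last exact: tinD.
    rewrite (morph_tsumU _ _ (tsignD _)); apply: eq_tsumU => u x.
    rewrite -[tin _](@ucons_tin _ _ _ B N u (r + q)) ucons_tsign /tsign mulnS oddD.
    by case: (odd q.+1); case: (odd (q.+1 * i)) => /=; rewrite ?opprK.
  rewrite [LHS]exchange_big; apply: eq_bigr => z _; rewrite -IH.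
  rewrite (big_morph _ (uconsDr _) (additive_fun0 (uconsDr _))).
  by rewrite (big_morph _ (tsignD _) (tsign0 N _)).
rewrite -tsumUDF; apply: eq_tsumU => u x.
by rewrite ins_cup -mul_tin -tact_tin tder_ucons.
Qed.

Lemma tin_scale_sign p e (c : Cco N p) : tin ((-1) ^+ e *: c) = tsign e (tin c).
Proof. by rewrite scaler_tsign /tsign; case: odd; rewrite ?tinN. Qed.

Lemma tin_circ_bar p q (c : Cco N p) (d : Cco N q) :
  tin (circ_bar c d) = tsign (p.+1 * q.+1) (tder q.+1 (tin d) (tin c)).
Proof.
case: p c => [|p] c; first by rewrite [tder _ _ _]tder_ofN tsign0 raddf0.
rewrite /= (tin_scale_sign (p := p + q)); congr tsign; rewrite raddf_sum -sum_circ.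
by apply: eq_bigr => i _; apply: (tin_scale_sign (p := p + q)).
Qed.

Lemma tin_bracket p q (c : Cco N p) (d : Cco N q) :
  tin (bracket c d) = tbr p q (tin c) (tin d).
Proof.
rewrite /bracket tinD tinN tin_scale_sign tin_circ_bar /tbr; congr (_ - _).
rewrite [tin (degcast _ _ _)]dinj_degcast; last by rewrite addnC.
rewrite -[dinj _]/(tin _) tin_circ_bar mulnC.
by rewrite /tsign; case: odd; rewrite ?opprK.
Qed.
End CochainOperations.

(** * Cohomology *)

Section CohomologyClasses.
Variables (k : comPzRingType) (A U : kalgType k) (B : left_bialgebroid A U).
Variable N : bc_yd_algebra B.
Local Notation tot := (tot N).
Implicit Types (c : k).

Lemma src_kalgC c (u : U) : src B (kalg c) * u = u * src B (kalg c).
Proof.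
have -> : src B (kalg c) = kalg c :> U; last exact: kalgC.
rewrite /src /env; have -> : kalg c = (c *: (1 : kmod A)) :> A by rewrite kmodZ mulr1.
have -> : @ot _ _ (cbimod (kmod A)) (kmod A) (c *: (1 : kmod A)) 1 =
    c *: (@ot _ _ (cbimod (kmod A)) (kmod A) (1 : kmod A) 1) by apply: otZ.
rewrite linearZZ kmodZ (eta1 B : (B (env 1 1) : U) = 1).
exact: mulr1.
Qed.

(** The k-action on cochains. It commutes with products and derivations because s and t agree on k
    and take central values there. *)
Definition kscale c (w : tot) : tot := (kalg c : A) *: w.

Lemma kscaleD c : additive_fun (kscale c).
Proof. exact: scalerDr. Qed.

Lemma kscale_tact c u (w : tot) : tact u (kscale c w) = kscale c (tact u w).
Proof. by rewrite /kscale -!tact_src -!tactM src_kalgC. Qed.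

Lemma kscale_mulr c (w v : tot) : w * kscale c v = kscale c (w * v).
Proof. by rewrite /kscale -tact_tgt_mul -src_kalg tact_src scalemul. Qed.

Lemma kscale_mull c (w v : tot) : kscale c w * v = kscale c (w * v).
Proof. exact: scalemul. Qed.

Lemma kscale_ucons c u (w : tot) : ucons u (kscale c w) = kscale c (ucons u w).
Proof. by rewrite /kscale -(balUA (ucons_bal N)) -src_kalg ucons_src. Qed.

Lemma kscale_tsign c e (w : tot) : kscale c (tsign e w) = tsign e (kscale c w).
Proof. by rewrite /kscale tsignZ. Qed.

Lemma kscale_tderl c e (w f : tot) : tder e (kscale c w) f = kscale c (tder e w f).
Proof.
apply: (cons_eq (f := tder e (kscale c w)) (g := fun f => kscale c (tder e w f))).
- exact: tderD.
- by move=> g h; rewrite tderD kscaleD.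
- by move=> n; rewrite !tder_ofN (additive_fun0 (kscaleD c)).
- move=> u {}f IH; rewrite !tder_ucons IH kscale_tact kscale_mull kscaleD kscale_tsign.
  by rewrite kscale_ucons.
Qed.

Lemma kscale_tderr c e (w f : tot) : tder e w (kscale c f) = kscale c (tder e w f).
Proof. exact: tderZ. Qed.

Lemma kscaleB c (w v : tot) : kscale c (w - v) = kscale c w - kscale c v.
Proof. exact: scalerBr. Qed.

Lemma kscale_tbrl c p q (w v : tot) : tbr p q (kscale c w) v = kscale c (tbr p q w v).
Proof. by rewrite /tbr kscaleB kscale_tsign kscale_tderl kscale_tderr. Qed.

Lemma kscale_tbrr c p q (w v : tot) : tbr p q w (kscale c v) = kscale c (tbr p q w v).
Proof. by rewrite /tbr kscaleB kscale_tsign kscale_tderl kscale_tderr. Qed.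

Definition tdif (w : tot) : tot :=
  dlift (fun p (x : Cco N p) => tin (cobar_d x : Cco N p.+1)) w.

Lemma tdif_subproof p : additive_fun (fun x : Cco N p => tin (cobar_d x : Cco N p.+1)).
Proof. by move=> x y; rewrite !tin_cobar_d tinD tdiffD. Qed.

Lemma tdif_additive : additive_fun tdif.
Proof. exact: dliftD tdif_subproof. Qed.

Lemma tdif_tin p (x : Cco N p) : tdif (tin x) = tin (cobar_d x : Cco N p.+1).
Proof. exact: dlift_dinj tdif_subproof _ _. Qed.

Lemma tdifE p w : homog p w -> tdif w = tdiff p w.
Proof. by move=> [x ->]; rewrite tdif_tin tin_cobar_d. Qed.

Lemma tdif_compS p (w : tot) : dsval (tdif w) p.+1 = cobar_d (dsval w p : Cco N p).
Proof.
pose f (w : tot) := dsval (tdif w) p.+1; pose g (w : tot) : Cco N p.+1 := cobar_d (dsval w p).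
apply: (tot_eq (f := f) (g := g)) => [v z|v z|q x].
- by rewrite /f tdif_additive.
- exact: (raddfD (cobar_dL N p)).
- rewrite /f /g tdif_tin; have [e|qp] := eqVneq q p.
    by case: p / e {f g}; rewrite !dinjE.
  have e0 : dsval (tin x) p = 0 by apply: dinj_neq => e; rewrite e eqxx in qp.
  rewrite e0 [RHS](raddf0 (cobar_dL N p)); apply: dinj_neq => -[e].
  by rewrite e eqxx in qp.
Qed.

Lemma tdif_comp0 (w : tot) : dsval (tdif w) 0 = 0.
Proof.
apply: (tot_eq (f := fun w => dsval (tdif w) 0%N) (g := fun=> 0)) => [v z|v z|q x].
- by rewrite tdif_additive.
- by rewrite addr0.
- by rewrite tdif_tin; apply: dinj_neq.
Qed.

(** Here w may be inhomogeneous: its component one degree lower is already a primitive, and [tdif]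
    has no component in degree 0. *)
Lemma coboundaryP p (x : Cco N p) :
  coboundary (C := cobar N) (x : cobar N p) <-> exists w, tin x = tdif w.
Proof.
split.
  case: p x => [|p] x /=.
    by move=> ->; exists 0; rewrite raddf0 (additive_fun0 tdif_additive).
  by move=> [y ->]; exists (tin (y : Cco N p)); rewrite tdif_tin.
move=> [w e]; have xE : x = dsval (tdif w) p by rewrite -e dinjE.
case: p x e xE => [|p] x _ ->; first exact: tdif_comp0.
by exists (dsval w p); rewrite tdif_compS.
Qed.

Definition bdry (w : tot) := exists v, w = tdif v.

Lemma bdry0 : bdry 0.
Proof. by exists 0; rewrite (additive_fun0 tdif_additive). Qed.
Lemma bdryD w v : bdry w -> bdry v -> bdry (w + v).
Proof. by move=> [w' ->] [v' ->]; exists (w' + v'); rewrite tdif_additive. Qed.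
Lemma bdryN w : bdry w -> bdry (- w).
Proof.
move=> [w' ->]; exists (- w'); apply: (@addrI _ (tdif w')).
by rewrite -tdif_additive !subrr (additive_fun0 tdif_additive).
Qed.
Lemma bdry_tsign e w : bdry w -> bdry (tsign e w).
Proof. by rewrite /tsign; case: odd => // /bdryN. Qed.

Lemma tdiff_odd p q (w : tot) : odd p = odd q -> tdiff p w = tdiff q w.
Proof. by move=> pq; rewrite /tdiff (tsign_odd _ pq). Qed.

(** [tdiff] sees its degree only through its parity, so an index of the right parity still gives a
    coboundary. *)
Lemma bdry_tdiff p q w : homog p w -> w = 0 \/ odd p = odd q -> bdry (tdiff q w).
Proof.
move=> wp [->|pq]; first by rewrite tdiff0; apply: bdry0.
by exists w; rewrite (tdifE wp); apply/esym/tdiff_odd.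
Qed.

(** The cocycle w represents the class h. As a relation with w in [tot], it lets identities of
    classes be checked on representatives without degree casts. *)
Definition rep p (h : Hco N p) (w : tot) :=
  exists x : Cco N p, has_class (C := cobar N) (x : cobar N p) h /\ w = tin x.

Lemma rep_homog p (h : Hco N p) w : rep h w -> homog p w.
Proof. by move=> [x [_ ->]]; exists x. Qed.

Lemma rep_cycle p (h : Hco N p) w : rep h w -> tdiff p w = 0.
Proof.
move=> [x [[z [<- _]] ->]]; rewrite -tin_cobar_d.
have := kervalP z; rewrite unfold_in => /eqP e.
by rewrite [cobar_d _]e raddf0.
Qed.

Lemma rep_ex p (h : Hco N p) : exists w, rep h w.
Proof.
elim/quotmod_ind: h => z; exists (tin (val z : Cco N p)).
by exists (val z); split=> //; exists z.
Qed.

Lemma rep_of p w : homog p w -> tdiff p w = 0 -> exists h : Hco N p, rep h w.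
Proof.
move=> [x ->]; rewrite -tin_cobar_d => e.
have xk : (x : cobar N p) \in ker_pred (cc_d (cobar N) p).
  rewrite unfold_in; apply/eqP/(@dinj_inj _ (Cco N)).
  by rewrite [LHS]e raddf0.
exists (quotmod_pi _ (Kernel xk)); exists x; split=> //.
by exists (Kernel xk).
Qed.

Lemma rep_eq p (h l : Hco N p) w v : rep h w -> rep l v -> h = l <-> bdry (w - v).
Proof.
move=> [x [[z [zx ->]] ->]] [y [[t [ty ->]] ->]].
have -> : tin x - tin y = tin (x - y) by rewrite tinD tinN.
split=> [/quotmod_piP /asboolP|b]; last apply/quotmod_piP/asboolP.
  by rewrite [val _]/= zx ty => /coboundaryP.
by rewrite [val _]/= zx ty; apply/coboundaryP.
Qed.

Lemma rep_bdry p (h l : Hco N p) w v : rep h w -> rep l v -> bdry (w - v) -> h = l.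
Proof. by move=> hw lv /(rep_eq hw lv). Qed.

Lemma repE p (h l : Hco N p) w v : rep h w -> rep l v -> w = v -> h = l.
Proof. by move=> hw lv e; apply: (rep_bdry hw lv); rewrite e subrr; apply: bdry0. Qed.

Lemma repD p (h l : Hco N p) w v : rep h w -> rep l v -> rep (h + l) (w + v).
Proof.
move=> [x [[z [zx ->]] ->]] [y [[t [ty ->]] ->]]; exists (x + y).
rewrite tinD; split=> //; exists (z + t); split; last by rewrite -quotmod_piD.
by rewrite -zx -ty.
Qed.

Lemma repZ p c (h : Hco N p) w : rep h w -> rep (c *: h) (kscale c w).
Proof.
move=> [x [[z [zx ->]] ->]]; exists ((kalg c : A) *: x).
rewrite /kscale -(linearZZ (@tin _ _ _ B N p)); split=> //.
by exists (c *: z); split; [rewrite -zx | apply/esym/quotmod_piZ].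
Qed.

Lemma rep0 p : rep (0 : Hco N p) 0.
Proof.
have [w hw] := rep_ex (0 : Hco N p).
have := repD hw (repZ (-1) hw); rewrite scaler0 addr0 /kscale.
by rewrite rmorphN1 scaleN1r subrr.
Qed.

Lemma repN p (h : Hco N p) w : rep h w -> rep (- h) (- w).
Proof.
by move=> hw; have := repZ (-1) hw; rewrite scaleN1r /kscale rmorphN1 scaleN1r.
Qed.

Lemma rep_tsign p e (h : Hco N p) w : rep h w -> rep ((-1) ^+ e *: h) (tsign e w).
Proof. by rewrite scaler_tsign /tsign; case: odd => // /repN. Qed.

(** The second alternative covers the truncated degrees, where the cast is 0 and the representative
    vanishes. *)
Lemma rep_degcast p q (h : Hco N p) w : rep h w -> p = q \/ w = 0 ->
  rep (degcast (Hco N) q h) w.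
Proof.
move=> hw [e|w0].
  by case: q / e; rewrite degcast_id.
have -> : h = 0 by apply: (repE hw (rep0 p)).
rewrite (additive_fun0 (f := degcast (Hco N) q)) ?w0; first exact: rep0.
by move=> x y; rewrite -[x]scale1r degcast_linear !scale1r.
Qed.

Lemma rep_diff p (h : Hco N p) w w' : rep h w -> rep h w' ->
  w' = w \/ exists m v, [/\ m.+1 = p, homog m v & w' = w + tdiff m v].
Proof.
move=> hw hw'; have [x [[z [zx hz]] ->]] := hw; have [y [[t [ty ht]] ->]] := hw'.
have := hz; rewrite ht => /quotmod_piP /asboolP; rewrite [val _]/= ty zx.
case: p h hw hw' x z zx hz y t ty ht => [|p] h hw hw' x z zx hz y t ty ht /=.
  by move/eqP; rewrite subr_eq0 => /eqP ->; left.
move=> [v e]; right; exists p, (tin (v : Cco N p)); split=> //; first by exists v.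
have -> : tdiff p (tin (v : Cco N p)) = tin (y - x).
  by rewrite -tin_cobar_d; congr tin; apply/esym/e.
by rewrite -tinD addrC subrK.
Qed.
End CohomologyClasses.

(** * Products and brackets of cohomology classes *)

Section GerstenhaberCohomology.
Variables (k : comPzRingType) (A U : kalgType k) (B : left_bialgebroid A U).
Variable N : bc_yd_algebra B.
Local Notation tot := (tot N).

Lemma rep_inj p (h : Hco N p) w v : homog p v -> tdiff p v = 0 -> rep h w ->
  bdry (v - w) -> rep h v.
Proof.
move=> vp dv hw b; have [l lv] := rep_of vp dv.
by rewrite -(rep_bdry lv hw b).
Qed.

Lemma tdiff_mul0 p q (w v : tot) : homog p w -> tdiff p w = 0 -> tdiff q v = 0 ->
  tdiff (p + q) (w * v) = 0.
Proof. by move=> wp dw dv; rewrite (tdiff_mul q _ wp) dw dv mul0r mulr0 tsign0 addr0. Qed.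

Lemma tbr_deg0 p q (w v : tot) : homog p w -> homog q v -> (p + q = 0)%N -> tbr p q w v = 0.
Proof.
by move=> wp vq /eqP; rewrite addn_eq0 => /andP[/eqP p0 /eqP q0]; subst p q; apply: tbr00.
Qed.

(** The truncated degree of a bracket is wrong only for p = q = 0, and there the bracket is zero. *)
Lemma tbr_deg p q (w v : tot) : homog p w -> homog q v ->
  tbr p q w v = 0 \/ odd (p + q).-1 = odd (p + q).+1.
Proof.
move=> wp vq; case e : (p + q)%N => [|m]; last by right; rewrite /= negbK.
by left; apply: tbr_deg0.
Qed.

Lemma tdiff_tbr0 p q (w v : tot) : homog p w -> homog q v ->
  tdiff p w = 0 -> tdiff q v = 0 -> tdiff (p + q).-1 (tbr p q w v) = 0.
Proof.
move=> wp vq dw dv; case: (tbr_deg wp vq) => [->|e]; first exact: tdiff0.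
rewrite (tdiff_odd _ e) (tdiff_tbr wp vq) dw dv.
by rewrite (additive_fun0 (tbrDl _ _ _)) (additive_fun0 (tbrDr _ _ _)) tsign0 addr0.
Qed.

Lemma bdry_tbr p q (w v : tot) : homog p w -> homog q v ->
  bdry (tdiff (p + q).+1 (tbr p q w v)).
Proof.
by move=> wp vq; apply: bdry_tdiff (homog_tbr wp vq) (tbr_deg wp vq).
Qed.

(** One class serves all representatives: changing one factor at a time by a coboundary changes the
    product by a coboundary, since d is a derivation. *)
Lemma hmul_ex p q (h : Hco N p) (l : Hco N q) :
  exists m : Hco N (p + q), forall w v, rep h w -> rep l v -> rep m (w * v).
Proof.
have [w0 hw0] := rep_ex h; have [v0 lv0] := rep_ex l.
have mC w v : rep h w -> rep l v -> tdiff (p + q) (w * v) = 0.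
  by move=> hw lv; apply: tdiff_mul0; [apply: rep_homog hw|apply: rep_cycle hw|apply: rep_cycle lv].
have mh w v : rep h w -> rep l v -> homog (p + q) (w * v).
  by move=> /rep_homog hw /rep_homog lv; apply: homog_mul.
have [m mw] := rep_of (mh _ _ hw0 lv0) (mC _ _ hw0 lv0).
exists m => w v hw lv; apply: (rep_inj (mh _ _ hw lv) (mC _ _ hw lv) mw).
have -> : w * v - w0 * v0 = (w - w0) * v + w0 * (v - v0) by rewrite mulrBl mulrBr addrA subrK.
apply: bdryD.
- case: (rep_diff hw0 hw) => [->|[i [u [ip ui ->]]]]; first by rewrite subrr mul0r; apply: bdry0.
  rewrite [_ - _]addrC addKr; have := tdiff_mul q v ui.
  rewrite (rep_cycle lv) mulr0 tsign0 addr0 => <-.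
  by apply: bdry_tdiff (homog_mul ui (rep_homog lv)) _; right.
- case: (rep_diff lv0 lv) => [->|[i [u [ip ui ->]]]]; first by rewrite subrr mulr0; apply: bdry0.
  rewrite [_ - _]addrC addKr; have := tdiff_mul i u (rep_homog hw0).
  rewrite (rep_cycle hw0) mul0r add0r => /(congr1 (tsign p)) e.
  have -> : w0 * tdiff i u = tsign p (tdiff (p + i) (w0 * u)).
    by rewrite e /tsign; case: odd; rewrite ?opprK.
  apply: bdry_tsign; apply: bdry_tdiff (homog_mul (rep_homog hw0) ui) _; by right.
Qed.

Lemma hbr_ex p q (h : Hco N p) (l : Hco N q) :
  exists m : Hco N (p + q).-1, forall w v, rep h w -> rep l v -> rep m (tbr p q w v).
Proof.
have [w0 hw0] := rep_ex h; have [v0 lv0] := rep_ex l.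
have mC w v : rep h w -> rep l v -> tdiff (p + q).-1 (tbr p q w v) = 0.
  move=> hw lv; apply: (tdiff_tbr0 (rep_homog hw) (rep_homog lv)); first exact: rep_cycle hw.
  exact: rep_cycle lv.
have mh w v : rep h w -> rep l v -> homog (p + q).-1 (tbr p q w v).
  by move=> /rep_homog hw /rep_homog lv; apply: homog_tbr.
have [m mw] := rep_of (mh _ _ hw0 lv0) (mC _ _ hw0 lv0).
exists m => w v hw lv; apply: (rep_inj (mh _ _ hw lv) (mC _ _ hw lv) mw).
have -> : tbr p q w v - tbr p q w0 v0 = tbr p q (w - w0) v + tbr p q w0 (v - v0).
  by rewrite tbrBl tbrBr addrA subrK.
apply: bdryD.
- case: (rep_diff hw0 hw) => [->|[i [u [ip ui ->]]]].
    by rewrite subrr (additive_fun0 (tbrDl _ _ _)); apply: bdry0.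
  rewrite [_ - _]addrC addKr; have := tdiff_tbr ui (rep_homog lv).
  rewrite (rep_cycle lv) (additive_fun0 (tbrDr _ _ _)) tsign0 addr0 ip => <-.
  exact: bdry_tbr ui (rep_homog lv).
- case: (rep_diff lv0 lv) => [->|[i [u [ip ui ->]]]].
    by rewrite subrr (additive_fun0 (tbrDr _ _ _)); apply: bdry0.
  rewrite [_ - _]addrC addKr; have := tdiff_tbr (rep_homog hw0) ui.
  rewrite (rep_cycle hw0) (additive_fun0 (tbrDl _ _ _)) add0r ip => /(congr1 (tsign p.+1)) e.
  have -> : tbr p q w0 (tdiff i u) = tsign p.+1 (tdiff (p + i).+1 (tbr p i w0 u)).
    by rewrite e /tsign; case: odd; rewrite ?opprK.
  exact: bdry_tsign (bdry_tbr (rep_homog hw0) ui).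
Qed.

Definition hmul p q (h : Hco N p) (l : Hco N q) : Hco N (p + q) := sval (cid (hmul_ex h l)).
Definition hbr p q (h : Hco N p) (l : Hco N q) : Hco N (p + q).-1 := sval (cid (hbr_ex h l)).

Lemma rep_mul p q (h : Hco N p) (l : Hco N q) w v :
  rep h w -> rep l v -> rep (hmul h l) (w * v).
Proof. exact: (svalP (cid (hmul_ex h l))). Qed.

Lemma rep_br p q (h : Hco N p) (l : Hco N q) w v :
  rep h w -> rep l v -> rep (hbr h l) (tbr p q w v).
Proof. exact: (svalP (cid (hbr_ex h l))). Qed.

Lemma hone_ex : exists h : Hco N 0, rep h 1.
Proof.
apply: rep_of; first exact: homog1.
by rewrite /tdiff mulr1 mul1r /tsign subrr tder0 ?subrr //; apply: homog1.
Qed.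
Definition hone : Hco N 0 := sval (cid hone_ex).
Lemma rep_one : rep hone 1. Proof. exact: (svalP (cid hone_ex)). Qed.

(** A primitive is D_v w up to sign. In degree p = 0 it vanishes, so there the two products agree on
    the nose. *)
Lemma bdry_comm p q (w v : tot) : homog p w -> homog q v ->
  tdiff p w = 0 -> tdiff q v = 0 -> bdry (w * v - tsign (p * q) (v * w)).
Proof.
move=> wp vq dw dv; have e := tdiff_tder vq wp.
have -> : w * v - tsign (p * q) (v * w) =
    tsign (q.+1 + p + q.+1 * p) (tdiff (p + q).+1 (tder q.+1 v w)).
  rewrite e dw dv (additive_fun0 (tderD _ _)) (additive_fun0 (tderDl _ _)) tsign0 add0r addr0.
  rewrite /tsign !(oddM, oddD) /= ?(oddM, oddD) /=.
  by case: (odd p); case: (odd q) => /=; zmodule.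
apply: bdry_tsign; case: p wp {dw e} => [|p] wp.
  by rewrite tder0 // tdiff0; apply: bdry0.
apply: bdry_tdiff (homog_tder _ vq wp) _; right; by rewrite /= negbK.
Qed.

(** The terms with D_c fit exactly by [tder_mul]; the rest has the brace of c with x and y as
    primitive, up to sign. *)
Lemma bdry_leibniz p q r (c x y : tot) : homog p c -> homog q x -> homog r y ->
  tdiff p c = 0 -> tdiff q x = 0 -> tdiff r y = 0 ->
  bdry (tbr p (q + r) c (x * y) - (tbr p q c x * y + tsign (p.+1 * q) (x * tbr p r c y))).
Proof.
move=> cp xq yr dc dx dy; have e := tdiff_tbrace xq yr dx dy cp dc.
have -> : tbr p (q + r) c (x * y) - (tbr p q c x * y + tsign (p.+1 * q) (x * tbr p r c y)) =
    tsign (p.+1 * (q + r).+1 + (q + r)) (tdiff (p + q + r) (tbrace q r x y c)).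
  rewrite e /tbr (tder_mul _ _ _ xq) !texpand -?mulrA.
  rewrite /tsign !(oddM, oddD) /= ?(oddM, oddD) /=.
  by case: (odd p); case: (odd q); case: (odd r) => /=; zmodule.
apply: bdry_tsign; case: p cp {dc e} (homog_tbrace xq yr cp) => [|[|p]] cp b.
- by rewrite b tdiff0; apply: bdry0.
- by rewrite b tdiff0; apply: bdry0.
- apply: bdry_tdiff b _; right; by rewrite !oddD /= negbK.
Qed.

Lemma hmul_linl p q (l : Hco N q) : linear (fun h : Hco N p => hmul h l).
Proof.
move=> c h h'; have [w hw] := rep_ex h; have [w' hw'] := rep_ex h'; have [v lv] := rep_ex l.
apply: (repE (rep_mul (repD (repZ c hw) hw') lv) (repD (repZ c (rep_mul hw lv)) (rep_mul hw' lv))).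
by rewrite mulrDl kscale_mull.
Qed.

Lemma hmul_linr p q (h : Hco N p) : linear (hmul h : Hco N q -> _).
Proof.
move=> c l l'; have [w hw] := rep_ex h; have [v lv] := rep_ex l; have [v' lv'] := rep_ex l'.
apply: (repE (rep_mul hw (repD (repZ c lv) lv')) (repD (repZ c (rep_mul hw lv)) (rep_mul hw lv'))).
by rewrite mulrDr kscale_mulr.
Qed.

Lemma hbr_linl p q (l : Hco N q) : linear (fun h : Hco N p => hbr h l).
Proof.
move=> c h h'; have [w hw] := rep_ex h; have [w' hw'] := rep_ex h'; have [v lv] := rep_ex l.
apply: (repE (rep_br (repD (repZ c hw) hw') lv) (repD (repZ c (rep_br hw lv)) (rep_br hw' lv))).
by rewrite (tbrDl p q v (kscale c w)) kscale_tbrl.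
Qed.

Lemma hbr_linr p q (h : Hco N p) : linear (hbr h : Hco N q -> _).
Proof.
move=> c l l'; have [w hw] := rep_ex h; have [v lv] := rep_ex l; have [v' lv'] := rep_ex l'.
apply: (repE (rep_br hw (repD (repZ c lv) lv')) (repD (repZ c (rep_br hw lv)) (rep_br hw lv'))).
by rewrite tbrDr kscale_tbrr.
Qed.

Lemma hmulA p q r (x : Hco N p) (y : Hco N q) (z : Hco N r) :
  degcast (Hco N) (p + q + r) (hmul x (hmul y z)) = hmul (hmul x y) z.
Proof.
have [a xa] := rep_ex x; have [b yb] := rep_ex y; have [c zc] := rep_ex z.
apply: (repE (rep_degcast (rep_mul xa (rep_mul yb zc)) _) (rep_mul (rep_mul xa yb) zc)).
  by left; rewrite addnA.
exact: mulrA.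
Qed.

Lemma hmul1x p (x : Hco N p) : hmul hone x = x.
Proof. by have [a xa] := rep_ex x; apply: (repE (rep_mul rep_one xa) xa); rewrite mul1r. Qed.

Lemma hmulx1 p (x : Hco N p) : degcast (Hco N) p (hmul x hone) = x.
Proof.
have [a xa] := rep_ex x; apply: (repE (rep_degcast (rep_mul xa rep_one) _) xa).
  by left; rewrite addn0.
by rewrite mulr1.
Qed.

Lemma hmulC p q (x : Hco N p) (y : Hco N q) :
  hmul x y = (-1) ^+ (p * q) *: degcast (Hco N) (p + q) (hmul y x).
Proof.
have [a xa] := rep_ex x; have [b yb] := rep_ex y.
apply: (rep_bdry (rep_mul xa yb) (rep_tsign _ (rep_degcast (rep_mul yb xa) _))).
  by left; rewrite addnC.
exact: bdry_comm (rep_homog xa) (rep_homog yb) (rep_cycle xa) (rep_cycle yb).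
Qed.

Lemma hbr00 (x y : Hco N 0) : hbr x y = 0.
Proof.
have [a xa] := rep_ex x; have [b yb] := rep_ex y.
by apply: (repE (rep_br xa yb) (rep0 _ _)); apply: tbr00 (rep_homog xa) (rep_homog yb).
Qed.

Lemma hbrC p q (x : Hco N p) (y : Hco N q) :
  hbr x y = - ((-1) ^+ (p.+1 * q.+1) *: degcast (Hco N) (p + q).-1 (hbr y x)).
Proof.
have [a xa] := rep_ex x; have [b yb] := rep_ex y.
apply: (repE (rep_br xa yb) (repN (rep_tsign _ (rep_degcast (rep_br yb xa) _)))).
  by left; rewrite addnC.
exact: tbrC.
Qed.

Lemma tbr_inner p q r (x y z : tot) : homog q y -> homog r z ->
  tbr p (q + r).-1 x (tbr q r y z) = tbr p (q + r).+1 x (tbr q r y z).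
Proof.
move=> yq zr; case: (tbr_deg yq zr) => [->|e]; last exact: tbr_odd.
by rewrite !(additive_fun0 (tbrDr _ _ _)).
Qed.

Lemma tbr_innerl p q r (x y z : tot) : homog q y -> homog r z ->
  tbr (q + r).-1 p (tbr q r y z) x = tbr (q + r).+1 p (tbr q r y z) x.
Proof.
move=> yq zr; case: (tbr_deg yq zr) => [->|e]; last exact: tbr_odd.
by rewrite !(additive_fun0 (tbrDl _ _ _)).
Qed.

(** Truncation spoils the degree only for q + r = 0, when the inner bracket is zero. *)
Lemma tbr_inner_deg p q r s (x y z : tot) : homog p x -> homog q y -> homog r z ->
  s = (p + q + r)%N ->
  ((p + (q + r).-1).-1 = s.-2 \/ tbr p (q + r).-1 x (tbr q r y z) = 0).
Proof.
move=> xp yq zr ->; case e : (q + r)%N => [|m].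
  by right; rewrite (tbr_deg0 yq zr e) (additive_fun0 (tbrDr _ _ _)).
by left; rewrite -addnA e addnS.
Qed.

Lemma h_jacobi p q r (x : Hco N p) (y : Hco N q) (z : Hco N r) :
  let J := @degcast k (Hco N) (p + q + r).-2 in
  J _ (hbr x (hbr y z)) =
  J _ (hbr (hbr x y) z) + (-1) ^+ (p.+1 * q.+1) *: J _ (hbr y (hbr x z)).
Proof.
have [a xa] := rep_ex x; have [b yb] := rep_ex y; have [c zc] := rep_ex z.
have [[ah bh] ch] := (rep_homog xa, rep_homog yb, rep_homog zc).
move=> J; apply: (repE (rep_degcast (rep_br xa (rep_br yb zc)) _)
  (repD (rep_degcast (rep_br (rep_br xa yb) zc) _)
    (rep_tsign _ (rep_degcast (rep_br yb (rep_br xa zc)) _)))).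
- exact: tbr_inner_deg.
- case e : (p + q)%N => [|m].
    by right; rewrite (tbr_deg0 ah bh e) (additive_fun0 (tbrDl _ _ _)).
  by left.
- by apply: tbr_inner_deg => //; rewrite [(q + p)%N]addnC.
- by rewrite !tbr_inner // tbr_innerl // tbr_jacobi.
Qed.

Lemma h_leibniz p q r (c : Hco N p) (x : Hco N q) (y : Hco N r) :
  let L := @degcast k (Hco N) (p + q + r).-1 in
  L _ (hbr c (hmul x y)) =
  L _ (hmul (hbr c x) y) + (-1) ^+ (p.+1 * q) *: L _ (hmul x (hbr c y)).
Proof.
have [a ca] := rep_ex c; have [b xb] := rep_ex x; have [d yd] := rep_ex y.
have [[ah bh] dh] := (rep_homog ca, rep_homog xb, rep_homog yd).
move=> L; apply: (rep_bdry (rep_degcast (rep_br ca (rep_mul xb yd)) _)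
  (repD (rep_degcast (rep_mul (rep_br ca xb) yd) _)
    (rep_tsign _ (rep_degcast (rep_mul xb (rep_br ca yd)) _)))).
- by left; rewrite addnA.
- case e : (p + q)%N => [|m]; last by left.
  by right; rewrite (tbr_deg0 ah bh e) mul0r.
- case e : (p + r)%N => [|m]; first by right; rewrite (tbr_deg0 ah dh e) mulr0.
  by left; rewrite -[RHS]/((p + q + r).-1) addnAC e addSn addnC.
- exact: bdry_leibniz ah bh dh (rep_cycle ca) (rep_cycle xb) (rep_cycle yd).
Qed.

Definition cobar_gerstenhaber : gerstenhaber (Hco N) :=
  Gerstenhaber hmul_linl hmul_linr hmulA hmul1x hmulx1 hmulC hbr_linl hbr_linr hbr00 hbrC
    h_jacobi h_leibniz.

Lemma has_class_rep p (x : Cco N p) (h : Hco N p) :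
  has_class (C := cobar N) (x : cobar N p) h <-> rep h (tin x).
Proof.
split=> [xh|[y [yh /dinj_inj e]]]; first by exists x.
by rewrite e.
Qed.
End GerstenhaberCohomology.

(** * Transport of a Gerstenhaber structure along isomorphisms *)

Section Transport.
Variables (k : comPzRingType) (V W : nat -> lmodType k) (G : gerstenhaber W).
Variables (f : forall n, {linear V n -> W n}) (g : forall n, W n -> V n).
Hypotheses (fK : forall n, cancel (f n) (@g n)) (gK : forall n, cancel (@g n) (f n)).

Lemma transport_degcast m n (x : V m) : f n (degcast V n x) = degcast W n (f m x).
Proof.
have [e|/eqP e] := eqVneq m n; first by case: n / e; rewrite !degcast_id.
by rewrite !degcast_neq ?raddf0.
Qed.

Let f_inj n : injective (f n) := can_inj (@fK n).

Lemma gerstenhaber_transport : exists G' : gerstenhaber V, gerstenhaber_morphism G' G f.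
Proof.
pose mul p q (x : V p) (y : V q) : V (p + q)%N := g (g_mul G (f p x) (f q y)).
pose br p q (x : V p) (y : V q) : V (p + q).-1 := g (g_br G (f p x) (f q y)).
have fmul p q x y : f (p + q)%N (mul p q x y) = g_mul G (f p x) (f q y) by apply: gK.
have fbr p q x y : f (p + q).-1 (br p q x y) = g_br G (f p x) (f q y) by apply: gK.
have ml p q (y : V q) : linear (fun x : V p => mul p q x y).
  move=> c x x'; apply: f_inj; rewrite fmul !linearP !fmul; exact: g_mul_linl.
have mr p q (x : V p) : linear (mul p q x).
  move=> c y y'; apply: f_inj; rewrite fmul !linearP !fmul; exact: g_mul_linr.
have mA p q r x y z : degcast V (p + q + r) (mul p (q + r)%N x (mul q r y z)) =
    mul (p + q)%N r (mul p q x y) z.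
  by apply: f_inj; rewrite transport_degcast !fmul g_mulA.
have m1x p x : mul 0%N p (g (g_one G)) x = x.
  by apply: f_inj; rewrite (fmul 0%N) gK g_mul1x.
have mx1 p x : degcast V p (mul p 0%N x (g (g_one G))) = x.
  by apply: f_inj; rewrite transport_degcast fmul gK g_mulx1.
have mC p q x y : mul p q x y = (-1) ^+ (p * q) *: degcast V (p + q) (mul q p y x).
  by apply: f_inj; rewrite linearZZ transport_degcast !fmul g_mulC.
have bl p q (y : V q) : linear (fun x : V p => br p q x y).
  move=> c x x'; apply: f_inj; rewrite fbr !linearP !fbr; exact: g_br_linl.
have brr p q (x : V p) : linear (br p q x).
  move=> c y y'; apply: f_inj; rewrite fbr !linearP !fbr; exact: g_br_linr.
have b00 x y : br 0%N 0%N x y = 0.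
  by apply: f_inj; rewrite (fbr 0%N 0%N) raddf0 g_br00.
have bC p q x y : br p q x y = - ((-1) ^+ (p.+1 * q.+1) *: degcast V (p + q).-1 (br q p y x)).
  by apply: f_inj; rewrite linearN linearZZ transport_degcast !fbr g_brC.
have jac p q r x y z : let J := @degcast k V (p + q + r).-2 in
    J _ (br p _ x (br q r y z)) =
    J _ (br _ r (br p q x y) z) + (-1) ^+ (p.+1 * q.+1) *: J _ (br q _ y (br p r x z)).
  rewrite /=; apply: f_inj; rewrite linearD linearZZ !transport_degcast !fbr; exact: g_jacobi.
have lei p q r c x y : let L := @degcast k V (p + q + r).-1 in
    L _ (br p _ c (mul q r x y)) =
    L _ (mul _ r (br p q c x) y) + (-1) ^+ (p.+1 * q) *: L _ (mul q _ x (br p r c y)).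
  rewrite /=; apply: f_inj; rewrite linearD linearZZ !transport_degcast !fmul !fbr !fmul.
  exact: g_leibniz.
exists (Gerstenhaber ml mr mA m1x mx1 mC bl brr b00 bC jac lei).
by split; [apply: gK|apply: fmul|apply: fbr].
Qed.
End Transport.

(** * Double complexes *)

Section Correspondence.
Variables (R : pzRingType) (V W : lmodType R).

(** A linear relation that is total on both sides and matches S with T is as good as an isomorphism
    of quotients: two partners of one element differ by an element of the submodule. *)
Lemma quotient_correspondence (S : {pred V}) (T : {pred W})
    (Sc : GRing.submod_closed S) (Tc : GRing.submod_closed T) (C : V -> W -> Prop) :
  (forall a x x' y y', C x y -> C x' y' -> C (a *: x + x') (a *: y + y')) ->
  (forall x, exists y, C x y) -> (forall y, exists x, C x y) ->
  (forall x y, C x y -> x \in S <-> y \in T) ->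
  exists f : {linear quotmod Sc -> quotmod Tc}, bijective f.
Proof.
move=> Clin Cl Cr CST.
have CB x x' y y' : C x y -> C x' y' -> C (x - x') (y - y').
  by move=> xy xy'; have := Clin (-1) _ _ _ _ xy' xy; rewrite !scaleN1r ![- _ + _]addrC.
pose f (h : quotmod Sc) : quotmod Tc := quotmod_pi Tc (sval (cid (Cl (repr h)))).
have fE x y : C x y -> f (quotmod_pi Sc x) = quotmod_pi Tc y.
  rewrite /f; case: cid => y' /= xy' xy; apply/quotmod_piP/(CST _ _ (CB _ _ _ _ xy' xy)).
  by apply/quotmod_piP; rewrite /quotmod_pi reprK.
have flin : linear f.
  move=> a; elim/quotmod_ind=> x; elim/quotmod_ind=> x'.
  have [y xy] := Cl x; have [y' xy'] := Cl x'.
  have -> : a *: quotmod_pi Sc x + quotmod_pi Sc x' = quotmod_pi Sc (a *: x + x').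
    by rewrite quotmod_piD [in RHS]quotmod_piZ.
  rewrite (fE _ _ (Clin a _ _ _ _ xy xy')) (fE _ _ xy) (fE _ _ xy') quotmod_piD.
  by rewrite [in LHS]quotmod_piZ.
exists (mklinear flin).
pose g (h : quotmod Tc) : quotmod Sc := quotmod_pi Sc (sval (cid (Cr (repr h)))).
have gE x y : C x y -> g (quotmod_pi Tc y) = quotmod_pi Sc x.
  rewrite /g; case: cid => x' /= xy' xy; apply/quotmod_piP/(CST _ _ (CB _ _ _ _ xy' xy)).
  by apply/quotmod_piP; rewrite /quotmod_pi reprK.
exists g; elim/quotmod_ind=> x /=.
  by have [y xy] := Cl x; rewrite (fE _ _ xy) (gE _ _ xy).
by have [y xy] := Cr x; rewrite (gE _ _ xy) (fE _ _ xy).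
Qed.
End Correspondence.

(** Exactness is asked only away from the edges p = 0 for [dh] and q = 0 for [dv]; the kernels on
    these edges are the complexes to be compared. *)
Record double_complex (R : pzRingType) := DoubleComplex {
  dc :> nat -> nat -> lmodType R;
  dh : forall p q, {linear dc p q -> dc p.+1 q};
  dv : forall p q, {linear dc p q -> dc p q.+1};
  dh_dh : forall p q x, dh p.+1 q (dh p q x) = 0;
  dv_dv : forall p q x, dv p q.+1 (dv p q x) = 0;
  dh_dv : forall p q x, dh p q.+1 (dv p q x) = dv p.+1 q (dh p q x);
  dh_exact : forall p q x, dh p.+1 q x = 0 -> exists y, x = dh p q y;
  dv_exact : forall p q x, dv p q.+1 x = 0 -> exists y, x = dv p q y
}.

Definition dc_swap (R : pzRingType) (K : double_complex R) : double_complex R :=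
  @DoubleComplex R (fun p q => K q p) (fun p q => dv K q p) (fun p q => dh K q p)
    (fun p q => @dv_dv R K q p) (fun p q => @dh_dh R K q p)
    (fun p q x => esym (@dh_dv R K q p x))
    (fun p q => @dv_exact R K q p) (fun p q => @dh_exact R K q p).

Section DoubleComplex.
Variable R : pzRingType.
Implicit Type K : double_complex R.

Definition dcyc K p q (x : K p q) := dh K p q x = 0 /\ dv K p q x = 0.

(* Rows and columns are exact in positive degrees only, so on the two edges   *)
(* the images of dh o dv are replaced by these submodules.                    *)
Definition dbnd K p q : K p q -> Prop :=
  match p, q return K p q -> Prop with
  | 0, 0 => fun x => x = 0
  | 0, q'.+1 => fun x => exists2 y, dh K 0 q' y = 0 & x = dv K 0 q' y
  | p'.+1, 0 => fun x => exists2 y, dv K p' 0 y = 0 & x = dh K p' 0 y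
  | p'.+1, q'.+1 => fun x => exists y, x = dh K p' q'.+1 (dv K p' q' y)
  end.

Lemma dbnd_swap K p q (x : K p q) : dbnd (K := dc_swap K) (p := q) (q := p) x <-> dbnd x.
Proof.
case: p q x => [|p] [|q] x //=.
by split=> -[y ->]; exists y; rewrite dh_dv.
Qed.

(** If [dv z] equals [dv w] with w killed by [dh], then z - w is killed by [dv] and has the same
    image under [dh] as z, so exactness of [dv] applies to it. *)
Lemma dstep_bnd K p q (z : K p q) : dbnd (dv K p q z) -> dbnd (dh K p q z).
Proof.
have main w : dh K p q w = 0 -> dv K p q z = dv K p q w -> dbnd (dh K p q z).
  move=> dw e; have {e}e : dv K p q (z - w) = 0 by rewrite linearB e subrr.
  have -> : dh K p q z = dh K p q (z - w) by rewrite linearB dw subr0.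
  clear dw; case: q z w e => [|q] z w e; first by exists (z - w).
  by have [v ->] := dv_exact e; exists v.
case: p z main => [|p] z main; first by move=> [w dw e]; apply: main e.
move=> [w e]; apply: (main (dh K p q w)); first exact: dh_dh.
by rewrite e dh_dv.
Qed.

Lemma dstep_cyc K p q (x : K p q.+1) : dcyc x ->
  exists2 z, x = dv K p q z & dcyc (dh K p q z).
Proof.
move=> [dx ex]; have [z e] := dv_exact ex; exists z => //; split; first exact: dh_dh.
by rewrite -dh_dv -e.
Qed.

(* C induces an isomorphism between the modules dcyc / dbnd at (p, q) and at  *)
(* (p', q').                                                                  *)
Definition correspondence K p q p' q' (C : K p q -> K p' q' -> Prop) : Prop :=
  [/\ forall a x x' y y', C x y -> C x' y' -> C (a *: x + x') (a *: y + y'),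
      forall x, dcyc x -> exists2 y, C x y & dcyc y,
      forall y, dcyc y -> exists2 x, C x y & dcyc x
    & forall x y, C x y -> dbnd x <-> dbnd y].

(* dv z in K p q.+1 corresponds to dh z in K p.+1 q *)
Lemma diagonal_correspondence K q p m : m = (p + q)%N ->
  exists C : K p q -> K m 0%N -> Prop, correspondence C.
Proof.
elim: q p => [|q IH] p; first rewrite addn0 => ->.
  exists eq; split=> [a x x' y y' -> -> //|x xc|y yc|x y -> //]; first by exists x.
  by exists y.
rewrite -addSnnS => /IH[C [Clin Cl Cr Cb]].
exists (fun x y => exists2 z, x = dv K p q z & C (dh K p q z) y); split.
- move=> a x x' y y' [z -> zy] [z' -> zy']; exists (a *: z + z'); first by rewrite linearP.
  by rewrite linearP; apply: Clin.
- move=> x /dstep_cyc[z -> /Cl[y zy yc]]; exists y => //; by exists z.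
- move=> y /Cr[x xy xc].
  have [z e zc] := @dstep_cyc (dc_swap K) q p x (conj xc.2 xc.1).
  exists (dv K p q z); last by split; [apply: zc.2|apply: zc.1].
  by exists z => //; rewrite -[dh _ _ _ _]e.
- move=> x y [z -> zy]; rewrite -(Cb _ _ zy); split; first exact: dstep_bnd.
  move/dbnd_swap => b; apply/dbnd_swap; exact: (@dstep_bnd (dc_swap K) q p z b).
Qed.
End DoubleComplex.

Lemma quotmod_pi_eq0 (R : pzRingType) (V : lmodType R) (S : {pred V})
    (Sc : GRing.submod_closed S) (x : V) : quotmod_pi Sc x = 0 <-> x \in S.
Proof.
have pi0 : quotmod_pi Sc 0 = 0.
  by apply: (@addrI _ (quotmod_pi Sc 0)); rewrite -quotmod_piD !addr0.
by rewrite -pi0; split=> [/quotmod_piP|xS]; [|apply/quotmod_piP]; rewrite subr0.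
Qed.

(** * Cotor *)

Section FlatExactness.
Variables (S A : pzRingType) (M : bimod S A).

Definition image_pred (R : pzRingType) (V W : lmodType R) (f : {linear V -> W}) : {pred W} :=
  fun y => `[< exists x, y = f x >].

Lemma image_submod_closed (R : pzRingType) (V W : lmodType R) (f : {linear V -> W}) :
  GRing.submod_closed (image_pred f).
Proof.
split; first by apply/asboolP; exists 0; rewrite linear0.
move=> a _ _ /asboolP[x ->] /asboolP[y ->]; apply/asboolP; exists (a *: x + y).
by rewrite linearP.
Qed.

Hypothesis flat : forall (X Y : lmodType A) (f : {linear X -> Y}),
  injective f -> injective (tmap M f).

(** Factor g through Y / im f: the second map is injective, so by flatness an element killed by M
    (x) g already dies in M (x) (Y / im f). Right exactness then puts it in the image of M (x) f. *)
Lemma tmap_exact (X Y Z : lmodType A) (f : {linear X -> Y}) (g : {linear Y -> Z}) :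
  (forall y, g y = 0 <-> exists x, y = f x) ->
  forall w, tmap M g w = 0 <-> exists z, w = tmap M f z.
Proof.
move=> fg w; split=> [gw0|[z ->]]; last first.
  elim/tens_ind: z => [|z z' IH IH'|m x]; first by rewrite !linear0.
    by rewrite !linearD IH IH' addr0.
  by rewrite !tmap_ot (_ : g (f x) = 0) ?ot0r //; apply/fg; exists x.
pose Q := quotmod (image_submod_closed f).
pose pi := quotmod_pi (image_submod_closed f).
have pi_lin : linear (pi : Y -> Q).
  by move=> a x y; rewrite /pi quotmod_piD [in LHS]quotmod_piZ.
pose piL := mklinear pi_lin.
pose gb (h : Q) := g (repr h).
have gbE y : gb (pi y) = g y.
  apply/eqP; rewrite -subr_eq0 /gb -linearB; apply/eqP/fg/asboolP.
  rewrite -[`[< _ >]]/(_ \in image_pred f); apply/(quotmod_piP (image_submod_closed f)).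
  by rewrite /quotmod_pi reprK.
have gb_lin : linear gb.
  move=> a; elim/quotmod_ind=> x; elim/quotmod_ind=> y; rewrite -!/(pi _).
  by rewrite -pi_lin !gbE linearP.
have gb_inj : injective gb.
  elim/quotmod_ind=> x; elim/quotmod_ind=> y; rewrite -!/(pi _) !gbE => e.
  apply/(quotmod_piP (image_submod_closed f))/asboolP/fg; by rewrite linearB e subrr.
have pw0 : tmap M piL w = 0.
  apply: (flat (f := mklinear gb_lin) gb_inj); rewrite linear0 -[RHS]gw0.
  elim/tens_ind: (w) => [|z z' IH IH'|m y]; first by rewrite !linear0.
    by rewrite !linearD IH IH'.
  by rewrite !tmap_ot; congr ot; apply: gbE.
(* Right exactness: F induces a map from M (x) (Y / im f) to the cokernel of M (x) f, and [key] says
   that composing it with M (x) pi gives the projection. *)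
pose P := quotmod (image_submod_closed (tmap M f)).
pose F (m : M) (h : Q) : P := quotmod_pi (image_submod_closed (tmap M f)) (ot m (repr h)).
have FE m y : F m (pi y) = quotmod_pi (image_submod_closed (tmap M f)) (ot m y).
  have [x e] : exists x, repr (pi y) - y = f x.
    by apply/asboolP/(quotmod_piP (image_submod_closed f)); rewrite /quotmod_pi reprK.
  apply/quotmod_piP/asboolP; exists (ot m x); rewrite tmap_ot -e.
  by apply/eqP; rewrite subr_eq -otDr subrK.
have Fb : balanced F.
  split=> [m m'|m|m a]; elim/quotmod_ind=> y; rewrite -?/(pi _).
  - by rewrite !FE otDl quotmod_piD.
  - by elim/quotmod_ind=> y'; rewrite -?/(pi _) -quotmod_piD !FE otDr quotmod_piD.
  - by rewrite -[a *: _]quotmod_piZ !FE ot_bal.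
have key z : tsum (tmap M piL z) F = quotmod_pi (image_submod_closed (tmap M f)) z.
  elim/tens_ind: z => [|z z' IH IH'|m y].
  - rewrite linear0 tsum0 //; apply/esym/quotmod_pi_eq0; by case: (image_submod_closed (tmap M f)).
  - by rewrite linearD tsumD // IH IH' quotmod_piD.
  - by rewrite tmap_ot tsum_ot // FE.
have := key w; rewrite pw0 tsum0 // => /esym/quotmod_pi_eq0.
by move=> /asboolP.
Qed.
End FlatExactness.

(** * Functoriality of cobar complexes and acyclicity for injective comodules *)

Section IterateMap.
Variables (k : comPzRingType) (A U : kalgType k) (B : left_bialgebroid A U).

Fixpoint imap (X Y : lmodType A) (f : {linear X -> Y}) (p : nat) :
    {linear iterU B X p -> iterU B Y p} :=
  match p return {linear iterU B X p -> iterU B Y p} with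
  | 0 => f
  | q.+1 => tmap (bU B) (imap f q)
  end.

Lemma imap_exact (X Y Z : lmodType A) (f : {linear X -> Y}) (g : {linear Y -> Z}) p :
  right_flat B -> (forall y, g y = 0 <-> exists x, y = f x) ->
  forall w, imap g p w = 0 <-> exists z, w = imap f p z.
Proof. by move=> flat fg; elim: p => [|p IH] //; apply: tmap_exact flat _ _ _ _ _ IH. Qed.

Lemma imap_inj (X Y : lmodType A) (f : {linear X -> Y}) p :
  right_flat B -> injective f -> injective (imap f p).
Proof. by move=> flat fi; elim: p => [|p IH] //; apply: flat. Qed.

Lemma imap_coface (N P : left_comodule B) (f : {linear N -> P}) p i (x : Cco N p) :
  comodule_hom f -> (i <= p.+1)%N -> imap f p.+1 (coface i x) = coface i (imap f p x).
Proof.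
move=> fH; case: i => [|i] ip; first exact: tmap_ot.
elim: p i ip x => [|p IH] [|i] ip x //.
- exact/esym/fH.
- exact/esym/comul_id_nat.
- by apply: (@tmap_sq _ _ _ _ _ _ _ (cofaceS N p i) (imap f p.+1) (imap f p)
    (cofaceS P p i)) => y; apply: IH.
Qed.

Lemma imap_restr_linear (X Y : lmodType A) (f : {linear X -> Y}) p :
  linear (imap f p : restr (iterU B X p) -> restr (iterU B Y p)).
Proof. by move=> c x y; apply: (linearP (imap f p)). Qed.

Definition imapL (X Y : lmodType A) (f : {linear X -> Y}) p :
    {linear restr (iterU B X p) -> restr (iterU B Y p)} := mklinear (@imap_restr_linear X Y f p).

Lemma imap_cobar_d (N P : left_comodule B) (f : {linear N -> P}) p (x : Cco N p) :
  comodule_hom f ->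
  imapL f p.+1 (cobar_dL N p x) = cobar_dL P p (imapL f p x).
Proof.
move=> fH; rewrite [cobar_dL N p x]/(cobar_d x) /cobar_d linear_sum; apply: eq_bigr => i _.
by rewrite linearZZ; congr (_ *: _); apply: imap_coface => //; rewrite -ltnS.
Qed.

Section Cofree.
Variable X : lmodType A.

Lemma cofree_coact1 (z : Utens B X) :
  \tsum_(u, m <- comul_id B X z) counit B u *: m = z.
Proof.
have Cb := balUP (counit_balU B (Utens B X)).
elim/Utens_ind: z => [|z w IHz IHw|u x]; first by rewrite linear0 tsum0.
  by rewrite linearD tsumD // IHz IHw.
rewrite comul_id_ot tsum_bind //.
rewrite -[RHS](congr1 (fun u => uot B u x) (sw_counitl B u)) (morph_sw B (f := fun u => uot B u x)).
  by apply: eq_tsum => v w; rewrite tsum_ot // uot_src.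
by move=> v w; apply: otDl.
Qed.

Definition cofree : left_comodule B :=
  @LeftComodule k A U B (Utens B X) (comul_id B X) (@comul_idA k A U B X) cofree_coact1.
End Cofree.

Section Injective.
Variables (I : left_comodule B) (Iinj : injective_comodule I).

(** The coaction embeds I in the cofree comodule U (x) I, being injective by counitality;
    injectivity of I extends the identity along it. *)
Lemma coact_retract : exists r : {linear Utens B I -> I},
  (forall x, r (coact I x) = x) /\
  (forall z, coact I (r z) = tmap (bU B) r (comul_id B I z)).
Proof.
have hom_coact : comodule_hom (P := cofree I) (coact I) by move=> x; apply: coactA.
have inj_coact : injective (coact I) by move=> x y e; rewrite -[x]coact1 e coact1.
have hom_id : comodule_hom (N := I) (P := I) idfun.
  move=> x; rewrite [RHS](_ : _ = coact I x) //.
  elim/Utens_ind: (coact I x) => [|z w IHz IHw|u m]; first by rewrite linear0.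
    by rewrite linearD IHz IHw.
  exact: tmap_ot.
have [r [rH rK]] := Iinj (X := I) (Y := cofree I) hom_coact inj_coact hom_id.
by exists r.
Qed.

Section Homotopy.
Variable r : {linear Utens B I -> I}.
Hypotheses (rK : forall x, r (coact I x) = x)
  (rH : forall z, coact I (r z) = tmap (bU B) r (comul_id B I z)).

(** An extra codegeneracy: r is applied to the last copy of U together with I, which undoes the last
    coface. *)
Fixpoint chtpy (p : nat) : {linear Cco I p.+1 -> Cco I p} :=
  match p return {linear Cco I p.+1 -> Cco I p} with
  | 0 => r
  | q.+1 => tmap (bU B) (chtpy q)
  end.

Lemma chtpy_last p (x : Cco I p) : chtpy p (cofaceS I p p x) = x.
Proof.
elim: p x => [|p IH] x; first exact: rK.
elim/Utens_ind: x => [|z w IHz IHw|u m]; first by rewrite !linear0.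
  by rewrite !linearD IHz IHw.
by rewrite [LHS](congr1 _ (tmap_ot (cofaceS I p p) _ _)) [LHS]tmap_ot IH.
Qed.

Lemma chtpy_cofaceS p j (x : Cco I p.+1) : (j <= p)%N ->
  chtpy p.+1 (cofaceS I p.+1 j x) = cofaceS I p j (chtpy p x).
Proof.
elim: p j x => [|p IH] [|j] x jp //.
- exact/esym/comul_id_nat.
- by apply: (@tmap_sq _ _ _ _ _ _ _ (cofaceS I p.+1 j) (chtpy p.+1) (chtpy p)
    (cofaceS I p j)) => y; apply: IH.
Qed.

Lemma chtpy_restr_linear p : linear (chtpy p : restr (Cco I p.+1) -> restr (Cco I p)).
Proof. by move=> c x y; apply: (linearP (chtpy p)). Qed.

Lemma chtpy_cobar_d p (x : Cco I p.+1) :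
  chtpy p.+1 (cobar_d x) = (cobar_d (chtpy p x) : restr _) + (-1) ^+ p *: (x : restr _).
Proof.
pose h := mklinear (@chtpy_restr_linear p.+1).
rewrite -[LHS]/(h (cobar_d x)) /cobar_d linear_sum big_ord_recr; congr (_ + _).
  apply: eq_bigr => i _; rewrite linearZZ; congr (_ *: _).
  case: i => [[|i]] ip /=; first exact: tmap_ot.
  exact: chtpy_cofaceS.
rewrite linearZZ /= !exprS mulrA mulrNN !mulr1 mul1r; congr (_ *: _); exact: (chtpy_last x).
Qed.
End Homotopy.

(** The homotopy satisfies h d = d h + (-1)^p by [chtpy_cobar_d], so a cocycle x is the differential
    of -(-1)^p h x. *)
Lemma cobar_acyclic p (x : Cco I p.+1) :
  cobar_dL I p.+1 x = 0 -> exists y, x = cobar_dL I p y :> restr _.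
Proof.
have [r [rK rH]] := coact_retract; move=> dx; exists (- (-1) ^+ p *: (chtpy r p x : restr _)).
have := chtpy_cobar_d rK rH x; rewrite [cobar_d x](_ : _ = 0) // linear0 => /esym/eqP.
rewrite addr_eq0 => /eqP e; rewrite linearZZ.
rewrite (e : cobar_dL I p (chtpy r p x) = _).
by rewrite scalerN scaleNr opprK scalerA -expr2 sqrr_sign scale1r.
Qed.
End Injective.
End IterateMap.

(** * Comparison of Cotor with the cobar cohomology *)

Section CotorCobar.
Variables (k : comPzRingType) (A U : kalgType k) (B : left_bialgebroid A U).
Variables (N : left_comodule B) (I : injective_resolution N).
Hypothesis flat : right_flat B.

Let K (p q : nat) : lmodType k := restr (Cco (I q) p).
Let Kh p q : {linear K p q -> K p.+1 q} := cobar_dL (I q) p.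
Let Kv p q : {linear K p q -> K p q.+1} := imapL B (ir_d I q) p.

Fact resolution_hh p q (x : K p q) : Kh p.+1 q (Kh p q x) = 0.
Proof. exact: cobar_dd. Qed.
Fact resolution_vv p q (x : K p q) : Kv p q.+1 (Kv p q x) = 0.
Proof.
exact: (proj2 (imap_exact flat (@ir_exactS _ _ _ _ _ I q) (Kv p q x)) (ex_intro _ x (erefl _))).
Qed.
Fact resolution_hv p q (x : K p q) : Kh p q.+1 (Kv p q x) = Kv p.+1 q (Kh p q x).
Proof. by apply/esym/imap_cobar_d/ir_d_hom. Qed.
Fact resolution_h_exact p q (x : K p.+1 q) : Kh p.+1 q x = 0 -> exists y, x = Kh p q y.
Proof. exact: (cobar_acyclic (@ir_inj _ _ _ _ _ I q)). Qed.
Fact resolution_v_exact p q (x : K p q.+1) : Kv p q.+1 x = 0 -> exists y, x = Kv p q y.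
Proof. exact: (proj1 (imap_exact flat (@ir_exactS _ _ _ _ _ I q) x)). Qed.

Definition resolution_complex : double_complex k :=
  DoubleComplex resolution_hh resolution_vv resolution_hv resolution_h_exact resolution_v_exact.
Local Notation D := resolution_complex.

(** The isomorphism of A (x)_A X with X; its inverse is [base_ot]. *)
Definition base_val (X : lmodType A) (z : tens (bA A) X) : restr X :=
  \tsum_(a, x <- z) ((a : A) *: x).

Lemma base_bal (X : lmodType A) :
  balanced (M := bA A) (fun (a : bA A) (x : X) => (a : A) *: x : restr X).
Proof.
split=> [a b x|a x y|a b x]; first exact: (scalerDl x (a : A) (b : A)).
  exact: (scalerDr (a : A) x y).
by rewrite scalerA.
Qed.

Lemma base_val_linear (X : lmodType A) : linear (@base_val X).
Proof.
apply: tsum_linear; first exact: base_bal.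
by move=> c a x; rewrite -[RHS]/(kalg c *: ((a : A) *: x)) scalerA.
Qed.

Definition base_ot (X : lmodType A) (x : X) : tens (bA A) X := @ot _ _ (bA A) X (1 : A) x.

Lemma base_valK (X : lmodType A) (z : tens (bA A) X) : base_ot (base_val z : X) = z.
Proof.
elim/tens_ind: z => [|z w IHz IHw|a x].
- by rewrite /base_val tsum0; [apply: ot0r|apply: base_bal].
- rewrite -[in RHS]IHz -[in RHS]IHw -[RHS]otDr /base_val tsumD //; exact: base_bal.
- rewrite /base_val tsum_ot; last exact: base_bal.
  by rewrite /base_ot -ot_bal; congr ot; apply: mul1r.
Qed.

Lemma base_otK (X : lmodType A) (x : X) : base_val (base_ot x) = x.
Proof. by rewrite /base_val tsum_ot; [exact: (scale1r x)|exact: base_bal]. Qed.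

Lemma tmap_base_ot (X Y : lmodType A) (f : {linear X -> Y}) (x : X) :
  tmap (bA A) f (base_ot x) = base_ot (f x).
Proof. exact: tmap_ot. Qed.

Lemma base_val_tmap (X Y : lmodType A) (f : {linear X -> Y}) (z : tens (bA A) X) :
  base_val (tmap (bA A) f z) = f (base_val z).
Proof. by rewrite -[z in LHS]base_valK tmap_base_ot base_otK. Qed.

(** Under A (x)_A P = P, the cotensor product A [] P consists of the x whose coaction is 1 (x) x,
    the kernel of the first cobar differential. *)
Lemma cotensor_baseP (P : left_comodule B) (x : P) :
  base_ot x \in ker_pred (extL (@rcoact_tgt _ _ _ _ (base_comodule B)) P \-
                          tmap (base_comodule B) (coact P)) <->
  cobar_dL P 0 x = 0.
Proof.
have -> : cobar_dL P 0 x = (uot B 1 x : Utens B P) - coact P x :> restr (Utens B P).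
  rewrite [cobar_dL _ _ _]/(@cobar_d k A U B P 0 x) /cobar_d !big_ord_recl big_ord0 addr0.
  by rewrite expr0 expr1 scale1r scaleN1r.
have extE : extL (@rcoact_tgt _ _ _ _ (base_comodule B)) P (base_ot x) = base_ot (uot B 1 x).
  rewrite /extL /= /ext tsum_ot; last exact: (ext_bal (@rcoact_tgt _ _ _ _ (base_comodule B))).
  by rewrite /= /coA tgt1 tsum_ot //; apply: ext_bal_in.
have tE : tmap (base_comodule B) (coact P) (base_ot x) = base_ot (coact P x).
  exact: tmap_base_ot.
rewrite unfold_in [X in X == 0](_ : _ = base_ot (uot B 1 x) - base_ot (coact P x)); last first.
  by rewrite -extE -tE.
rewrite subr_eq0.
split=> [/eqP e|/eqP]; last by rewrite subr_eq0 => /eqP ->.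
have := congr1 (@base_val (Utens B P)) e; rewrite !base_otK => ->.
by rewrite subrr.
Qed.

Let cot q : lmodType k := cotensor (base_comodule B) (I q).

(** Embeds A [] I^q as the kernel of [dh] on the edge p = 0; dually, [cob_in] embeds the cobar
    complex of N as the kernel of [dv] on the edge q = 0. *)
Definition cot_in q (z : cot q) : D 0%N q := base_val (val z : tens (bA A) (I q)).

Lemma cot_in_linear q : linear (@cot_in q).
Proof. by move=> c z w; rewrite /cot_in -base_val_linear. Qed.

Lemma cot_in_inj q : injective (@cot_in q).
Proof.
move=> z w e; apply: val_inj.
by rewrite -[LHS](base_valK (X := I q)) -[RHS](base_valK (X := I q)); congr base_ot.
Qed.

Lemma cot_in_cyc q (x : D 0%N q) : dh D 0 q x = 0 <-> exists z, x = cot_in z.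
Proof.
split=> [/cotensor_baseP xk|[z ->]].
  by exists (Kernel xk); rewrite /cot_in base_otK.
by apply/cotensor_baseP; rewrite base_valK; apply: kervalP.
Qed.

Lemma cot_in_d q (z : cot q) :
  cot_in (cc_d (cotensor_complex (base_comodule B) I) q z) = dv D 0 q (cot_in z).
Proof. exact: base_val_tmap. Qed.

Definition cob_in p (x : cobar N p) : D p 0%N := imapL B (ir_aug I) p x.

Lemma cob_in_inj p : injective (@cob_in p).
Proof. exact: imap_inj flat (@ir_aug_inj _ _ _ _ _ I). Qed.

Lemma cob_in_cyc p (x : D p 0%N) : dv D p 0 x = 0 <-> exists z, x = cob_in z.
Proof. exact: (imap_exact flat (@ir_exact0 _ _ _ _ _ I)). Qed.

Lemma cob_in_d p (x : cobar N p) :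
  cob_in (cc_d (cobar N) p x) = dh D p 0 (cob_in x).
Proof. exact: (imap_cobar_d x (@ir_aug_hom _ _ _ _ _ I)). Qed.

Lemma cot_in_bnd n (z : cotensor_complex (base_comodule B) I n) :
  coboundary z <-> dbnd (K := D) (cot_in z).
Proof.
have L := @cot_in_linear; have in0 q : cot_in (0 : cot q) = 0.
  by rewrite -[LHS]/(mklinear (L q) 0) linear0.
case: n z => [|n] z /=.
  by split=> [->|e]; [exact: (in0 0%N)|apply: cot_in_inj; rewrite in0].
split=> [[y ->]|[x /cot_in_cyc[y ->] e]].
  by exists (cot_in y); [apply/cot_in_cyc; exists y|apply: cot_in_d].
by exists y; apply: cot_in_inj; rewrite cot_in_d.
Qed.

Lemma cob_in_bnd n (x : cobar N n) : coboundary x <-> dbnd (K := D) (cob_in x).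
Proof.
have in0 p : cob_in (0 : cobar N p) = 0 by rewrite /cob_in linear0.
case: n x => [|n] x /=.
  by split=> [->|e]; [exact: (in0 0%N)|apply: (@cob_in_inj 0%N); rewrite e in0].
split=> [[y ->]|[z /cob_in_cyc[y ->] e]].
  by exists (cob_in y); [apply/cob_in_cyc; exists y|apply: cob_in_d].
by exists y; apply: (@cob_in_inj n.+1); rewrite e; apply: (esym (cob_in_d y)).
Qed.

(** Bicycles modulo [dbnd] at (0, n) and at (n, 0) are the two cohomologies, and the zigzag relation
    along the antidiagonal matches them. *)
Lemma cotor_cobar n : exists f : {linear Cotor (base_comodule B) I n -> Hco N n}, bijective f.
Proof.
have [C [Clin Cl Cr Cb]] := @diagonal_correspondence k D n 0 n (esym (add0n n)).
pose R (z : cocycles (cotensor_complex (base_comodule B) I) n) (x : cocycles (cobar N) n) :=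
  C (cot_in (val z)) (cob_in (val x)).
apply: (@quotient_correspondence _ _ _ _ _ _ _ R).
- move=> a z z' x x' zx zx'; rewrite /R /= cot_in_linear /cob_in linearP; exact: Clin.
- move=> z; have zc : dcyc (K := D) (cot_in (val z)).
    split; first by apply/cot_in_cyc; exists (val z).
    have := kervalP z; rewrite unfold_in => /eqP e; rewrite -cot_in_d [cc_d _ _ _]e.
    by rewrite -[LHS]/(mklinear (@cot_in_linear n.+1) 0) linear0.
  have [y zy [dy ey]] := Cl _ zc; have [x yE] := (cob_in_cyc _).1 ey.
  have xk : x \in ker_pred (cc_d (cobar N) n).
    rewrite unfold_in; apply/eqP/cob_in_inj; rewrite cob_in_d -yE dy.
    by rewrite /cob_in linear0.
  by exists (Kernel xk); rewrite /R /= -yE.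
- move=> x; have xc : dcyc (K := D) (cob_in (val x)).
    split; last by apply/cob_in_cyc; exists (val x).
    have := kervalP x; rewrite unfold_in => /eqP e; rewrite -cob_in_d [cc_d _ _ _]e.
    by rewrite /cob_in linear0.
  have [y zy [dy ey]] := Cr _ xc; have [z yE] := (cot_in_cyc _).1 dy.
  have zk : z \in ker_pred (cc_d (cotensor_complex (base_comodule B) I) n).
    rewrite unfold_in; apply/eqP/cot_in_inj; rewrite cot_in_d -yE ey.
    by rewrite -[RHS]/(mklinear (@cot_in_linear n.+1) 0) linear0.
  by exists (Kernel zk); rewrite /R /= -yE.
- move=> z x zx; split=> /asboolP b; apply/asboolP.
    by apply/cob_in_bnd/(Cb _ _ zx)/cot_in_bnd.
  by apply/cot_in_bnd/(Cb _ _ zx)/cob_in_bnd.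
Qed.
End CotorCobar.

Theorem corollary3p8 (k : comPzRingType) (A U : kalgType k)
    (B : left_bialgebroid A U) (N : bc_yd_algebra B) :
  exists G : gerstenhaber (Hco N),
    [/\ has_class (C := cobar N) (n := 0%N) (yone N) (g_one G),
        forall (p q : nat) (x : Cco N p) (y : Cco N q) (h : Hco N p) (l : Hco N q),
          has_class (C := cobar N) x h -> has_class (C := cobar N) y l ->
          has_class (C := cobar N) (cup x y) (g_mul G h l),
        forall (p q : nat) (x : Cco N p) (y : Cco N q) (h : Hco N p) (l : Hco N q),
          has_class (C := cobar N) x h -> has_class (C := cobar N) y l ->
          has_class (C := cobar N) (bracket x y) (g_br G h l)
      & right_flat B ->
        forall I : injective_resolution N,
        exists (G' : gerstenhaber (Cotor (base_comodule B) I))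
               (f : forall n, {linear Cotor (base_comodule B) I n -> Hco N n}),
          (forall n, bijective (f n)) /\ gerstenhaber_morphism G' G f].
Proof.
exists (cobar_gerstenhaber N); split.
- by apply/has_class_rep; apply: (rep_one N).
- move=> p q x y h l /has_class_rep hx /has_class_rep ly; apply/has_class_rep.
  by rewrite -mul_tin; apply: rep_mul.
- move=> p q x y h l /has_class_rep hx /has_class_rep ly; apply/has_class_rep.
  by rewrite tin_bracket; apply: rep_br.
- move=> flat I; have fP n := cid (cotor_cobar I flat n).
  pose f n := sval (fP n); have fb n : bijective (f n) by apply: svalP (fP n).
  have gP n : {g | cancel (f n) g /\ cancel g (f n)}.
    by apply: cid; case: (fb n) => g fK gK; exists g.
  have [G' fG'] := gerstenhaber_transport (cobar_gerstenhaber N)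
    (fun n => (svalP (gP n)).1) (fun n => (svalP (gP n)).2).
  by exists G', f.
Qed.
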